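(* Let $k$ be a commutative ring with identity, let $H$ be a Hopf algebra over $k$ with bijective antipode $S$, and let $M$ be a stable anti-Yetter-Drinfeld $H$-module (left $H$-module and right $H$-comodule). Let $K^H_*(H,M)=\widehat{C^*_H(H,M)}$ be the cyclic dual of the cocyclic module $C^*_H(H,M)$, so that $K^H_n(H,M)=H^{\otimes(n+1)}\otimes_H M$, and let $C^H_*(H,M)$ be the cyclic module with $C_n^H(H,M)=M\Box_H H^{\otimes(n+1)}$. Then the maps $$\theta: H^{\otimes(n+1)}\otimes_H M\longrightarrow M\Box_H H^{\otimes(n+1)},\qquad n\ge 0,$$ induced by $$\theta(h_0\otimes h_1\otimes\cdots\otimes h_n\otimes m)= h_n^{(2)}m^{(0)}\otimes h_n^{(3)}m^{(1)}S(h_0^{(1)})\otimes h_0^{(2)}S(h_1^{(1)})\otimes h_1^{(2)}S(h_2^{(1)})\otimes\cdots\otimes h_{n-1}^{(2)}S(h_n^{(1)})$$ form an isomorphism of cyclic modules $$\theta: K_*^H(H,M)\longrightarrow C_*^H(H,M).$$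
   Context: Unadorned tensor products are over $k$. Sweedler notation: $\Delta(h)=h^{(1)}\otimes h^{(2)}$ for the coproduct of $H$, $\epsilon$ for the counit, and $\Delta_M(m)=m^{(0)}\otimes m^{(1)}\in M\otimes H$ for a right coaction. A left $H$-module and right $H$-comodule $M$ is an anti-Yetter-Drinfeld module if $\Delta_M(hm)=h^{(2)}m^{(0)}\otimes h^{(3)}m^{(1)}S(h^{(1)})$ for all $h\in H$, $m\in M$; it is stable if $m^{(1)}m^{(0)}=m$ for all $m\in M$. A cyclic module is a simplicial $k$-module $(X_n,\delta_i,\sigma_i)$ with $k$-linear operators $\tau_n:X_n\to X_n$ such that $\delta_i\tau_n=\tau_{n-1}\delta_{i-1}$ and $\sigma_i\tau_n=\tau_{n+1}\sigma_{i-1}$ for $1\le i\le n$, $\delta_0\tau_n=\delta_n$, $\sigma_0\tau_n=\tau_{n+1}^2\sigma_n$, and $\tau_n^{n+1}=\mathrm{id}$. A morphism (isomorphism) of cyclic modules is a family of $k$-linear maps (bijections) commuting with all $\delta_i,\sigma_i,\tau_n$. Cocyclic modules are defined dually, as cosimplicial modules with coface maps $d_i$, codegeneracies $s_i$ and cyclic operators $t_n$. Cyclic dual: for a cocyclic module $X=(X^n,d_i,s_i,t_n)$, the cyclic dual $\widehat X$ is the cyclic module with $\widehat X_n=X^n$, $\delta_i=s_{i-1}$ for $1\le i\le n$, $\delta_0=s_{n-1}t_n$, $\sigma_i=d_i$ for $0\le i\le n$, $\tau_n=t_n^{-1}$. The cocyclic module $C^*_H(H,M)$: $C^n_H(H,M)=H^{\otimes(n+1)}\otimes_H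 M$, where $H$ acts on $H^{\otimes(n+1)}$ on the right diagonally, $(h_0\otimes\cdots\otimes h_n)\cdot g=h_0g^{(1)}\otimes\cdots\otimes h_ng^{(n+1)}$. Its operators are induced by the following operators on $H^{\otimes(n+1)}\otimes M$ (it is known that they descend and give a cocyclic module): $d_i(h_0\otimes\cdots\otimes h_n\otimes m)=h_0\otimes\cdots\otimes h_i^{(1)}\otimes h_i^{(2)}\otimes\cdots\otimes h_n\otimes m$ for $0\le i\le n$; $d_{n+1}(h_0\otimes\cdots\otimes h_n\otimes m)=h_0^{(2)}\otimes h_1\otimes\cdots\otimes h_n\otimes h_0^{(1)}S^{-1}(m^{(1)})\otimes m^{(0)}$; $s_i(h_0\otimes\cdots\otimes h_n\otimes m)=h_0\otimes\cdots\otimes h_i\otimes\epsilon(h_{i+1})\otimes h_{i+2}\otimes\cdots\otimes h_n\otimes m$ for $0\le i\le n-1$ (the factor $h_{i+1}$ is removed); $t_n(h_0\otimes\cdots\otimes h_n\otimes m)=h_1\otimes\cdots\otimes h_n\otimes h_0S^{-1}(m^{(1)})\otimes m^{(0)}$. Consequently, in the cyclic dual $K^H_*(H,M)$, on classes of $h_0\otimes\cdots\otimes h_n\otimes m$: $\delta_i$ ($0\le i\le n$) applies $\epsilon$ to $h_i$, $\sigma_i$ ($0\le i\le n$) replaces $h_i$ by $h_i^{(1)}\otimes h_i^{(2)}$, and $\tau_n(h_0\otimes\cdots\otimes h_n\otimes m)=h_nm^{(1)}\otimes h_0\otimes\cdots\otimes h_{n-1}\otimes m^{(0)}$. The cyclic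 module $C^H_*(H,M)$: $C^H_n(H,M)=M\Box_H H^{\otimes(n+1)}$, where for a right comodule $M$ and a left comodule $N$ the cotensor product $M\Box_H N$ is the kernel of $\Delta_M\otimes\mathrm{id}-\mathrm{id}\otimes{}_N\Delta:M\otimes N\to M\otimes H\otimes N$, and $H^{\otimes(n+1)}$ carries the diagonal left coaction $h_0\otimes\cdots\otimes h_n\mapsto h_0^{(1)}\cdots h_n^{(1)}\otimes(h_0^{(2)}\otimes\cdots\otimes h_n^{(2)})$. Its operators are the restrictions of the following operators on $M\otimes H^{\otimes(n+1)}$ (it is known that they restrict and give a cyclic module): $\delta_i(m\otimes h_0\otimes\cdots\otimes h_n)=m\otimes h_0\otimes\cdots\otimes h_ih_{i+1}\otimes\cdots\otimes h_n$ for $0\le i\le n-1$; $\delta_n(m\otimes h_0\otimes\cdots\otimes h_n)=h_n^{(1)}m\otimes h_n^{(2)}h_0\otimes h_1\otimes\cdots\otimes h_{n-1}$; $\sigma_i(m\otimes h_0\otimes\cdots\otimes h_n)=m\otimes h_0\otimes\cdots\otimes h_i\otimes1\otimes h_{i+1}\otimes\cdots\otimes h_n$ for $0\le i\le n$; $\tau_n(m\otimes h_0\otimes\cdots\otimes h_n)=h_n^{(1)}m\otimes h_n^{(2)}\otimes h_0\otimes\cdots\otimes h_{n-1}$. It is known that $\theta$, defined on $H^{\otimes(n+1)}\otimes M$ by the displayed formula, takes values in $M\Box_H H^{\otimes(n+1)}$ and factors through $H^{\otimes(n+1)}\otimes_H M$. *)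

(* Defs.v *)
From HB Require Import structures.
From mathcomp Require Import all_boot all_algebra.
From mathcomp Require Import generic_quotient ring_quotient sesquilinear boolp.

Set Implicit Arguments.
Unset Strict Implicit.
Unset Printing Implicit Defensive.

Import GRing.Theory.
Local Open Scope ring_scope.
Local Open Scope quotient_scope.

Reserved Notation "U \ox V" (at level 40, left associativity).
Reserved Notation "u *t v" (at level 40, left associativity).

(* A finite formal sum of pure tensors is a sequence of pairs; coefficients
   are absorbed in the first component.  [tens_rel] is the congruence generated
   by commutativity and bilinearity. *)
Section Tensor.
Variables (k : comNzRingType) (U V : lmodType k).

Inductive tens_rel : seq (U * V) -> seq (U * V) -> Prop :=
| TensRefl s : tens_rel s s
| TensSym s t : tens_rel s t -> tens_rel t s
| TensTrans s t r : tens_rel s t -> tens_rel t r -> tens_rel s r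
| TensCat s s' t t' :
    tens_rel s s' -> tens_rel t t' -> tens_rel (s ++ t) (s' ++ t')
| TensCatC s t : tens_rel (s ++ t) (t ++ s)
| TensAddl u u' v : tens_rel [:: (u + u', v)] [:: (u, v); (u', v)]
| TensAddr u v v' : tens_rel [:: (u, v + v')] [:: (u, v); (u, v')]
| TensScale c u v : tens_rel [:: (c *: u, v)] [:: (u, c *: v)]
| TensZero v : tens_rel [:: (0, v)] [::].

Definition tens_eq (s t : seq (U * V)) : bool := `[< tens_rel s t >].

Lemma tens_eq_equiv : equiv_class_of tens_eq.
Proof.
split=> [s|s t|t s r].
- by apply/asboolP; exact: TensRefl.
- by apply/asboolP/asboolP => /TensSym.
- by move=> /asboolP st /asboolP tr; apply/asboolP; exact: TensTrans st tr.
Qed.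

Canonical tens_eq_equivRel := EquivRelPack tens_eq_equiv.
Canonical tens_eq_encModRel := defaultEncModRel tens_eq.

Definition tensor := {eq_quot tens_eq}.
HB.instance Definition _ : EqQuotient _ tens_eq tensor := EqQuotient.on tensor.
HB.instance Definition _ := Choice.on tensor.

Definition tclass (s : seq (U * V)) : tensor := \pi_tensor s.

Definition terms (x : tensor) : seq (U * V) := repr x.

Lemma termsK x : tclass (terms x) = x. Proof. exact: reprK. Qed.

Lemma tclassP s t : tclass s = tclass t <-> tens_rel s t.
Proof.
split=> [/eqmodP|st]; first by move/asboolP.
by apply/eqmodP/asboolP.
Qed.

Definition topp_seq (s : seq (U * V)) := [seq (- p.1, p.2) | p <- s].
Definition tscale_seq (c : k) (s : seq (U * V)) := [seq (c *: p.1, p.2) | p <- s].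

Definition tzero : tensor := tclass [::].
Definition tadd (x y : tensor) : tensor := tclass (terms x ++ terms y).
Definition topp (x : tensor) : tensor := tclass (topp_seq (terms x)).
Definition tscale (c : k) (x : tensor) : tensor :=
  tclass (tscale_seq c (terms x)).

Lemma terms_rel s : tens_rel (terms (tclass s)) s.
Proof. by apply/tclassP; rewrite termsK. Qed.

Lemma tens_rel_scale c s t :
  tens_rel s t -> tens_rel (tscale_seq c s) (tscale_seq c t).
Proof.
elim=> {s t} [s|s t _|s t r _ + _|s s' t t' _ IH _ IH'|s t|u u' v|u v v'|a u v|v].
- exact: TensRefl.
- exact: TensSym.
- exact: TensTrans.
- by rewrite /tscale_seq !map_cat; exact: TensCat.
- by rewrite /tscale_seq !map_cat; exact: TensCatC.
- by rewrite /= scalerDr; exact: TensAddl.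
- exact: TensAddr.
- by rewrite /= scalerA mulrC -scalerA; exact: TensScale.
- by rewrite /= scaler0; exact: TensZero.
Qed.

Lemma tclass_cat s t : tclass (s ++ t) = tadd (tclass s) (tclass t).
Proof. by apply/tclassP/TensSym/TensCat; exact: terms_rel. Qed.

Lemma tclass_scale c s : tclass (tscale_seq c s) = tscale c (tclass s).
Proof. by apply/tclassP/TensSym/tens_rel_scale/terms_rel. Qed.

Lemma topp_seqE s : topp_seq s = tscale_seq (- 1) s.
Proof. by apply: eq_map => p; rewrite scaleN1r. Qed.

Lemma toppE x : topp x = tscale (- 1) x.
Proof. by rewrite /topp topp_seqE. Qed.

Lemma taddA : associative tadd.
Proof.
by move=> x y z; rewrite -[x]termsK -[y]termsK -[z]termsK -!tclass_cat catA.
Qed.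

Lemma taddC : commutative tadd.
Proof. by move=> x y; apply/tclassP/TensCatC. Qed.

Lemma tadd0 : left_id tzero tadd.
Proof. by move=> x; rewrite -[x]termsK -tclass_cat. Qed.

Lemma tscaleDl x : {morph tscale^~ x : a b / a + b >-> tadd a b}.
Proof.
move=> a b; rewrite -[x]termsK -!tclass_scale -tclass_cat.
elim: (terms x) => [|p s IH]; first by [].
rewrite [LHS](tclass_cat [:: ((a + b) *: p.1, p.2)]) IH.
have -> : tclass [:: ((a + b) *: p.1, p.2)] =
    tclass [:: (a *: p.1, p.2); (b *: p.1, p.2)].
  by apply/tclassP; rewrite scalerDl; exact: TensAddl.
rewrite -tclass_cat; apply/tclassP => /=.
apply: (TensCat (TensRefl [:: _])); rewrite -cat_rcons -cats1 -catA.
rewrite -[X in tens_rel X _]/([:: (b *: p.1, p.2)] ++ (_ ++ _)) !catA.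
by apply: TensCat; [exact: TensCatC | exact: TensRefl].
Qed.

Lemma tscale0 x : tscale 0 x = tzero.
Proof.
rewrite -[x]termsK -tclass_scale; apply/tclassP.
elim: (terms x) => [|p s IH] /=; first exact: TensRefl.
by apply: (TensCat (s := [:: _]) (s' := [::])) IH; rewrite scale0r; exact: TensZero.
Qed.

Lemma tscale1 : left_id 1 tscale.
Proof.
move=> x; rewrite -[x]termsK -tclass_scale; congr tclass.
by rewrite /tscale_seq -[RHS]map_id; apply: eq_map => -[u v]; rewrite /= scale1r.
Qed.

Lemma taddN : left_inverse tzero topp tadd.
Proof. by move=> x; rewrite toppE -{2}[x]tscale1 -tscaleDl addNr tscale0. Qed.

HB.instance Definition _ := GRing.isZmodule.Build tensor taddA taddC tadd0 taddN.

Lemma tscaleA a b x : tscale a (tscale b x) = tscale (a * b) x.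
Proof.
rewrite -[x]termsK -!tclass_scale; congr tclass.
by rewrite /tscale_seq -map_comp; apply: eq_map => p; rewrite /= scalerA.
Qed.

Lemma tscaleDr : right_distributive tscale +%R.
Proof.
move=> c x y; rewrite -[x]termsK -[y]termsK -[_ + _]tclass_cat -!tclass_scale.
by rewrite /tscale_seq map_cat tclass_cat.
Qed.

HB.instance Definition _ :=
  GRing.Zmodule_isLmodule.Build k tensor tscaleA tscale1 tscaleDr tscaleDl.

Lemma tclassD s t : tclass (s ++ t) = tclass s + tclass t.
Proof. exact: tclass_cat. Qed.

Lemma tclassZ c s : tclass (tscale_seq c s) = c *: tclass s.
Proof. exact: tclass_scale. Qed.

Definition ptens (u : U) (v : V) : tensor := tclass [:: (u, v)].

Lemma ptens_bilinear : bilinear_for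
  (GRing.Scale.Law.clone _ _ *:%R _) (GRing.Scale.Law.clone _ _ *:%R _) ptens.
Proof.
have scl c u v : ptens (c *: u) v = c *: ptens u v by rewrite -tclassZ.
split=> [v c u u'|u c v v'] /=.
  by rewrite -scl -tclassD; apply/tclassP; exact: TensAddl.
have -> : c *: ptens u v = ptens u (c *: v).
  by rewrite -scl; apply/tclassP; exact: TensScale.
by rewrite -tclassD; apply/tclassP; exact: TensAddr.
Qed.

HB.instance Definition _ := bilinear_isBilinear.Build k U V tensor _ _ ptens ptens_bilinear.

Lemma tclassE s : tclass s = \sum_(p <- s) ptens p.1 p.2.
Proof.
elim: s => [|[u v] s IH]; first by rewrite big_nil.
by rewrite big_cons -IH -[_ :: _]cat1s tclassD.
Qed.

Lemma termsE x : x = \sum_(p <- terms x) ptens p.1 p.2.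
Proof. by rewrite -tclassE termsK. Qed.

End Tensor.

Notation "U \ox V" := (tensor U V) : type_scope.
Notation "u *t v" := (ptens u v) : ring_scope.

Definition is_bilinear (k : comNzRingType) (U V W : lmodType k)
    (f : U -> V -> W) : Prop :=
  (forall v, linear (f^~ v)) /\ (forall u, linear (f u)).

Section Lift.
Variables (k : comNzRingType) (U V W : lmodType k).

(* [terms x] is an arbitrary representative: for bilinear [f] the sum
   [\sum_(p <- terms x) f p.1 p.2] does not depend on it.  With [x] a coproduct
   or a coaction this sum is what Sweedler's notation stands for, [p.1] and
   [p.2] being the two legs. *)
Lemma terms_sum (f : U -> V -> W) (s : seq (U * V)) : is_bilinear f ->
  \sum_(p <- terms (\sum_(p <- s) p.1 *t p.2)) f p.1 p.2 =
  \sum_(p <- s) f p.1 p.2.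
Proof.
move=> [fl fr].
have fD u u' v : f (u + u') v = f u v + f u' v.
  by have := fl v 1 u u'; rewrite !scale1r.
have fD' u v v' : f u (v + v') = f u v + f u v'.
  by have := fr u 1 v v'; rewrite !scale1r.
have f0 v : f 0 v = 0 by apply: (addrI (f 0 v)); rewrite -fD !addr0.
have f0' u : f u 0 = 0 by apply: (addrI (f u 0)); rewrite -fD' !addr0.
have fZ c u v : f (c *: u) v = c *: f u v.
  by have := fl v c u 0; rewrite !addr0 f0 addr0.
have fZ' c u v : f u (c *: v) = c *: f u v.
  by have := fr u c v 0; rewrite !addr0 f0' addr0.
have inv (t r : seq (U * V)) : tens_rel t r ->
    \sum_(p <- t) f p.1 p.2 = \sum_(p <- r) f p.1 p.2.
  elim=> {t r} [t|t r _ ->|t r q _ -> _ ->|t t' r r' _ IH _ IH'|t r|u u' v|u v v'|c u v|v] //.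
  - by rewrite !big_cat IH IH'.
  - by rewrite !big_cat /= addrC.
  - by rewrite !big_cons !big_nil !addr0 fD.
  - by rewrite !big_cons !big_nil !addr0 fD'.
  - by rewrite !big_cons !big_nil !addr0 fZ fZ'.
  - by rewrite big_cons !big_nil addr0 f0.
by rewrite -tclassE; apply: inv; exact: terms_rel.
Qed.

Lemma terms_pure (f : U -> V -> W) u v : is_bilinear f ->
  \sum_(p <- terms (u *t v)) f p.1 p.2 = f u v.
Proof.
move=> bf; have := terms_sum [:: (u, v)] bf.
by rewrite !big_cons !big_nil !addr0.
Qed.

Lemma terms_linear (f : U -> V -> W) : is_bilinear f ->
  linear (fun x : U \ox V => \sum_(p <- terms x) f p.1 p.2).
Proof.
move=> bf c x y.
have -> : c *: x + y =
    \sum_(p <- tscale_seq c (terms x) ++ terms y) p.1 *t p.2.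
  by rewrite -tclassE tclassD tclassZ !termsK.
rewrite terms_sum // big_cat big_map /= scaler_sumr; congr (_ + _).
apply: eq_bigr => p _.
have /= := bf.1 p.2 c p.1 0; rewrite addr0 => ->.
suff -> : f 0 p.2 = 0 by rewrite addr0.
have /= := bf.1 p.2 1 0 0; rewrite !scale1r addr0 => f00.
by apply: (addrI (f 0 p.2)); rewrite addr0 -f00.
Qed.

Definition tlift_fun (f : U -> V -> W) (_ : is_bilinear f) (x : U \ox V) : W :=
  \sum_(p <- terms x) f p.1 p.2.

HB.instance Definition _ (f : U -> V -> W) (bf : is_bilinear f) :=
  GRing.isLinear.Build k (U \ox V) W _ (tlift_fun bf) (terms_linear bf).

Definition tlift (f : U -> V -> W) (bf : is_bilinear f) :
  {linear U \ox V -> W} := tlift_fun bf.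

Lemma tliftE (f : U -> V -> W) (bf : is_bilinear f) u v :
  tlift bf (u *t v) = f u v.
Proof. exact: terms_pure. Qed.

Lemma tensor_ext (f g : {linear U \ox V -> W}) :
  (forall u v, f (u *t v) = g (u *t v)) -> f =1 g.
Proof.
by move=> fg x; rewrite [x]termsE !linear_sum; apply: eq_bigr => p _; exact: fg.
Qed.

End Lift.

Lemma ptens_is_bilinear (k : comNzRingType) (U V : lmodType k) :
  is_bilinear (@ptens k U V).
Proof. by split=> [v|u] c x y; rewrite (linearPl, linearPr). Qed.

Section Map.
Variables (k : comNzRingType) (U V U' V' : lmodType k).
Variables (f : {linear U -> U'}) (g : {linear V -> V'}).

Lemma tmap_bilinear : is_bilinear (fun u v => f u *t g v).
Proof. by split=> [v|u] c x y /=; rewrite linearP (linearPl, linearPr). Qed.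

Definition tmap : {linear U \ox V -> U' \ox V'} := tlift tmap_bilinear.

Lemma tmapE u v : tmap (u *t v) = f u *t g v. Proof. exact: tliftE. Qed.
End Map.

Section Assoc.
Variables (k : comNzRingType) (U V W : lmodType k).

Lemma assoc_inner_bilinear (w : W) :
  is_bilinear (fun (u : U) (v : V) => u *t (v *t w)).
Proof. by split=> [v|u] c x y /=; rewrite ?linearPl ?linearPr. Qed.

Lemma assoc_bilinear :
  is_bilinear (fun (x : U \ox V) w => tlift (assoc_inner_bilinear w) x).
Proof.
split=> [w|x] c y z /=; first by rewrite linearP.
rewrite scaler_sumr -big_split; apply: eq_bigr => p _ /=.
by rewrite !linearPr.
Qed.

Definition tassoc : {linear (U \ox V) \ox W -> U \ox (V \ox W)} :=
  tlift assoc_bilinear.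

Lemma tassocE u v w : tassoc ((u *t v) *t w) = u *t (v *t w).
Proof. by rewrite /tassoc !tliftE. Qed.
End Assoc.

Arguments tassoc {k U V W}.

Section ModuleQuotient.
Variables (k : comNzRingType) (V : lmodType k) (P : {pred V}).

Definition submod_pred (subP : submod_closed P) : {pred V} := P.

HB.instance Definition _ (subP : submod_closed P) :=
  GRing.isSubmodClosed.Build k V (submod_pred subP) subP.

Variable subP : submod_closed P.
Local Notation quotP := (Quotient.quot (submod_pred subP)).

Definition modquot := quotP.
HB.instance Definition _ := GRing.Zmodule.on modquot.

Definition modcls (x : V) : modquot := \pi_quotP x.

Lemma modclsP x y : modcls x = modcls y <-> x - y \in P.
Proof.
rewrite -[_ \in P]/(_ \in submod_pred subP) Quotient.idealrBE.
by split=> [/eqP|/eqP].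
Qed.

Definition modquot_repr (x : modquot) : V := repr (x : quotP).

Lemma modquot_reprK x : modcls (modquot_repr x) = x.
Proof. exact: reprK. Qed.

Definition modquot_scale c (x : modquot) : modquot := modcls (c *: modquot_repr x).

Lemma modcls_scale c x : modcls (c *: x) = modquot_scale c (modcls x).
Proof.
apply/modclsP; rewrite -scalerBr -[_ \in P]/(_ \in submod_pred subP) rpredZ //.
by apply/modclsP; rewrite modquot_reprK.
Qed.

Lemma modclsD x y : modcls (x + y) = modcls x + modcls y.
Proof. exact: (@pi_addr _ _ _ _ _ quotP x y). Qed.

Lemma modquot_scaleA a b x :
  modquot_scale a (modquot_scale b x) = modquot_scale (a * b) x.
Proof. by rewrite -[x]modquot_reprK -!modcls_scale scalerA. Qed.

Lemma modquot_scale1 : left_id 1 modquot_scale.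
Proof. by move=> x; rewrite -[x]modquot_reprK -!modcls_scale scale1r. Qed.

Lemma modquot_scaleDr : right_distributive modquot_scale +%R.
Proof.
move=> c x y; rewrite -[x]modquot_reprK -[y]modquot_reprK.
by rewrite -modclsD -!modcls_scale scalerDr modclsD.
Qed.

Lemma modquot_scaleDl x : {morph modquot_scale^~ x : a b / a + b}.
Proof.
move=> a b; rewrite -[x]modquot_reprK.
by rewrite -!modcls_scale scalerDl modclsD.
Qed.

HB.instance Definition _ := GRing.Zmodule_isLmodule.Build k modquot
  modquot_scaleA modquot_scale1 modquot_scaleDr modquot_scaleDl.

Lemma modcls_linear : linear modcls.
Proof. by move=> c x y; rewrite modclsD modcls_scale. Qed.

HB.instance Definition _ := GRing.isLinear.Build k V modquot _ modcls modcls_linear.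

End ModuleQuotient.

Record hopfAlgebra (k : comNzRingType) := HopfAlgebra {
  hopf_alg :> algType k;
  comul : {linear hopf_alg -> hopf_alg \ox hopf_alg};
  counit : {scalar hopf_alg};
  antipode : {linear hopf_alg -> hopf_alg};
  comulA : forall h,
    tassoc (tmap comul idfun (comul h)) = tmap idfun comul (comul h);
  counitl : forall h, \sum_(p <- terms (comul h)) counit p.1 *: p.2 = h;
  counitr : forall h, \sum_(p <- terms (comul h)) counit p.2 *: p.1 = h;
  comul1 : comul 1 = 1 *t 1;
  comulM : forall g h, comul (g * h) =
    \sum_(p <- terms (comul g)) \sum_(q <- terms (comul h))
      (p.1 * q.1) *t (p.2 * q.2);
  counit1 : counit 1 = 1;
  counitM : forall g h, counit (g * h) = counit g * counit h;
  antipodel : forall h,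
    \sum_(p <- terms (comul h)) antipode p.1 * p.2 = (counit h)%:A;
  antipoder : forall h,
    \sum_(p <- terms (comul h)) p.1 * antipode p.2 = (counit h)%:A
}.

Arguments comul {k _}.
Arguments counit {k _}.
Arguments antipode {k _}.

(* Left H-module and right H-comodule, no compatibility being required. *)
Record modComod (k : comNzRingType) (H : hopfAlgebra k) := ModComod {
  mc_mod :> lmodType k;
  hact : {bilinear H -> mc_mod -> mc_mod};
  hact1 : forall m, hact 1 m = m;
  hactM : forall g h m, hact (g * h) m = hact g (hact h m);
  coact : {linear mc_mod -> mc_mod \ox H};
  coactA : forall m,
    tassoc (tmap coact idfun (coact m)) = tmap idfun comul (coact m);
  coact_counit : forall m, \sum_(p <- terms (coact m)) counit p.2 *: p.1 = m
}.

Arguments hact {k H _}.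
Arguments coact {k H _}.

Section Hopf.
Variables (k : comNzRingType) (H : hopfAlgebra k).
Local Notation S := (@antipode k H).

(* In the sum, h^(1) = p.1, h^(2) = q.1 and h^(3) = q.2. *)
Definition is_aYD (M : modComod H) : Prop := forall (h : H) (m : M),
  coact (hact h m) =
  \sum_(p <- terms (comul h)) \sum_(q <- terms (comul p.2))
    \sum_(r <- terms (coact m)) hact q.1 r.1 *t (q.2 * r.2 * S p.1).

Definition is_stable (M : modComod H) : Prop := forall m : M,
  \sum_(r <- terms (coact m)) hact r.2 r.1 = m.

(* [hpow n] is the (n+1)-st tensor power of [H]. *)
Fixpoint hpow (n : nat) : lmodType k :=
  if n is n'.+1 then (H \ox hpow n' : lmodType k) else (H : lmodType k).

(* h_0 \ox ... \ox h_n; only meant for [size h = n.+1]. *)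
Fixpoint hpure (n : nat) (h : seq H) : hpow n :=
  if n is n'.+1 then h`_0 *t hpure n' (behead h) else h`_0.

(* The families of pairs ((h_i^(1), h_i^(2)))_i indexed by the summands of the
   coproducts of all the entries of [h]. *)
Fixpoint sweedlers (h : seq H) : seq (seq (H * H)) :=
  if h is x :: h' then
    [seq p :: ps | p <- terms (comul x), ps <- sweedlers h']
  else [:: [::]].

Lemma comul_bilinear (W : lmodType k) (f : H -> H -> W) : is_bilinear f ->
  linear (fun h : H => \sum_(p <- terms (comul h)) f p.1 p.2).
Proof. by move=> bf c g h; rewrite linearP; exact: (terms_linear bf). Qed.

(* Diagonal right action: (h \ox x) g = h g^(1) \ox x g^(2). *)
Fixpoint diag_act (n : nat) : hpow n -> H -> hpow n :=
  match n with
  | 0 => fun h g => h * g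
  | n'.+1 => fun x g =>
      \sum_(p <- terms x) \sum_(q <- terms (comul g))
        (p.1 * q.1) *t diag_act p.2 q.2
  end.

Lemma diag_act_bilinear n : is_bilinear (@diag_act n).
Proof.
elim: n => [|n [IHl IHr]].
  split=> [g|h] c x y /=; first by rewrite mulrDl scalerAl.
  by rewrite mulrDr scalerAr.
split=> [g|x] c y z.
  apply: (terms_linear (f := fun h x => \sum_(q <- terms (comul g))
    (h * q.1) *t diag_act x q.2)).
  split=> [x|h] a u v /=; rewrite scaler_sumr -big_split; apply: eq_bigr => q _ /=.
    by rewrite mulrDl -scalerAl linearPl.
  by rewrite IHl linearPr.
rewrite /= scaler_sumr -big_split; apply: eq_bigr => p _.
apply: (comul_bilinear (f := fun a b => (p.1 * a) *t diag_act p.2 b)).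
split=> [b|a] d u v /=; first by rewrite mulrDr -scalerAr linearPl.
by rewrite IHr linearPr.
Qed.

Lemma diag_actE n (h g : H) (x : hpow n) :
  diag_act (n := n.+1) (h *t x) g =
  \sum_(q <- terms (comul g)) (h * q.1) *t diag_act x q.2.
Proof.
apply: (terms_pure (f := fun h x => \sum_(q <- terms (comul g))
  (h * q.1) *t diag_act x q.2)).
have [IHl IHr] := diag_act_bilinear n.
split=> [y|a] c u v /=; rewrite scaler_sumr -big_split; apply: eq_bigr => q _ /=.
  by rewrite mulrDl -scalerAl linearPl.
by rewrite IHl linearPr.
Qed.

(* (a \ox b, c \ox d) |-> a c \ox (b \ox d) *)
Definition mul_shuffle (V : lmodType k) (x : H \ox H) (y : H \ox V) :
    H \ox (H \ox V) :=
  \sum_(p <- terms x) \sum_(q <- terms y) (p.1 * q.1) *t (p.2 *t q.2).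

Lemma mul_shuffle_bilinear (V : lmodType k) : is_bilinear (@mul_shuffle V).
Proof.
split=> [y|x] c u v.
  apply: (terms_linear (f := fun a b =>
    \sum_(q <- terms y) (a * q.1) *t (b *t q.2))).
  split=> [b|a] e r s /=; rewrite scaler_sumr -big_split; apply: eq_bigr => q _ /=.
    by rewrite mulrDl -scalerAl linearPl.
  by rewrite !linearPl linearPr.
rewrite /mul_shuffle scaler_sumr -big_split; apply: eq_bigr => p _ /=.
apply: (terms_linear (f := fun c d => (p.1 * c) *t (p.2 *t d))).
split=> [b|a] e r s /=; first by rewrite mulrDr -scalerAr linearPl.
by rewrite !linearPr.
Qed.

Lemma diag_coact_step (V : lmodType k) (lam : {linear V -> H \ox V}) :
  is_bilinear (fun h x => mul_shuffle (comul h) (lam x)).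
Proof.
have [bl br] := mul_shuffle_bilinear V.
by split=> [x|h] c u v /=; rewrite linearP ?bl ?br.
Qed.

(* Diagonal left coaction: h_0 \ox ... \ox h_n |->
   h_0^(1) ... h_n^(1) \ox (h_0^(2) \ox ... \ox h_n^(2)). *)
Fixpoint diag_coact (n : nat) : {linear hpow n -> H \ox hpow n} :=
  match n with
  | 0 => comul
  | n'.+1 => tlift (diag_coact_step (diag_coact n'))
  end.

Lemma diag_coactE n (h : seq H) : size h = n.+1 ->
  diag_coact n (hpure n h) =
  \sum_(ps <- sweedlers h)
    (\prod_(p <- ps) p.1) *t hpure n [seq p.2 | p <- ps].
Proof.
elim: n h => [|n IH] [//|x h] [sh].
  case: h sh => // _; rewrite big_allpairs_dep [LHS]termsE.
  by apply: eq_bigr => p _; rewrite !big_seq1.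
rewrite big_allpairs_dep (tliftE (diag_coact_step _)) IH //.
apply: eq_bigr => p _.
pose F (c : H) (d : hpow n) := (p.1 * c) *t (p.2 *t d).
have bF : is_bilinear F.
  split=> [b|a] e r s; first by rewrite /F mulrDr -scalerAr linearPl.
  by rewrite /F !linearPr.
have := terms_sum [seq (\prod_(q <- ps) q.1, hpure n [seq q.2 | q <- ps])
  | ps <- sweedlers h] bF.
rewrite !big_map /= => ->; apply: eq_bigr => ps _.
by rewrite /F big_cons.
Qed.

End Hopf.

Arguments hpure {k H}.
Arguments sweedlers {k H}.
Arguments diag_act {k H n}.
Arguments diag_coact {k H}.

Section Balanced.
Variables (k : comNzRingType) (H : hopfAlgebra k) (N : lmodType k).
Variables (ract : N -> H -> N) (M : modComod H).

Definition bal_relator (p : N * H * M) : N \ox M :=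
  ract p.1.1 p.1.2 *t p.2 - p.1.1 *t hact p.1.2 p.2.

(* The k-span of the x g \ox m - x \ox g m. *)
Definition bal_span : {pred N \ox M} := fun z =>
  `[< exists s : seq (k * (N * H * M)),
        z = \sum_(p <- s) p.1 *: bal_relator p.2 >].

Lemma bal_span_closed : submod_closed bal_span.
Proof.
split=> [|c x y /asboolP[s ->] /asboolP[t ->]]; apply/asboolP.
  by exists [::]; rewrite big_nil.
exists ([seq (c * p.1, p.2) | p <- s] ++ t).
rewrite big_cat big_map scaler_sumr; congr (_ + _).
by apply: eq_bigr => p _; rewrite scalerA.
Qed.

Definition baltensor : lmodType k := modquot bal_span_closed.

Definition balcls (x : N \ox M) : baltensor := modcls bal_span_closed x.

End Balanced.

Arguments baltensor {k H N} ract M.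
Arguments balcls {k H N} ract M x.

Section Cotensor.
Variables (k : comNzRingType) (H : hopfAlgebra k) (M N : lmodType k).
Variables (rho : {linear M -> M \ox H}) (lam : {linear N -> H \ox N}).

(* M \ox H \ox N is bracketed to the right. *)
Definition cotens_pred : {pred M \ox N} := fun z =>
  tassoc (tmap rho idfun z) == tmap idfun lam z.

Lemma cotens_closed : submod_closed cotens_pred.
Proof.
split=> [|c x y /eqP xP /eqP yP]; apply/eqP; first by rewrite !linear0.
by rewrite !linearP -xP -yP.
Qed.

HB.instance Definition _ :=
  GRing.isSubmodClosed.Build k (M \ox N) cotens_pred cotens_closed.

Record cotensor := Cotensor { cot_val : M \ox N; _ : cot_val \in cotens_pred }.
HB.instance Definition _ := [isSub for cot_val].
HB.instance Definition _ := [Choice of cotensor by <:].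
HB.instance Definition _ := [SubChoice_isSubLmodule of cotensor by <:].

End Cotensor.

(* Operators are indexed by all of [nat]; only those with the index in the range
   indicated are part of the structure. *)
Record cyclicModule (k : comNzRingType) (X : nat -> lmodType k) := CyclicModule {
  face : forall n (i : nat), {linear X n.+1 -> X n};  (* 0 <= i <= n+1 *)
  degen : forall n (i : nat), {linear X n -> X n.+1}; (* 0 <= i <= n *)
  cyc : forall n, {linear X n -> X n};
  face_face : forall n i j x, (i < j <= n.+2)%N ->
    face n i (face n.+1 j x) = face n j.-1 (face n.+1 i x);
  degen_degen : forall n i j x, (i <= j <= n)%N ->
    degen n.+1 i (degen n j x) = degen n.+1 j.+1 (degen n i x);
  face_degen_lt : forall n i j x, (i < j <= n.+1)%N ->
    face n.+1 i (degen n.+1 j x) = degen n j.-1 (face n i x);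
  face_degen_eq : forall n j x, (j <= n)%N -> face n j (degen n j x) = x;
  face_degen_eqS : forall n j x, (j <= n)%N -> face n j.+1 (degen n j x) = x;
  face_degen_gt : forall n i j x, (j.+1 < i <= n.+2)%N ->
    face n.+1 i (degen n.+1 j x) = degen n j (face n i.-1 x);
  face_cyc : forall n i x, (0 < i <= n.+1)%N ->
    face n i (cyc n.+1 x) = cyc n (face n i.-1 x);
  face0_cyc : forall n x, face n 0 (cyc n.+1 x) = face n n.+1 x;
  degen_cyc : forall n i x, (0 < i <= n)%N ->
    degen n i (cyc n x) = cyc n.+1 (degen n i.-1 x);
  degen0_cyc : forall n x,
    degen n 0 (cyc n x) = cyc n.+1 (cyc n.+1 (degen n n x));
  cyc_order : forall n x, iter n.+1 (cyc n) x = x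
}.

Record cocyclicModule (k : comNzRingType) (X : nat -> lmodType k) :=
  CocyclicModule {
  coface : forall n (i : nat), {linear X n -> X n.+1};  (* 0 <= i <= n+1 *)
  codegen : forall n (i : nat), {linear X n.+1 -> X n}; (* 0 <= i <= n *)
  cocyc : forall n, {linear X n -> X n};
  coface_coface : forall n i j x, (i < j <= n.+2)%N ->
    coface n.+1 j (coface n i x) = coface n.+1 i (coface n j.-1 x);
  codegen_codegen : forall n i j x, (i <= j <= n)%N ->
    codegen n j (codegen n.+1 i x) = codegen n i (codegen n.+1 j.+1 x);
  codegen_coface_lt : forall n i j x, (i < j <= n.+1)%N ->
    codegen n.+1 j (coface n.+1 i x) = coface n i (codegen n j.-1 x);
  codegen_coface_eq : forall n j x, (j <= n)%N -> codegen n j (coface n j x) = x;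
  codegen_coface_eqS : forall n j x, (j <= n)%N ->
    codegen n j (coface n j.+1 x) = x;
  codegen_coface_gt : forall n i j x, (j.+1 < i <= n.+2)%N ->
    codegen n.+1 j (coface n.+1 i x) = coface n i.-1 (codegen n j x);
  cocyc_coface : forall n i x, (0 < i <= n.+1)%N ->
    cocyc n.+1 (coface n i x) = coface n i.-1 (cocyc n x);
  cocyc_coface0 : forall n x, cocyc n.+1 (coface n 0 x) = coface n n.+1 x;
  cocyc_codegen : forall n i x, (0 < i <= n)%N ->
    cocyc n (codegen n i x) = codegen n i.-1 (cocyc n.+1 x);
  cocyc_codegen0 : forall n x,
    cocyc n (codegen n 0 x) = codegen n n (cocyc n.+1 (cocyc n.+1 x));
  cocyc_order : forall n x, iter n.+1 (cocyc n) x = x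
}.

Section CyclicDual.
Variables (k : comNzRingType) (X : nat -> lmodType k) (C : cocyclicModule X).

(* The inverse of [cocyc C n], which has order dividing [n.+1]. *)
Definition cocyc_inv n (x : X n) : X n := iter n (cocyc C n) x.

Lemma cocycK n : cancel (cocyc C n) (@cocyc_inv n).
Proof. by move=> x; rewrite /cocyc_inv -iterSr cocyc_order. Qed.

Lemma cocyc_invK n : cancel (@cocyc_inv n) (cocyc C n).
Proof. by move=> x; rewrite /cocyc_inv -iterS cocyc_order. Qed.

Lemma cocyc_inv_linear n : linear (@cocyc_inv n).
Proof.
move=> c x y; apply: (can_inj (@cocycK n)).
by rewrite linearP !cocyc_invK.
Qed.

HB.instance Definition _ n :=
  GRing.isLinear.Build k (X n) (X n) _ (@cocyc_inv n) (@cocyc_inv_linear n).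

Definition dual_face n (i : nat) : {linear X n.+1 -> X n} :=
  if i is i'.+1 then codegen C n i' else codegen C n n \o cocyc C n.+1.

Definition dual_degen n (i : nat) : {linear X n -> X n.+1} := coface C n i.

Definition dual_cyc n : {linear X n -> X n} := @cocyc_inv n.

Lemma dual_face_face n i j x : (i < j <= n.+2)%N ->
  dual_face n i (dual_face n.+1 j x) = dual_face n j.-1 (dual_face n.+1 i x).
Proof.
move=> /andP[]; case: i j => [|i] [|[|j]] // ij jn /=.
- rewrite (cocyc_codegen0 C) (cocyc_codegen C) ?leqnn //.
  by rewrite [RHS](codegen_codegen C) ?leqnn.
- by rewrite (cocyc_codegen C) //= (codegen_codegen C) // leqnn andbT.
- by rewrite [RHS](codegen_codegen C) //; apply/andP.
Qed.

Lemma dual_degen_degen n i j x : (i <= j <= n)%N ->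
  dual_degen n.+1 i (dual_degen n j x) =
  dual_degen n.+1 j.+1 (dual_degen n i x).
Proof.
move=> /andP[ij jn]; rewrite /dual_degen [RHS](coface_coface C) //.
by rewrite ltnS ij !ltnS; apply: leqW.
Qed.

Lemma dual_face_degen_lt n i j x : (i < j <= n.+1)%N ->
  dual_face n.+1 i (dual_degen n.+1 j x) = dual_degen n j.-1 (dual_face n i x).
Proof.
move=> /andP[]; case: i j => [|i] [|j] // ij jn; rewrite /dual_degen /=.
  by rewrite (cocyc_coface C) ?(codegen_coface_lt C) //= ?ltnS ?leqnn ?andbT // leqW.
by rewrite (codegen_coface_gt C) // ij /= !ltnS leqW.
Qed.

Lemma dual_face_degen_eq n j x : (j <= n)%N ->
  dual_face n j (dual_degen n j x) = x.
Proof.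
case: j => [|j] jn; rewrite /dual_degen /=.
  by rewrite (cocyc_coface0 C) (codegen_coface_eqS C).
by rewrite (codegen_coface_eqS C) // ltnW.
Qed.

Lemma dual_face_degen_eqS n j x : (j <= n)%N ->
  dual_face n j.+1 (dual_degen n j x) = x.
Proof. exact: (codegen_coface_eq C). Qed.

Lemma dual_face_degen_gt n i j x : (j.+1 < i <= n.+2)%N ->
  dual_face n.+1 i (dual_degen n.+1 j x) = dual_degen n j (dual_face n i.-1 x).
Proof.
by case: i => [|[|i]] //= ij; rewrite /dual_degen (codegen_coface_lt C).
Qed.

Lemma dual_face_cyc n i x : (0 < i <= n.+1)%N ->
  dual_face n i (dual_cyc n.+1 x) = dual_cyc n (dual_face n i.-1 x).
Proof.
case: i => [|[|i]] //= ij; apply: (can_inj (@cocycK n)); rewrite cocyc_invK.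
  by rewrite (cocyc_codegen0 C) cocyc_invK.
by rewrite (cocyc_codegen C) // cocyc_invK.
Qed.

Lemma dual_face0_cyc n x :
  dual_face n 0 (dual_cyc n.+1 x) = dual_face n n.+1 x.
Proof. by rewrite /= cocyc_invK. Qed.

Lemma dual_degen_cyc n i x : (0 < i <= n)%N ->
  dual_degen n i (dual_cyc n x) = dual_cyc n.+1 (dual_degen n i.-1 x).
Proof.
move=> /andP[i0 ij]; apply: (can_inj (@cocycK n.+1)); rewrite /dual_degen.
by rewrite cocyc_invK (cocyc_coface C) ?i0 1?leqW // cocyc_invK.
Qed.

Lemma dual_degen0_cyc n x : dual_degen n 0 (dual_cyc n x) =
  dual_cyc n.+1 (dual_cyc n.+1 (dual_degen n n x)).
Proof.
apply: (can_inj (@cocycK n.+1)); apply: (can_inj (@cocycK n.+1)).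
by rewrite !cocyc_invK (cocyc_coface0 C) (cocyc_coface C) ?leqnn // cocyc_invK.
Qed.

Lemma dual_cyc_order n x : iter n.+1 (dual_cyc n) x = x.
Proof.
have K m : iter m (dual_cyc n) (iter m (cocyc C n) x) = x.
  by elim: m => // m IH; rewrite iterSr iterS /= cocycK.
by rewrite -{1}[x](cocyc_order C) K.
Qed.

Definition cyclic_dual : cyclicModule X := CyclicModule
  dual_face_face dual_degen_degen dual_face_degen_lt dual_face_degen_eq
  dual_face_degen_eqS dual_face_degen_gt dual_face_cyc dual_face0_cyc
  dual_degen_cyc dual_degen0_cyc dual_cyc_order.

End CyclicDual.

Definition cyclic_iso (k : comNzRingType) (X Y : nat -> lmodType k)
    (C : cyclicModule X) (D : cyclicModule Y)
    (f : forall n, {linear X n -> Y n}) : Prop :=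
  [/\ forall n, bijective (f n),
      forall n i x, (i <= n.+1)%N -> f n (face C n i x) = face D n i (f n.+1 x),
      forall n i x, (i <= n)%N -> f n.+1 (degen C n i x) = degen D n i (f n x)
    & forall n x, f n (cyc C n x) = cyc D n (f n x)].

Section HopfCyclic.
Variables (k : comNzRingType) (H : hopfAlgebra k) (M : modComod H).
Local Notation S := (@antipode k H).

Definition CH_mod (n : nat) : lmodType k := baltensor (@diag_act k H n) M.

(* The class of h_0 \ox ... \ox h_n \ox m. *)
Definition CH_cls (n : nat) (h : seq H) (m : M) : CH_mod n :=
  balcls (@diag_act k H n) M (hpure n h *t m).

Lemma hpow_ext (V : lmodType k) n (f g : {linear hpow H n -> V}) :
  (forall h : seq H, size h = n.+1 -> f (hpure n h) = g (hpure n h)) -> f =1 g.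
Proof.
elim: n V f g => [|n IH] V f g fg; first by move=> x; exact: (fg [:: x]).
apply: tensor_ext => a.
have lin (e : {linear hpow H n.+1 -> V}) :
    linear (fun y : hpow H n => e (a *t y : hpow H n.+1)).
  by move=> c x y; rewrite linearPr linearP.
pose lin_at (e : {linear hpow H n.+1 -> V}) : {linear hpow H n -> V} :=
  HB.pack (fun y : hpow H n => e (a *t y : hpow H n.+1))
    (GRing.isLinear.Build k (hpow H n) V _ _ (lin e)).
by apply: (IH _ (lin_at f) (lin_at g)) => h sh; apply: (fg (a :: h)); rewrite /= sh.
Qed.

(* Hence the operators below and the maps [theta] are determined by the values
   prescribed for them. *)
Lemma CH_mod_ext (V : lmodType k) n (f g : {linear CH_mod n -> V}) :
  (forall (h : seq H) m, size h = n.+1 ->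
     f (CH_cls n h m) = g (CH_cls n h m)) -> f =1 g.
Proof.
move=> fg x; rewrite -[x]modquot_reprK; move: (modquot_repr x).
pose cl : {linear hpow H n \ox M -> CH_mod n} :=
  modcls (bal_span_closed (@diag_act k H n) M).
apply: (tensor_ext (f := f \o cl) (g := g \o cl)) => y m; move: y.
have lin (e : {linear CH_mod n -> V}) :
    linear (fun y : hpow H n => e (cl (y *t m))).
  by move=> c u v; rewrite linearPl !linearP.
pose lin_at (e : {linear CH_mod n -> V}) : {linear hpow H n -> V} :=
  HB.pack (fun y : hpow H n => e (cl (y *t m)))
    (GRing.isLinear.Build k (hpow H n) V _ _ (lin e)).
by apply: (hpow_ext (f := lin_at f) (g := lin_at g)) => h sh; exact: fg.
Qed.

Definition cot_mod (n : nat) : lmodType k :=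
  cotensor (@coact k H M) (diag_coact n).

(* [X] has the operators of C^*_H(H,M), [Sinv] being the inverse of the
   antipode.  They are specified on the classes of pure tensors, which generate
   [CH_mod n]. *)
Record has_CH_operators (Sinv : H -> H) (X : cocyclicModule CH_mod) : Prop := {
  CH_coface : forall n (h : seq H) (m : M) i, size h = n.+1 -> (i <= n)%N ->
    coface X n i (CH_cls n h m) =
    \sum_(p <- terms (comul h`_i))
      CH_cls n.+1 (take i h ++ [:: p.1, p.2 & drop i.+1 h]) m;
  CH_coface_last : forall n (h : seq H) (m : M), size h = n.+1 ->
    coface X n n.+1 (CH_cls n h m) =
    \sum_(p <- terms (comul h`_0)) \sum_(r <- terms (coact m))
      CH_cls n.+1 (p.2 :: rcons (behead h) (p.1 * Sinv r.2)) r.1;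
  CH_codegen : forall n (h : seq H) (m : M) i, size h = n.+2 -> (i <= n)%N ->
    codegen X n i (CH_cls n.+1 h m) =
    counit h`_i.+1 *: CH_cls n (take i.+1 h ++ drop i.+2 h) m;
  CH_cocyc : forall n (h : seq H) (m : M), size h = n.+1 ->
    cocyc X n (CH_cls n h m) =
    \sum_(r <- terms (coact m))
      CH_cls n (rcons (behead h) (h`_0 * Sinv r.2)) r.1
}.

(* [f] is the restriction to the cotensor products of a linear map
   [M \ox hpow a -> M \ox hpow b] given by [phi] on pure tensors. *)
Definition restricts (a b : nat) (phi : M -> seq H -> M \ox hpow H b)
    (f : cot_mod a -> cot_mod b) : Prop :=
  exists2 F : {linear M \ox hpow H a -> M \ox hpow H b},
    forall (m : M) (h : seq H), size h = a.+1 -> F (m *t hpure a h) = phi m h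
    & forall z, cot_val (f z) = F (cot_val z).

(* [C] has the operators of C^H_*(H,M). *)
Record has_cot_operators (C : cyclicModule cot_mod) : Prop := {
  cot_face : forall n i, (i <= n)%N ->
    restricts (fun (m : M) (h : seq H) =>
      m *t hpure n (take i h ++ h`_i * h`_i.+1 :: drop i.+2 h))
      (face C n i);
  cot_face_last : forall n,
    restricts (fun (m : M) (h : seq H) =>
      \sum_(p <- terms (comul h`_n.+1))
        hact p.1 m *t hpure n (p.2 * h`_0 :: take n (behead h)))
      (face C n n.+1);
  cot_degen : forall n i, (i <= n)%N ->
    restricts (fun (m : M) (h : seq H) =>
      m *t hpure n.+1 (take i.+1 h ++ 1 :: drop i.+1 h))
      (degen C n i);
  cot_cyc : forall n,
    restricts (fun (m : M) (h : seq H) =>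
      \sum_(p <- terms (comul h`_n)) hact p.1 m *t hpure n (p.2 :: take n h))
      (cyc C n)
}.

(* The entries of [ps] are the pairs (h_i^(1), h_i^(2)) for i < n; for i = n the
   second leg is comultiplied further, so that h_n^(1) = ps_n.1,
   h_n^(2) = q.1 and h_n^(3) = q.2. *)
Definition theta_formula (n : nat) (h : seq H) (m : M) : M \ox hpow H n :=
  \sum_(ps <- sweedlers h)
    let p i := nth (0, 0) ps i in
    \sum_(q <- terms (comul (p n).2)) \sum_(r <- terms (coact m))
      hact q.1 r.1 *t
        hpure n (q.2 * r.2 * S (p 0).1 ::
                 [seq (p i).2 * S (p i.+1).1 | i <- iota 0 n]).

Definition is_theta (theta : forall n, {linear CH_mod n -> cot_mod n}) : Prop :=
  forall n (h : seq H) (m : M), size h = n.+1 ->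
    cot_val (theta n (CH_cls n h m)) = theta_formula n h m.

End HopfCyclic.

(* Main.v *)
(** Write [u \ox v] for [h_0 \ox ... \ox h_n |->
    S(h_0^(1)) \ox h_0^(2) S(h_1^(1)) \ox ... \ox h_{n-1}^(2) S(h_n^(1)) \ox h_n^(2)]
    ([chain] below), with [u] in the tensor power and [v] the last factor.  Then
    [theta (h \ox m) = v^(1) m^(0) \ox (v^(2) m^(1)) . u], where [x . u] multiplies
    the first factor of [u] by [x] on the left.  The chain map is recursive in
    the first factor and satisfies two telescoping identities: the diagonal
    coaction on [u] is [S(v^(1)) \ox u \ox v^(2)], which with the anti-Yetter-Drinfeld
    condition puts [theta] in the cotensor product, and the diagonal action of [g]
    turns [u \ox v] into [S(g^(1)) . u \ox v g^(2)], which makes [theta] balanced.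
    The inverse of [theta] sends [m \ox w] to the class of [unchain w \ox m], where
    [unchain] normalises the last factor to 1.

    Only one of the two cyclic structures is built directly.  On the cotensor side
    all cyclic identities with the faces 0..n hold on the whole of
    [M \ox H^{\ox (n+1)}], except for the order of the cyclic operator: there the
    (n+1)-st power is [m \ox h |-> h^(-1) m \ox h^(0)], which is the identity on the
    cotensor product by stability.  The cocyclic module on [CH_mod] is transported
    along [theta], and its prescribed operators are recovered from the fact that
    [theta] intertwines the formulas. *)

Require Import Defs.
From HB Require Import structures.
From mathcomp Require Import all_boot all_algebra.
From mathcomp Require boolp.

Set Implicit Arguments.
Unset Strict Implicit.
Unset Printing Implicit Defensive.

Import GRing.Theory.
Local Open Scope ring_scope.

(** * Sweedler sums *)

(* Wrapping [linear], which is a product, keeps [done] from introducing its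
   variables before the hint on [islin] applies. *)
Variant islin (k : comNzRingType) (U V : lmodType k) (f : U -> V) : Prop :=
  IsLin of linear f.

Definition mklin (k : comNzRingType) (U V : lmodType k) (f : U -> V)
    (lf : islin f) : {linear U -> V} :=
  HB.pack f (GRing.isLinear.Build k U V _ f (let: IsLin l := lf in l)).

(* [tsum x (fun a b => E)] is Sweedler's [E] for [x = a \ox b].  It is locked because
   unification would otherwise identify it with applications of [tlift]. *)
HB.lock Definition tsum (k : comNzRingType) (U V W : lmodType k) (x : U \ox V)
    (F : U -> V -> W) : W := \sum_(p <- terms x) F p.1 p.2.

Section Sums.
Variable k : comNzRingType.
Implicit Types U V W : lmodType k.

Lemma islin_linear U V (f : {linear U -> V}) : islin f.
Proof. by split; exact: linearP. Qed.

Lemma islin_id U : islin (fun x : U => x).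
Proof. by split. Qed.

Lemma islin_map U V W (g : {linear V -> W}) (f : U -> V) :
  islin f -> islin (fun x => g (f x)).
Proof. by move=> [lf]; split=> c x y; rewrite lf linearP. Qed.

Lemma islin_comp U V W (g : V -> W) (f : U -> V) :
  islin g -> islin f -> islin (fun x => g (f x)).
Proof. by move=> [lg] [lf]; split=> c x y; rewrite lf lg. Qed.

Lemma islin_scale U V (f : U -> V) c : islin f -> islin (fun x => c *: f x).
Proof.
by move=> [lf]; split=> d x y; rewrite lf scalerDr !scalerA mulrC.
Qed.

Lemma islin_scalar U V W (e : {scalar V}) (f : U -> V) (w : W) :
  islin f -> islin (fun x => e (f x) *: w).
Proof. by move=> [lf]; split=> d x y; rewrite lf linearP scalerDl scalerA. Qed.

Lemma islin_ptensl U V W (f : U -> V) (w : W) :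
  islin f -> islin (fun x => f x *t w).
Proof. by move=> [lf]; split=> d x y; rewrite lf linearPl. Qed.

Lemma islin_ptensr U V W (f : U -> V) (w : W) :
  islin f -> islin (fun x => w *t f x).
Proof. by move=> [lf]; split=> d x y; rewrite lf linearPr. Qed.

Lemma islin_mull U (H : algType k) (f : U -> H) (w : H) :
  islin f -> islin (fun x => f x * w).
Proof. by move=> [lf]; split=> d x y; rewrite lf mulrDl scalerAl. Qed.

Lemma islin_mulr U (H : algType k) (f : U -> H) (w : H) :
  islin f -> islin (fun x => w * f x).
Proof. by move=> [lf]; split=> d x y; rewrite lf mulrDr scalerAr. Qed.

Lemma islin_bigsum U V (I : Type) (s : seq I) (f : I -> U -> V) :
  (forall i, islin (f i)) -> islin (fun x => \sum_(i <- s) f i x).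
Proof.
move=> lf; split=> c x y; rewrite scaler_sumr -big_split.
by apply: eq_bigr => i _; have [->] := lf i.
Qed.

Lemma tsum_def U V W (x : U \ox V) (F : U -> V -> W) :
  tsum x F = \sum_(p <- terms x) F p.1 p.2.
Proof. by rewrite unlock. Qed.

Lemma islin_tsum U U' V' W (x : U' \ox V') (F : U -> U' -> V' -> W) :
  (forall a b, islin (fun u => F u a b)) -> islin (fun u => tsum x (F u)).
Proof. by rewrite unlock => lF; apply: islin_bigsum. Qed.

Lemma islin_tsum_arg U U' V' W (f : U -> U' \ox V') (F : U' -> V' -> W) :
  (forall b, islin (F^~ b)) -> (forall a, islin (F a)) ->
  islin f -> islin (fun u => tsum (f u) F).
Proof.
move=> l1 l2 [lf]; have bF : is_bilinear F.
  by split=> [b|a]; [case: (l1 b) | case: (l2 a)].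
by rewrite unlock; split=> c x y; rewrite lf; exact: (terms_linear bF).
Qed.

Lemma eq_tsum U V W (x : U \ox V) (F G : U -> V -> W) :
  (forall a b, F a b = G a b) -> tsum x F = tsum x G.
Proof. by rewrite unlock => FG; apply: eq_bigr => p _. Qed.

Lemma tsum_pure U V W (F : U -> V -> W) u v :
  (forall b, islin (F^~ b)) -> (forall a, islin (F a)) ->
  tsum (u *t v) F = F u v.
Proof.
rewrite tsum_def => l1 l2; apply: terms_pure.
by split=> [b|a]; [case: (l1 b) | case: (l2 a)].
Qed.

Lemma tsum_exch U V U' V' W (x : U \ox V) (y : U' \ox V')
    (F : U -> V -> U' -> V' -> W) :
  tsum x (fun a b => tsum y (F a b)) =
  tsum y (fun c d => tsum x (fun a b => F a b c d)).
Proof. by rewrite unlock; apply: exchange_big. Qed.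

Lemma tsumE U V (x : U \ox V) : tsum x (fun a b => a *t b) = x.
Proof. by rewrite tsum_def [RHS]termsE. Qed.

Lemma lin_sum U V (I : Type) (s : seq I) (g : U -> V) (F : I -> U) :
  islin g -> g (\sum_(i <- s) F i) = \sum_(i <- s) g (F i).
Proof. by move=> lg; rewrite -[g]/(mklin lg : _ -> _) linear_sum. Qed.

Lemma lin_tsum U V W W' (x : U \ox V) (g : W -> W') (F : U -> V -> W) :
  islin g -> g (tsum x F) = tsum x (fun a b => g (F a b)).
Proof. by rewrite !tsum_def; apply: lin_sum. Qed.

Lemma map_tsum U V W W' (x : U \ox V) (g : {linear W -> W'}) (F : U -> V -> W) :
  g (tsum x F) = tsum x (fun a b => g (F a b)).
Proof. exact/lin_tsum/islin_linear. Qed.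

Lemma lin_tsum_bigsum U V W (I : Type) (s : seq I) (f : I -> U \ox V)
    (F : U -> V -> W) :
  (forall b, islin (F^~ b)) -> (forall a, islin (F a)) ->
  tsum (\sum_(i <- s) f i) F = \sum_(i <- s) tsum (f i) F.
Proof.
move=> l1 l2; apply: (lin_sum s (g := fun x => tsum x F)).
by apply: islin_tsum_arg => //; exact: islin_id.
Qed.

Lemma tsum_tsum U V U' V' W (x : U \ox V) (f : U -> V -> U' \ox V')
    (F : U' -> V' -> W) :
  (forall b, islin (F^~ b)) -> (forall a, islin (F a)) ->
  tsum (tsum x f) F = tsum x (fun a b => tsum (f a b) F).
Proof. by move=> l1 l2; rewrite !(tsum_def x); apply: lin_tsum_bigsum. Qed.

Lemma tsum_ptensl U V W W' (x : U \ox V) (F : U -> V -> W) (w : W') :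
  tsum x F *t w = tsum x (fun a b => F a b *t w).
Proof. exact/(lin_tsum x F (g := fun z => z *t w))/islin_ptensl/islin_id. Qed.

Lemma tsum_ptensr U V W W' (x : U \ox V) (F : U -> V -> W) (w : W') :
  w *t tsum x F = tsum x (fun a b => w *t F a b).
Proof. exact/(lin_tsum x F (g := fun z => w *t z))/islin_ptensr/islin_id. Qed.

Lemma tsum_scale U V W (x : U \ox V) (F : U -> V -> W) c :
  c *: tsum x F = tsum x (fun a b => c *: F a b).
Proof. by rewrite unlock; exact: scaler_sumr. Qed.

Lemma tens_ext U V W (f g : U \ox V -> W) :
  islin f -> islin g -> (forall u v, f (u *t v) = g (u *t v)) -> f =1 g.
Proof. by move=> lf lg; exact: (tensor_ext (f := mklin lf) (g := mklin lg)). Qed.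

Lemma linZ U V (f : U -> V) c x : islin f -> f (c *: x) = c *: f x.
Proof. by move=> lf; rewrite -[f]/(mklin lf : _ -> _) linearZ. Qed.

Lemma linB U V (f : U -> V) x y : islin f -> f (x - y) = f x - f y.
Proof. by move=> lf; rewrite -[f]/(mklin lf : _ -> _) linearB. Qed.

End Sums.

Lemma islin_hactl (k : comNzRingType) (H : hopfAlgebra k) (M : modComod H)
    (U : lmodType k) (f : U -> H) (m : M) :
  islin f -> islin (fun x => hact (f x) m).
Proof. by move=> [lf]; split=> d x y; rewrite lf linearPl. Qed.

Lemma islin_hactr (k : comNzRingType) (H : hopfAlgebra k) (M : modComod H)
    (U : lmodType k) (f : U -> M) (h : H) :
  islin f -> islin (fun x => hact h (f x)).
Proof. by move=> [lf]; split=> d x y; rewrite lf linearPr. Qed.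

(* Redefined below to cover each new multilinear operator. *)
Ltac islin_ext := fail.
Ltac islin_step :=
  first [ assumption | apply: islin_id | exact: islin_linear | islin_ext
        | apply: islin_ptensl | apply: islin_ptensr
        | apply: islin_mull | apply: islin_mulr
        | apply: islin_hactl | apply: islin_hactr
        | apply: islin_tsum_arg => [?|?|] | apply: islin_tsum => ? ?
        | apply: islin_scalar | apply: islin_scale
        | apply: islin_bigsum => ?
        | apply: islin_map
        | match goal with
          | h : islin _ |- _ => apply: (islin_comp h)
          | h : forall _, islin _ |- _ => apply: (islin_comp (h _))
          | h : forall _ _, islin _ |- _ => apply: (islin_comp (h _ _))
          end ].
Ltac islin_tac := intros; solve [repeat islin_step].

#[local] Hint Extern 0 (islin _) => islin_tac : core.

Section Coassociativity.
Variables (k : comNzRingType) (A B C D E : lmodType k) (W : lmodType k).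
Variables (f : {linear A -> D \ox B}) (g : {linear E -> B \ox C}).
Variable F : D -> B -> C -> W.
Hypotheses (l1 : forall b c, islin (fun a => F a b c))
  (l2 : forall a c, islin (fun b => F a b c)) (l3 : forall a b, islin (F a b)).

(* Covers the coassociativity of [comul] and [coact] as well as the equation
   defining the cotensor product. *)
Lemma tassoc_tsum (x : A \ox C) (y : D \ox E) :
  tassoc (tmap f idfun x) = tmap idfun g y ->
  tsum x (fun a c => tsum (f a) (fun d b => F d b c)) =
  tsum y (fun d e => tsum (g e) (F d)).
Proof.
(* [G] is the linear map induced by [F] on the triple tensor product; applied to the hypothesis it
   turns an equality of tensors into one of sums. *)
pose G (x : D \ox (B \ox C)) := tsum x (fun a y => tsum y (F a)).
have lG : islin G by rewrite /G.
have GE a b c : G (a *t (b *t c)) = F a b c.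
  by rewrite /G !tsum_pure //= => *; rewrite tsum_pure.
move/(congr1 G); rewrite -{1}(tsumE x) -{1}(tsumE y) !map_tsum.
rewrite !(lin_tsum _ _ lG) => GE'; apply: etrans (etrans GE' _).
  apply: eq_tsum => a c.
  rewrite tmapE -[in RHS](tsumE (f a)) tsum_ptensl map_tsum (lin_tsum _ _ lG).
  by apply: eq_tsum => d b; rewrite tassocE GE.
apply: eq_tsum => d e.
rewrite tmapE -[in LHS](tsumE (g e)) tsum_ptensr (lin_tsum _ _ lG).
by apply: eq_tsum => b c; rewrite GE.
Qed.

End Coassociativity.

(** * Hopf algebra identities *)

Section HopfIdentities.
Variables (k : comNzRingType) (H : hopfAlgebra k).
Local Notation S := (@antipode k H).
Implicit Types U V W : lmodType k.

Lemma coassoc W (h : H) (F : H -> H -> H -> W) :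
  (forall b c, islin (fun a => F a b c)) ->
  (forall a c, islin (fun b => F a b c)) ->
  (forall a b, islin (F a b)) ->
  tsum (comul h) (fun a b => tsum (comul a) (fun a1 a2 => F a1 a2 b)) =
  tsum (comul h) (fun a b => tsum (comul b) (F a)).
Proof. by move=> l1 l2 l3; apply: tassoc_tsum (comulA h). Qed.

Lemma comul_mul W (g h : H) (F : H -> H -> W) :
  (forall b, islin (F^~ b)) -> (forall a, islin (F a)) ->
  tsum (comul (g * h)) F =
  tsum (comul g) (fun a b => tsum (comul h) (fun c d => F (a * c) (b * d))).
Proof.
move=> l1 l2; rewrite comulM lin_tsum_bigsum // [RHS]tsum_def.
apply: eq_bigr => p _; rewrite lin_tsum_bigsum // tsum_def.
by apply: eq_bigr => q _; rewrite tsum_pure.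
Qed.

Lemma comul_one W (F : H -> H -> W) :
  (forall b, islin (F^~ b)) -> (forall a, islin (F a)) ->
  tsum (comul (1 : H)) F = F 1 1.
Proof. by move=> l1 l2; rewrite comul1 tsum_pure. Qed.

Lemma counit_suml W (h : H) (G : H -> W) : islin G ->
  tsum (comul h) (fun a b => counit a *: G b) = G h.
Proof.
move=> lG; rewrite -[in RHS](counitl h) -(tsum_def _ (fun a b => counit a *: b)).
by rewrite (lin_tsum _ _ lG); apply: eq_tsum => a b; rewrite linZ.
Qed.

Lemma counit_sumr W (h : H) (G : H -> W) : islin G ->
  tsum (comul h) (fun a b => counit b *: G a) = G h.
Proof.
move=> lG; rewrite -[in RHS](counitr h) -(tsum_def _ (fun a b => counit b *: a)).
by rewrite (lin_tsum _ _ lG); apply: eq_tsum => a b; rewrite linZ.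
Qed.

Lemma antipode_suml W (h : H) (G : H -> W) : islin G ->
  tsum (comul h) (fun a b => G (S a * b)) = counit h *: G 1.
Proof.
by move=> lG; rewrite -(lin_tsum _ _ lG) tsum_def antipodel linZ.
Qed.

Lemma antipode_sumr W (h : H) (G : H -> W) : islin G ->
  tsum (comul h) (fun a b => G (a * S b)) = counit h *: G 1.
Proof.
by move=> lG; rewrite -(lin_tsum _ _ lG) tsum_def antipoder linZ.
Qed.

Section Cancel.
Variables (W : lmodType k) (F : H -> H -> W) (h : H).
Hypotheses (l1 : forall b, islin (F^~ b)) (l2 : forall a, islin (F a)).

(** Coassociativity separates the last leg from S(a) b, the antipode axiom leaves a counit, and the
    counit axiom absorbs it. The sum is nested to the right because [coassoc] leaves iterated
    coproducts in that shape. *)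
Lemma antipodeKl :
  tsum (comul h) (fun a r => tsum (comul r) (fun b c => F (S a * b) c)) = F 1 h.
Proof.
rewrite -(coassoc _ (F := fun a b c => F (S a * b) c)) //.
under eq_tsum => a b do rewrite (antipode_suml _ (l1 b)).
exact: counit_suml.
Qed.

Lemma antipodeKr :
  tsum (comul h) (fun a r => tsum (comul r) (fun b c => F (a * S b) c)) = F 1 h.
Proof.
rewrite -(coassoc _ (F := fun a b c => F (a * S b) c)) //.
under eq_tsum => a b do rewrite (antipode_sumr _ (l1 b)).
exact: counit_suml.
Qed.

End Cancel.

Lemma antipode1 : S 1 = 1.
Proof.
have := antipode_suml 1 (@islin_id k H).
by rewrite comul_one // mulr1 counit1 scale1r.
Qed.

Lemma counit_antipode (h : H) : counit (S h) = counit h.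
Proof.
(* The counit is viewed with values in [k^o], the ring as a module over itself, so that it can be
   applied to the antipode axiom. *)
have lc : islin (fun x : H => counit x : k^o) by split=> c x y; rewrite linearP.
have := antipode_suml h lc; rewrite counit1 [RHS]mulr1 => <-.
under eq_tsum => a b do rewrite counitM mulrC.
have lS : islin (fun x => counit (S x) : k^o).
  exact: islin_comp lc (islin_linear _).
exact: esym (counit_sumr h lS).
Qed.

(* Both sides are [S(g^(1) h^(1)) g^(2) h^(2) S(h^(3)) S(g^(3))]. *)
Lemma antipodeM (g h : H) : S (g * h) = S h * S g.
Proof.
transitivity (tsum (comul g) (fun g1 r => tsum (comul h) (fun h1 s =>
   tsum (comul r) (fun g2 g3 => tsum (comul s) (fun h2 h3 =>
     S (g1 * h1) * (g2 * h2 * S h3 * S g3)))))).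
  under eq_tsum => g1 r.
    under eq_tsum => h1 s.
      under eq_tsum => g2 g3.
        under eq_tsum => h2 h3 do rewrite -(mulrA g2).
        rewrite (antipode_sumr s (G := fun x => S (g1 * h1) * (g2 * x * S g3))) //.
        rewrite mulr1; over.
      rewrite -tsum_scale (antipode_sumr r (G := fun x => S (g1 * h1) * x)) //.
      rewrite mulr1; over.
    rewrite (counit_sumr h (G := fun x => counit r *: S (g1 * x))) //; over.
  by rewrite (counit_sumr g (G := fun x => S (x * h))).
(* Regrouped to the left, S(g^(1) h^(1)) g^(2) h^(2) has the form S(x^(1)) x^(2) for a product x,
   because [comul] is multiplicative, and collapses. *)
transitivity (tsum (comul g) (fun a g3 => tsum (comul a) (fun g1 g2 =>
   tsum (comul h) (fun b h3 => tsum (comul b) (fun h1 h2 =>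
     S (g1 * h1) * (g2 * h2) * (S h3 * S g3)))))).
  rewrite (coassoc _ (F := fun g1 g2 g3 =>
   tsum (comul h) (fun b h3 => tsum (comul b) (fun h1 h2 =>
     S (g1 * h1) * (g2 * h2) * (S h3 * S g3))))) //.
  apply: eq_tsum => g1 r; rewrite tsum_exch; apply: eq_tsum => g2 g3.
  rewrite (coassoc _ (F := fun h1 h2 h3 =>
     S (g1 * h1) * (g2 * h2) * (S h3 * S g3))) //.
  by apply: eq_tsum => h1 s; apply: eq_tsum => h2 h3; rewrite !mulrA.
under eq_tsum => a g3.
  rewrite tsum_exch; under eq_tsum => b h3.
    rewrite -(comul_mul a b (F := fun x y => S x * y * (S h3 * S g3))) //.
    rewrite (antipode_suml _ (G := fun x => x * (S h3 * S g3))) // mul1r.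
    rewrite counitM -scalerA; over.
  rewrite -tsum_scale (counit_suml h (G := fun x => S x * S g3)) //; over.
exact: (counit_suml g (G := fun x => S h * S x)).
Qed.

(** The product of the tensor square of [H], in which the convolution argument of [comul_antipode]
    takes place. *)
Definition tmul (x y : H \ox H) : H \ox H :=
  tsum x (fun a b => tsum y (fun c d => (a * c) *t (b * d))).

Lemma comul_tmul (g h : H) : comul (g * h) = tmul (comul g) (comul h).
Proof. by rewrite -[LHS]tsumE comul_mul. Qed.

Lemma islin_tmull U (f : U -> H \ox H) y : islin f -> islin (fun x => tmul (f x) y).
Proof. by rewrite /tmul. Qed.

Lemma islin_tmulr U (f : U -> H \ox H) y : islin f -> islin (fun x => tmul y (f x)).
Proof. by rewrite /tmul. Qed.

Ltac islin_ext ::= first [apply: islin_tmull | apply: islin_tmulr].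

Lemma tmul_pure a b c d : tmul (a *t b) (c *t d) = (a * c) *t (b * d).
Proof. by rewrite /tmul tsum_pure // => *; rewrite ?tsum_pure. Qed.

Lemma tmulA : associative tmul.
Proof.
move=> x y z.
apply: (tens_ext (f := fun x => tmul x (tmul y z))
  (g := fun x => tmul (tmul x y) z)) x => [||a b] //.
apply: (tens_ext (f := fun y => tmul (a *t b) (tmul y z))
  (g := fun y => tmul (tmul (a *t b) y) z)) y => [||c d] //.
apply: (tens_ext (f := fun z => tmul (a *t b) (tmul (c *t d) z))
  (g := fun z => tmul (tmul (a *t b) (c *t d)) z)) z => [||e f] //.
by rewrite !tmul_pure !mulrA.
Qed.

Lemma tmul1 x : tmul x (1 *t 1) = x.
Proof.
rewrite -[RHS]tsumE; apply: eq_tsum => a b; rewrite tsum_pure //.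
by rewrite !mulr1.
Qed.

Lemma tmul1l x : tmul (1 *t 1) x = x.
Proof.
rewrite /tmul tsum_pure //= -[RHS]tsumE; apply: eq_tsum => a b.
by rewrite !mul1r.
Qed.

(* Both sides are convolution inverse to [comul]. *)
Lemma comul_antipode (h : H) :
  comul (S h) = tsum (comul h) (fun a b => S b *t S a).
Proof.
pose C (h : H) := tsum (comul h) (fun a b => S b *t S a).
have lC : islin C by rewrite /C.
have BC x : tsum (comul x) (fun a b => tmul (comul a) (C b)) =
    counit x *: (1 *t 1).
  transitivity (tsum (comul x) (fun a r => tsum (comul r) (fun b s =>
     tsum (comul s) (fun c d => (a * S d) *t (b * S c))))).
    rewrite -(coassoc _ (F := fun a b s => tsum (comul s) (fun c d =>
      (a * S d) *t (b * S c)))) //.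
    apply: eq_tsum => a r; rewrite /C /tmul; apply: eq_tsum => b c.
    rewrite tsum_tsum //; apply: eq_tsum => d e.
    by rewrite tsum_pure.
  under eq_tsum => a r.
    rewrite (antipodeKr (F := fun u v => (a * S v) *t u)) //; over.
  exact: (antipode_sumr _ (G := fun u => u *t 1)).
have AB x : tsum (comul x) (fun a b => tmul (comul (S a)) (comul b)) =
    counit x *: (1 *t 1).
  under eq_tsum => a b do rewrite -comul_tmul.
  by rewrite (antipode_suml x (G := fun u => comul u)) // comul1.
(* The triple convolution of [comul] after S, [comul] and [C] is evaluated twice: [BC] collapses it
   to the left side, [AB] to the right side. *)
transitivity (tsum (comul h) (fun a r => tsum (comul r) (fun b c =>
    tmul (comul (S a)) (tmul (comul b) (C c))))).
  under eq_tsum => a r.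
    rewrite -(lin_tsum _ _ (g := fun u => tmul (comul (S a)) u)) //.
    rewrite BC (linZ _ _ (f := fun u => tmul (comul (S a)) u)) //.
    rewrite tmul1; over.
  by rewrite (counit_sumr h (G := fun u => comul (S u))).
rewrite -(coassoc _ (F := fun a b c => tmul (comul (S a)) (tmul (comul b) (C c)))) //.
under eq_tsum => a r.
  under eq_tsum => b c do rewrite tmulA.
  rewrite -(lin_tsum _ _ (g := fun u => tmul u (C r))) //.
  rewrite AB (linZ _ _ (f := fun u => tmul u (C r))) //.
  rewrite tmul1l; over.
exact: counit_suml.
Qed.

Lemma comul_antipode_sum W (h : H) (F : H -> H -> W) :
  (forall b, islin (F^~ b)) -> (forall a, islin (F a)) ->
  tsum (comul (S h)) F = tsum (comul h) (fun a b => F (S b) (S a)).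
Proof.
move=> l1 l2; rewrite comul_antipode tsum_tsum //.
by apply: eq_tsum => a b; rewrite tsum_pure.
Qed.

End HopfIdentities.

(** * The chain map and its inverse *)

Section TensorPowers.
Variables (k : comNzRingType) (H : hopfAlgebra k).
Local Notation S := (@antipode k H).
Local Notation T := (hpow H).
Implicit Types U V W : lmodType k.

Lemma hpowS_ext n W (f g : T n.+1 -> W) : islin f -> islin g ->
  (forall (x : H) (y : T n), f (x *t y) = g (x *t y)) -> f =1 g.
Proof. exact: tens_ext. Qed.

Fixpoint lmul (n : nat) : H -> T n -> T n :=
  match n with
  | 0 => fun a w => a * w
  | n'.+1 => fun a w => tsum (w : H \ox T n') (fun x y => (a * x) *t y)
  end.
Arguments lmul {n}.

Lemma islin_lmull U n (f : U -> H) (w : T n) :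
  islin f -> islin (fun x => lmul (f x) w).
Proof. by case: n w => [|n] w lf /=. Qed.

Lemma islin_lmulr U n (f : U -> T n) (a : H) :
  islin f -> islin (fun x => lmul a (f x)).
Proof. by case: n f => [|n] f lf /=. Qed.

Lemma islin_diagl U n (f : U -> T n) (g : H) :
  islin f -> islin (fun x => diag_act (f x) g).
Proof. by move=> [lf]; split=> c x y; rewrite lf (diag_act_bilinear _ n).1. Qed.

Lemma islin_diagr U n (f : U -> H) (w : T n) :
  islin f -> islin (fun x => diag_act w (f x)).
Proof. by move=> [lf]; split=> c x y; rewrite lf (diag_act_bilinear _ n).2. Qed.

End TensorPowers.

Ltac islin_power_step := first [apply: islin_lmull | apply: islin_lmulr
  | apply: islin_diagl | apply: islin_diagr].
Ltac islin_ext ::= islin_power_step.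

Section Chain.
Variables (k : comNzRingType) (H : hopfAlgebra k).
Local Notation S := (@antipode k H).
Local Notation T := (hpow H).
Implicit Types U V W : lmodType k.

Lemma lmul_pure n (a x : H) (y : T n) :
  lmul (n := n.+1) a (x *t y) = (a * x) *t y.
Proof. by rewrite /= tsum_pure. Qed.

Lemma lmulM n (a b : H) (w : T n) : lmul a (lmul b w) = lmul (a * b) w.
Proof.
case: n w => [|n] w; first by rewrite /= mulrA.
apply: (hpowS_ext (f := fun w => lmul a (lmul b w))
  (g := fun w => lmul (a * b) w)) w => [||x y] //.
by rewrite !lmul_pure mulrA.
Qed.

Lemma lmul1 n (w : T n) : lmul 1 w = w.
Proof.
case: n w => [|n] w; first by rewrite /= mul1r.
apply: (hpowS_ext (f := fun w => lmul 1 w)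
  (g := fun w => w)) w => [||x y] //.
by rewrite lmul_pure mul1r.
Qed.

Lemma diag_coact_pure n (x : H) (y : T n) :
  diag_coact n.+1 (x *t y) = tsum (comul x) (fun a b =>
    tsum (diag_coact n y) (fun c w => (a * c) *t (b *t w))).
Proof.
rewrite [LHS](tliftE (diag_coact_step _)) /mul_shuffle tsum_def.
by apply: eq_bigr => p _; rewrite tsum_def.
Qed.

Lemma diag_coact_pureF n (x : H) (y : T n) W (F : H -> T n.+1 -> W) :
  (forall b, islin (F^~ b)) -> (forall a, islin (F a)) ->
  tsum (diag_coact n.+1 (x *t y)) F = tsum (comul x) (fun a b =>
    tsum (diag_coact n y) (fun c w => F (a * c) (b *t w))).
Proof.
move=> l1 l2; rewrite diag_coact_pure tsum_tsum //; apply: eq_tsum => a b.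
by rewrite tsum_tsum //; apply: eq_tsum => c w; rewrite tsum_pure.
Qed.

Lemma diag_coact_lmul n (a : H) (w : T n) W (F : H -> T n -> W) :
  (forall b, islin (F^~ b)) -> (forall a, islin (F a)) ->
  tsum (diag_coact n (lmul a w)) F = tsum (comul a) (fun a1 a2 =>
    tsum (diag_coact n w) (fun c z => F (a1 * c) (lmul a2 z))).
Proof.
case: n w F => [|n] w F l1 l2; first by rewrite comul_mul.
apply: (hpowS_ext (f := fun w => tsum (diag_coact n.+1 (lmul a w)) F)
  (g := fun w => tsum (comul a) (fun a1 a2 =>
    tsum (diag_coact n.+1 w) (fun c z => F (a1 * c) (lmul a2 z))))) w => [||x y] //.
rewrite lmul_pure diag_coact_pureF // comul_mul //; apply: eq_tsum => a1 a2.
rewrite diag_coact_pureF //; apply: eq_tsum => x1 x2; apply: eq_tsum => c z.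
by rewrite mulrA lmul_pure.
Qed.

Lemma diag_coactA n (w : T n) W (F : H -> H -> T n -> W) :
  (forall b c, islin (fun a => F a b c)) ->
  (forall a c, islin (fun b => F a b c)) ->
  (forall a b, islin (F a b)) ->
  tsum (diag_coact n w) (fun c z => tsum (comul c) (fun c1 c2 => F c1 c2 z)) =
  tsum (diag_coact n w) (fun c z => tsum (diag_coact n z) (F c)).
Proof.
elim: n w F => [|n IH] w F l1 l2 l3; first by rewrite coassoc.
apply: (hpowS_ext (f := fun w => tsum (diag_coact n.+1 w)
    (fun c z => tsum (comul c) (fun c1 c2 => F c1 c2 z)))
  (g := fun w => tsum (diag_coact n.+1 w)
    (fun c z => tsum (diag_coact n.+1 z) (F c)))) w => [||x y] //.
rewrite !diag_coact_pureF //.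
transitivity (tsum (comul x) (fun a b => tsum (comul a) (fun a1 a2 =>
  tsum (diag_coact n y) (fun c z => tsum (comul c) (fun c1 c2 =>
    F (a1 * c1) (a2 * c2) (b *t z)))))).
  apply: eq_tsum => a b; rewrite tsum_exch; apply: eq_tsum => c z.
  by rewrite comul_mul.
rewrite (coassoc _ (F := fun a1 a2 b => tsum (diag_coact n y) (fun c z =>
  tsum (comul c) (fun c1 c2 => F (a1 * c1) (a2 * c2) (b *t z))))) //.
apply: eq_tsum => a r.
under eq_tsum => b1 b2.
  rewrite (IH y (fun c1 c2 z => F (a * c1) (b1 * c2) (b2 *t z))) //; over.
rewrite tsum_exch; apply: eq_tsum => c z.
by rewrite diag_coact_pureF.
Qed.

Lemma diag_coact_counit n (w : T n) W (G : T n -> W) : islin G ->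
  tsum (diag_coact n w) (fun c z => counit c *: G z) = G w.
Proof.
elim: n w G => [|n IH] w G lG; first exact: counit_suml.
apply: (hpowS_ext (f := fun w => tsum (diag_coact n.+1 w)
    (fun c z => counit c *: G z)) (g := G)) w => [||x y] //.
rewrite diag_coact_pureF //.
under eq_tsum => a b.
  under eq_tsum => c z do rewrite counitM -scalerA.
  rewrite -tsum_scale (IH y (fun z => G (b *t z))) //; over.
by rewrite (counit_suml x (G := fun b => G (b *t y))).
Qed.

(* The last tensor factor of [chain h] is kept apart from the others. *)
Fixpoint chain (n : nat) : T n -> T n \ox H :=
  match n with
  | 0 => fun x => tsum (comul x) (fun a b => S a *t b)
  | n'.+1 => fun z => tsum (z : H \ox T n') (fun x y =>
      tsum (chain y) (fun u v => tsum (comul x) (fun a b =>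
        (S a *t lmul b u : T n'.+1) *t v)))
  end.
Arguments chain {n}.

Lemma islin_chain U n (f : U -> T n) : islin f -> islin (fun x => chain (f x)).
Proof.
elim: n U f => [|n IH] U f lf /=; first by [].
apply: islin_tsum_arg => // a; apply: islin_tsum_arg => //.
exact: IH.
Qed.

End Chain.

Ltac islin_chain_step := first [islin_power_step | apply: islin_chain].
Ltac islin_ext ::= islin_chain_step.

Section ChainTheory.
Variables (k : comNzRingType) (H : hopfAlgebra k).
Local Notation S := (@antipode k H).
Local Notation T := (hpow H).
Implicit Types U V W : lmodType k.

Lemma chain0F (x : T 0) W (F : T 0 -> H -> W) :
  (forall b, islin (F^~ b)) -> (forall a, islin (F a)) ->
  tsum (chain x) F = tsum (comul x) (fun a b => F (S a) b).
Proof.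
by move=> l1 l2; rewrite tsum_tsum //; apply: eq_tsum => a b; rewrite tsum_pure.
Qed.

Lemma chain_pureF n x (y : T n) W (F : T n.+1 -> H -> W) :
  (forall b, islin (F^~ b)) -> (forall a, islin (F a)) ->
  tsum (chain (n := n.+1) (x *t y)) F =
  tsum (chain y) (fun u v => tsum (comul x) (fun a b => F (S a *t lmul b u) v)).
Proof.
move=> l1 l2; rewrite /= tsum_pure // tsum_tsum //; apply: eq_tsum => u v.
by rewrite tsum_tsum //; apply: eq_tsum => a b; rewrite tsum_pure.
Qed.

(** Telescoping: since S reverses coproducts, the coaction on S(x^(1)) \ox x^(2) . u contains
    S(x^(2)) x^(3) once all legs are expanded. This pair cancels, so the head adds nothing to the
    coaction leg and the induction hypothesis for the tail applies. *)
Lemma chain_coact n (h : T n) W (F : H -> T n -> H -> W) :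
  (forall b c, islin (fun a => F a b c)) ->
  (forall a c, islin (fun b => F a b c)) ->
  (forall a b, islin (F a b)) ->
  tsum (chain h) (fun u v => tsum (diag_coact n u) (fun c w => F c w v)) =
  tsum (chain h) (fun u v => tsum (comul v) (fun a b => F (S a) u b)).
Proof.
elim: n h F => [|n IH] h F l1 l2 l3.
  rewrite !chain0F //; under eq_tsum => a b do rewrite comul_antipode_sum //.
  by rewrite (coassoc _ (F := fun a1 a2 b => F (S a2) (S a1) b)).
apply: (hpowS_ext (f := fun h => tsum (chain h)
    (fun u v => tsum (diag_coact n.+1 u) (fun c w => F c w v)))
  (g := fun h => tsum (chain h)
    (fun u v => tsum (comul v) (fun a b => F (S a) u b)))) h => [||x y] //.
rewrite !chain_pureF //.
transitivity (tsum (chain y) (fun u v => tsum (diag_coact n u) (fun c z =>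
    tsum (comul x) (fun a r => F c (S a *t lmul r z) v)))); last first.
  rewrite (IH y (fun c z v => tsum (comul x) (fun a r =>
    F c (S a *t lmul r z) v))) //.
  by apply: eq_tsum => u v; rewrite tsum_exch.
apply: eq_tsum => u v; rewrite tsum_exch.
transitivity (tsum (comul x) (fun a b => tsum (comul a) (fun a1 a2 =>
    tsum (comul b) (fun b1 b2 => tsum (diag_coact n u) (fun c z =>
      F (S a2 * b1 * c) (S a1 *t lmul b2 z) v))))).
  apply: eq_tsum => a b; rewrite diag_coact_pureF // comul_antipode_sum //.
  apply: eq_tsum => a1 a2; rewrite diag_coact_lmul //.
  apply: eq_tsum => b1 b2; apply: eq_tsum => c z.
  by rewrite mulrA.
rewrite (coassoc _ (F := fun a1 a2 b => tsum (comul b) (fun b1 b2 =>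
  tsum (diag_coact n u) (fun c z =>
      F (S a2 * b1 * c) (S a1 *t lmul b2 z) v)))) //.
apply: eq_tsum => a r.
rewrite (antipodeKl (F := fun b1 b2 => tsum (diag_coact n u) (fun c z =>
      F (b1 * c) (S a *t lmul b2 z) v))) //.
by apply: eq_tsum => c z; rewrite mul1r.
Qed.

(** Since S reverses products, each inner factor acquires g^(j) S(g^(j+1)) between its two legs, and
    these pairs cancel. Only the first leg of [g], under S, and the last one survive. *)
Lemma chain_diag_act n (h : T n) (g : H) W (F : T n -> H -> W) :
  (forall b, islin (F^~ b)) -> (forall a, islin (F a)) ->
  tsum (chain (diag_act h g)) F = tsum (chain h) (fun u v =>
    tsum (comul g) (fun a b => F (lmul (S a) u) (v * b))).
Proof.
elim: n h g F => [|n IH] h g F l1 l2.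
  rewrite !chain0F // comul_mul //; apply: eq_tsum => x1 x2.
  by apply: eq_tsum => a b; rewrite antipodeM.
apply: (hpowS_ext (f := fun h => tsum (chain (diag_act h g)) F)
  (g := fun h => tsum (chain h) (fun u v =>
    tsum (comul g) (fun a b => F (lmul (S a) u) (v * b))))) h => [||x y].
- by apply: islin_tsum_arg => //; apply/islin_chain/islin_diagl/islin_id.
- by [].
rewrite chain_pureF // diag_actE.
rewrite -(tsum_def _ (fun a b => (x * a) *t diag_act y b : T n.+1)).
rewrite (lin_tsum _ _ (g := fun z : T n.+1 => tsum (chain z) F)) //.
transitivity (tsum (chain y) (fun u v => tsum (comul x) (fun x1 x2 =>
  tsum (comul g) (fun a b => tsum (comul a) (fun a1 a2 =>
    tsum (comul b) (fun b1 b2 =>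
    F (S a1 * S x1 *t lmul (x2 * (a2 * S b1)) u) (v * b2))))))).
  transitivity (tsum (comul g) (fun a b => tsum (chain y) (fun u v =>
    tsum (comul b) (fun b1 b2 => tsum (comul x) (fun x1 x2 =>
      tsum (comul a) (fun a1 a2 =>
       F (S a1 * S x1 *t lmul (x2 * (a2 * S b1)) u) (v * b2))))))).
    apply: eq_tsum => a b; rewrite chain_pureF // IH //; apply: eq_tsum => u v.
    apply: eq_tsum => b1 b2; rewrite comul_mul //; apply: eq_tsum => x1 x2.
    by apply: eq_tsum => a1 a2; rewrite antipodeM lmulM mulrA.
  rewrite tsum_exch; apply: eq_tsum => u v; rewrite [RHS]tsum_exch.
  apply: eq_tsum => a b; rewrite tsum_exch; apply: eq_tsum => x1 x2.
  exact: tsum_exch.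
apply: eq_tsum => u v; apply: eq_tsum => x1 x2.
rewrite (coassoc _ (F := fun a1 a2 b => tsum (comul b) (fun b1 b2 =>
    F (S a1 * S x1 *t lmul (x2 * (a2 * S b1)) u) (v * b2)))) //.
apply: eq_tsum => a r.
rewrite (antipodeKr (F := fun s b2 =>
    F (S a * S x1 *t lmul (x2 * s) u) (v * b2))) //.
by rewrite mulr1 lmul_pure.
Qed.

End ChainTheory.

(** * Inverting the chain map by normalising the last factor *)

Section Inverse.
Variables (k : comNzRingType) (H : hopfAlgebra k).
Local Notation S := (@antipode k H).
Local Notation T := (hpow H).
Implicit Types U V W : lmodType k.

(* g_0 \ox ... \ox g_n |->
   counit(g_0) g_1^(1) ... g_n^(1) \ox g_2^(2) ... g_n^(2) \ox ... \ox g_n^(n) \ox 1 *)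
Fixpoint unchain (n : nat) : T n -> T n :=
  match n with
  | 0 => fun g => counit g *: 1
  | n'.+1 => fun z => tsum (z : H \ox T n') (fun g w =>
      counit g *: tsum (diag_coact n' w) (fun c w' => c *t unchain w'))
  end.
Arguments unchain {n}.

(** This is S(w^(-1)) . w^(0) in reduced form: for w = g \ox y with coaction leg c on y, the
    antipode axiom turns S(g^(1) c) g^(2) into counit(g) S(c). *)
Fixpoint contract (n : nat) : T n -> T n :=
  match n with
  | 0 => fun g => counit g *: 1
  | n'.+1 => fun z => tsum (z : H \ox T n') (fun g w =>
      counit g *: tsum (diag_coact n' w) (fun c w' => S c *t w'))
  end.
Arguments contract {n}.

Lemma islin_unchain U n (f : U -> T n) : islin f -> islin (fun x => unchain (f x)).
Proof.
elim: n U f => [|n IH] U f lf /=; first exact: islin_scalar.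
apply: islin_tsum_arg => // a.
apply: islin_scale; apply: islin_tsum_arg => // b.
exact/islin_ptensr/IH/islin_id.
Qed.

Lemma islin_contract U n (f : U -> T n) :
  islin f -> islin (fun x => contract (f x)).
Proof. by case: n f => [|n] f lf /=; [exact: islin_scalar | by []]. Qed.

End Inverse.

Ltac islin_unchain_step := first [islin_chain_step
  | apply: islin_unchain | apply: islin_contract].
Ltac islin_ext ::= islin_unchain_step.

Section InverseTheory.
Variables (k : comNzRingType) (H : hopfAlgebra k).
Local Notation S := (@antipode k H).
Local Notation T := (hpow H).
Implicit Types U V W : lmodType k.

Lemma unchain_pure n (g : H) (w : T n) : unchain (n := n.+1) (g *t w) =
  counit g *: tsum (diag_coact n w) (fun c z => c *t unchain z).
Proof. by rewrite /= tsum_pure. Qed.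

Lemma contract_pure n (g : H) (w : T n) : contract (n := n.+1) (g *t w) =
  counit g *: tsum (diag_coact n w) (fun c z => S c *t z).
Proof. by rewrite /= tsum_pure. Qed.

Lemma unchain_lmul n (a : H) (w : T n) : unchain (lmul a w) = counit a *: unchain w.
Proof.
case: n w => [|n] w; first by rewrite /= counitM scalerA.
apply: (hpowS_ext (f := fun w => unchain (lmul a w))
  (g := fun w => counit a *: unchain w)) w => [||x y] //.
by rewrite lmul_pure !unchain_pure counitM scalerA.
Qed.

(** In the inductive step counits remove the legs of the head, leaving x c in front, with c the
    coaction leg of [u]. By [chain_coact] that leg is S(v^(1)), so acting with v^(2) makes the first
    factor x S(v^(1)) v^(2), which collapses to x; the tail is restored by induction. *)
Lemma diag_act_chain n (h : T n) :
  tsum (chain h) (fun u v => diag_act (unchain u) v) = h.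
Proof.
elim: n h => [|n IH] h.
  rewrite chain0F //=.
  under eq_tsum => a b do
    rewrite counit_antipode -scalerAl mul1r.
  exact: (counit_suml h (G := id)).
apply: (hpowS_ext (f := fun h => tsum (chain h) (fun u v => diag_act (unchain u) v))
  (g := fun h => h)) h => [||x y] //.
rewrite chain_pureF //.
pose F c w v : T n.+1 := diag_act (n := n.+1) ((x * c) *t unchain w) v.
transitivity (tsum (chain y) (fun u v => tsum (diag_coact n u) (fun c w => F c w v))).
  apply: eq_tsum => u v.
  under eq_tsum => a b.
    rewrite unchain_pure counit_antipode.
    rewrite (linZ _ _ (f := fun z : T n.+1 => diag_act z v)) //.
    rewrite diag_coact_lmul //; over.
  rewrite (counit_suml x (G := fun b => diag_act (n := n.+1) (tsum (comul b)
    (fun a1 a2 => tsum (diag_coact n u)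
      (fun c z => (a1 * c) *t unchain (lmul a2 z)))) v)) //.
  rewrite (lin_tsum _ _ (g := fun z : T n.+1 => diag_act z v)) //.
  under eq_tsum => a1 a2.
    under eq_tsum => c z do rewrite unchain_lmul linearZr /=.
    rewrite -tsum_scale.
    rewrite (linZ _ _ (f := fun z : T n.+1 => diag_act z v)) //; over.
  rewrite (counit_sumr x (G := fun b => diag_act (n := n.+1) (
     tsum (diag_coact n u)
      (fun c z => (b * c) *t unchain z)) v)) //.
  by rewrite (lin_tsum _ _ (g := fun z : T n.+1 => diag_act z v)).
rewrite (chain_coact y (F := F)) //; try by rewrite /F.
transitivity (x *t tsum (chain y) (fun u v => diag_act (unchain u) v)); last by rewrite IH.
rewrite tsum_ptensr; apply: eq_tsum => u v.
under eq_tsum => a b.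
  rewrite /F diag_actE -(tsum_def _ (fun c d =>
    (x * S a * c) *t diag_act (unchain u) d : T n.+1)).
  under eq_tsum => c d do rewrite -mulrA.
  over.
rewrite (antipodeKl (F := fun c d => (x * c) *t diag_act (unchain u) d)) //.
by rewrite mulr1.
Qed.

(** As [contract z] is S(z^(-1)) . z^(0), coassociativity of the diagonal coaction produces w^(-2)
    S(w^(-1)), which cancels. *)
Lemma lmul_contract n (w : T n) :
  tsum (diag_coact n w) (fun c z => lmul c (contract z)) = w.
Proof.
case: n w => [|n] w.
  rewrite /=; under eq_tsum => a b do rewrite -scalerAr mulr1.
  exact: (counit_sumr w (G := id)).
apply: (hpowS_ext (f := fun w => tsum (diag_coact n.+1 w)
    (fun c z => lmul c (contract z)))
  (g := fun w => w)) w => [||x y] //.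
rewrite diag_coact_pureF //.
transitivity (tsum (comul x) (fun a b => counit b *:
   tsum (diag_coact n y) (fun c w => tsum (diag_coact n w) (fun c' w' =>
     (a * c * S c') *t w')))).
  apply: eq_tsum => a b; rewrite tsum_scale; apply: eq_tsum => c w.
  rewrite contract_pure (linZ _ _ (f := fun z : T n.+1 => lmul (a * c) z)) //.
  rewrite (lin_tsum _ _ (g := fun z : T n.+1 => lmul (a * c) z)) //.
  by congr (_ *: _); apply: eq_tsum => c' w'; rewrite lmul_pure.
rewrite (counit_sumr x (G := fun a => tsum (diag_coact n y) (fun c w =>
   tsum (diag_coact n w) (fun c' w' => (a * c * S c') *t w')))) //.
rewrite -(diag_coactA y (F := fun c c' w => (x * c * S c') *t w)) //.
under eq_tsum => c z.
  under eq_tsum => c1 c2 do rewrite -mulrA.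
  rewrite (antipode_sumr c (G := fun c => (x * c) *t z)) //; over.
by rewrite (diag_coact_counit y (G := fun z => (x * 1) *t z)) // mulr1.
Qed.

(* [contract w] is thus the part of the chain of [unchain w] that [theta] sees. *)
Lemma chain_unchain n (w : T n) : chain (unchain w) = contract w *t 1.
Proof.
elim: n w => [|n IH] w.
  rewrite /= (linZ _ _ (f := fun g : H => tsum (comul g) (fun a b => S a *t b))) //.
  by rewrite comul_one // antipode1 linearZl.
apply: (hpowS_ext (f := fun w => chain (unchain w))
  (g := fun w => contract w *t 1)) w => [||x y] //.
rewrite unchain_pure contract_pure linearZl [RHS]/=.
rewrite (linZ _ _ (f := fun z : T n.+1 => chain z)) //.
congr (_ *: _); rewrite (lin_tsum _ _ (g := fun z : T n.+1 => chain z)) //.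
transitivity (tsum (diag_coact n y) (fun c z => tsum (diag_coact n z) (fun c' z' =>
   (S c *t lmul c' (contract z') : T n.+1) *t (1 : H)))).
  rewrite -(diag_coactA y (F := fun c c' z =>
    (S c *t lmul c' (contract z) : T n.+1) *t (1 : H))) //.
  apply: eq_tsum => c z; rewrite -[LHS]tsumE chain_pureF // IH tsum_pure //.
rewrite tsum_ptensl; apply: eq_tsum => c z.
by rewrite -tsum_ptensl -tsum_ptensr lmul_contract.
Qed.

End InverseTheory.

(** * The maps theta *)

Section Quotients.
Variables (k : comNzRingType).
Implicit Types U V W : lmodType k.

Section Lift.
Variables (V W : lmodType k) (P : {pred V}) (subP : submod_closed P) (f : V -> W).
Hypotheses (lf : islin f) (f0 : forall x, x \in P -> f x = 0).

Definition modlift (x : modquot subP) : W := f (modquot_repr x).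

Lemma modliftE x : modlift (modcls subP x) = f x.
Proof.
apply/eqP; rewrite -subr_eq0 -(linB _ _ lf) f0 //.
by apply/(modclsP subP); rewrite modquot_reprK.
Qed.

Lemma islin_modlift : islin modlift.
Proof.
split=> c x y; rewrite -[x]modquot_reprK -[y]modquot_reprK -linearP !modliftE.
by have [->] := lf.
Qed.

End Lift.

Section Balanced.
Variables (H : hopfAlgebra k) (N : lmodType k) (ract : N -> H -> N) (M : modComod H).

Lemma balcls_act x h (m : M) :
  balcls ract M (ract x h *t m) = balcls ract M (x *t hact h m).
Proof.
apply/modclsP/boolp.asboolP; exists [:: (1, (x, h, m))].
by rewrite big_seq1 /= scale1r.
Qed.

Lemma islin_balcls U (f : U -> N \ox M) :
  islin f -> islin (fun x => balcls ract M (f x)).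
Proof. by move=> [lf]; split=> c x y; rewrite lf -linearP. Qed.

Lemma bal_span_zero W (f : N \ox M -> W) : islin f ->
  (forall x h m, f (ract x h *t m) = f (x *t hact h m)) ->
  forall z, z \in bal_span ract (M := M) -> f z = 0.
Proof.
move=> lf fE z /boolp.asboolP[s ->].
rewrite (lin_sum _ _ lf) big1 // => -[c [[x h] m]] _.
by rewrite (linZ _ _ lf) (linB _ _ lf) fE subrr scaler0.
Qed.

End Balanced.

Section Cotensor.
Variables (H : hopfAlgebra k) (M N : lmodType k).
Variables (rho : {linear M -> M \ox H}) (lam : {linear N -> H \ox N}).

Lemma islin_cot_val U (f : U -> cotensor rho lam) :
  islin f -> islin (fun x => cot_val (f x)).
Proof. by move=> [lf]; split=> c x y; rewrite lf; exact: (linearP val). Qed.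

Lemma cot_val_inj : injective (@cot_val _ _ _ _ rho lam).
Proof. exact: val_inj. Qed.

Lemma cot_tsum (z : M \ox N) W (F : M -> H -> N -> W) :
  z \in cotens_pred rho lam ->
  (forall b c, islin (fun a => F a b c)) ->
  (forall a c, islin (fun b => F a b c)) ->
  (forall a b, islin (F a b)) ->
  tsum z (fun m w => tsum (rho m) (fun a b => F a b w)) =
  tsum z (fun m w => tsum (lam w) (F m)).
Proof. by move=> /eqP zP l1 l2 l3; apply: tassoc_tsum. Qed.

Lemma cot_tsumP (z : M \ox N) :
  tsum z (fun m w => tsum (rho m) (fun a b => a *t (b *t w))) =
  tsum z (fun m w => tsum (lam w) (fun b w' => m *t (b *t w'))) ->
  z \in cotens_pred rho lam.
Proof.
move=> zE; apply/eqP; rewrite -(tsumE z) !map_tsum.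
apply: etrans (etrans zE _); apply: eq_tsum => m w; rewrite tmapE.
  rewrite -[in LHS](tsumE (rho m)) tsum_ptensl map_tsum.
  by apply: eq_tsum => a b; rewrite tassocE.
by rewrite -[in RHS](tsumE (lam w)) tsum_ptensr.
Qed.

(** An opaque existence statement keeps the lift from being unfolded; it is known only through
    [cot_liftE]. *)
Lemma cot_lift_subproof U (f : U -> M \ox N) :
  islin f -> (forall x, f x \in cotens_pred rho lam) ->
  {g : {linear U -> cotensor rho lam} | forall x, cot_val (g x) = f x}.
Proof.
move=> [lf] fP; pose g x : cotensor rho lam := Cotensor (fP x).
have lg : islin g by split=> c x y; apply: val_inj; rewrite linearP /= lf.
by exists (mklin lg).
Qed.

Definition cot_lift U (f : U -> M \ox N) (lf : islin f)
    (fP : forall x, f x \in cotens_pred rho lam) := sval (cot_lift_subproof lf fP).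

Lemma cot_liftE U (f : U -> M \ox N) (lf : islin f)
    (fP : forall x, f x \in cotens_pred rho lam) x :
  cot_val (cot_lift lf fP x) = f x.
Proof. exact: (svalP (cot_lift_subproof lf fP)). Qed.

End Cotensor.
End Quotients.

Ltac islin_cot_step := first [islin_unchain_step
  | apply: islin_balcls | apply: islin_cot_val].
Ltac islin_ext ::= islin_cot_step.

Section Theta.
Variables (k : comNzRingType) (H : hopfAlgebra k) (M : modComod H).
Hypotheses (aydM : is_aYD M) (stableM : is_stable M).
Local Notation S := (@antipode k H).
Local Notation T := (hpow H).
Implicit Types U V W : lmodType k.

Lemma coact_coassoc (m : M) W (F : M -> H -> H -> W) :
  (forall b c, islin (fun a => F a b c)) ->
  (forall a c, islin (fun b => F a b c)) ->
  (forall a b, islin (F a b)) ->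
  tsum (coact m) (fun m0 m1 => tsum (coact m0) (fun a b => F a b m1)) =
  tsum (coact m) (fun m0 m1 => tsum (comul m1) (F m0)).
Proof. by move=> l1 l2 l3; apply: tassoc_tsum (coactA m). Qed.

Lemma coact_counit_sum (m : M) W (G : M -> W) : islin G ->
  tsum (coact m) (fun m0 m1 => counit m1 *: G m0) = G m.
Proof.
move=> lG; rewrite -[in RHS](coact_counit m) -(tsum_def _ (fun a b => counit b *: a)).
by rewrite (lin_tsum _ _ lG); apply: eq_tsum => a b; rewrite linZ.
Qed.

Lemma stable_sum (m : M) W (G : M -> W) : islin G ->
  tsum (coact m) (fun m0 m1 => G (hact m1 m0)) = G m.
Proof.
move=> lG; rewrite -[in RHS](stableM m) -(tsum_def _ (fun a b => hact b a)).
by rewrite (lin_tsum _ _ lG).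
Qed.

Lemma coact_hact (h : H) (m : M) W (F : M -> H -> W) :
  (forall b, islin (F^~ b)) -> (forall a, islin (F a)) ->
  tsum (coact (hact h m)) F = tsum (comul h) (fun a r => tsum (comul r) (fun b c =>
    tsum (coact m) (fun m0 m1 => F (hact b m0) (c * m1 * S a)))).
Proof.
move=> l1 l2; rewrite aydM lin_tsum_bigsum // [RHS]tsum_def; apply: eq_bigr => p _.
rewrite lin_tsum_bigsum // tsum_def; apply: eq_bigr => q _.
rewrite lin_tsum_bigsum // tsum_def; apply: eq_bigr => r _.
by rewrite tsum_pure.
Qed.

Definition theta_at n (u : T n) (v : H) (m : M) : M \ox T n :=
  tsum (comul v) (fun a b => tsum (coact m) (fun m0 m1 =>
    hact a m0 *t lmul (b * m1) u)).

Definition theta_pre n (z : T n \ox M) : M \ox T n :=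
  tsum z (fun h m => tsum (chain h) (fun u v => theta_at u v m)).

Lemma islin_theta_pre n U (f : U -> T n \ox M) :
  islin f -> islin (fun x => theta_pre (f x)).
Proof. by rewrite /theta_pre /theta_at. Qed.

Lemma theta_pre_pure n (h : T n) (m : M) :
  theta_pre (h *t m) = tsum (chain h) (fun u v => theta_at u v m).
Proof. by rewrite /theta_pre /theta_at tsum_pure. Qed.

(** By [chain_diag_act] the left side involves v g^(2) and S(g^(1)) . u; on the right the
    anti-Yetter-Drinfeld condition puts the same S(g^(1)) behind m^(1). Both become v^(1) g^(2)
    m^(0) \ox (v^(2) g^(3) m^(1) S(g^(1))) . u. *)
Lemma theta_pre_diag n (h : T n) (g : H) (m : M) :
  theta_pre (diag_act h g *t m) = theta_pre (h *t hact g m).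
Proof.
rewrite !theta_pre_pure /theta_at chain_diag_act //; apply: eq_tsum => u v.
transitivity (tsum (comul v) (fun v1 v2 => tsum (comul g) (fun a r =>
  tsum (comul r) (fun b c => tsum (coact m) (fun m0 m1 =>
    hact (v1 * b) m0 *t lmul (v2 * c * m1 * S a) u))))).
  rewrite [RHS]tsum_exch; apply: eq_tsum => a r; rewrite comul_mul //.
  apply: eq_tsum => v1 v2; apply: eq_tsum => b c; apply: eq_tsum => m0 m1.
  by rewrite lmulM.
apply: eq_tsum => v1 v2; rewrite coact_hact //.
apply: eq_tsum => a r; apply: eq_tsum => b c; apply: eq_tsum => m0 m1.
by rewrite hactM !mulrA.
Qed.

(** By the anti-Yetter-Drinfeld condition the coaction on v^(1) m^(0) contains S of the first leg of
    v; [chain_coact] trades exactly this leg for the diagonal coaction on u. *)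
Lemma theta_pre_cot n (z : T n \ox M) :
  theta_pre z \in cotens_pred coact (@diag_coact k H n).
Proof.
apply: cot_tsumP; rewrite /theta_pre !(tsum_tsum z) //; apply: eq_tsum => h m.
rewrite !(tsum_tsum (chain h)) // /theta_at.
(* The common value of both sides, where c \ox w stands for the diagonal coaction on [u]. *)
pose F c w v := tsum (comul v) (fun a r => tsum (comul r) (fun b b' =>
  tsum (coact m) (fun m0 m1 => tsum (comul m1) (fun d d' =>
    hact a m0 *t (b * d * c *t (lmul (b' * d') w : T n)))))).
transitivity (tsum (chain h) (fun u v => tsum (diag_coact n u) (fun c w => F c w v))).
  rewrite chain_coact //; try by rewrite /F.
  apply: eq_tsum => u v.
  transitivity (tsum (comul v) (fun a r => tsum (comul a) (fun a1 a2 =>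
    tsum (comul a2) (fun b c => tsum (coact m) (fun m0 m1 => tsum (comul m1) (fun d d' =>
       hact b m0 *t (c * d * S a1 *t lmul (r * d') u))))))).
    rewrite tsum_tsum //; apply: eq_tsum => a r.
    rewrite tsum_tsum //.
    transitivity (tsum (coact m) (fun m0 m1 => tsum (comul a) (fun a1 a2 =>
      tsum (comul a2) (fun b c => tsum (coact m0) (fun e d =>
       hact b e *t (c * d * S a1 *t lmul (r * m1) u)))))).
      by apply: eq_tsum => m0 m1; rewrite tsum_pure // coact_hact.
    rewrite tsum_exch; apply: eq_tsum => a1 a2.
    rewrite tsum_exch; apply: eq_tsum => b c.
    by rewrite -(coact_coassoc m (F := fun e d d' =>
       hact b e *t (c * d * S a1 *t lmul (r * d') u))).
  rewrite (coassoc _ (F := fun a1 a2 r => tsum (comul a2) (fun b c =>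
    tsum (coact m) (fun m0 m1 => tsum (comul m1) (fun d d' =>
       hact b m0 *t (c * d * S a1 *t lmul (r * d') u)))))) //.
  apply: eq_tsum => a r.
  rewrite /F (coassoc _ (F := fun b c r =>
    tsum (coact m) (fun m0 m1 => tsum (comul m1) (fun d d' =>
       hact b m0 *t (c * d * S a *t lmul (r * d') u))))) //.
apply: eq_tsum => u v.
rewrite /F [LHS]tsum_exch [RHS]tsum_tsum //; apply: eq_tsum => a r.
rewrite [RHS]tsum_tsum //.
transitivity (tsum (diag_coact n u) (fun c w => tsum (coact m) (fun m0 m1 =>
    tsum (comul r) (fun b b' => tsum (comul m1) (fun d d' =>
    hact a m0 *t (b * d * c *t (lmul (b' * d') w : T n))))))).
  by apply: eq_tsum => c w; rewrite tsum_exch.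
rewrite tsum_exch; apply: eq_tsum => m0 m1.
rewrite tsum_pure // diag_coact_lmul // comul_mul // tsum_exch.
apply: eq_tsum => b b'; exact: tsum_exch.
Qed.

Let islin_theta n : islin (@theta_pre n) := islin_theta_pre (@islin_id _ _).
Let theta_pre0 n := bal_span_zero (islin_theta n) (@theta_pre_diag n).

Definition theta_lin n : {linear CH_mod M n -> cot_mod M n} :=
  cot_lift (islin_modlift (bal_span_closed _ M) (islin_theta n) (@theta_pre0 n))
    (fun x => theta_pre_cot (modquot_repr x)).

Lemma theta_linE n (z : T n \ox M) :
  cot_val (theta_lin n (balcls diag_act M z)) = theta_pre z.
Proof. by rewrite cot_liftE (modliftE _ (islin_theta n) (@theta_pre0 n)). Qed.

Definition theta_inv n (z : cot_mod M n) : CH_mod M n :=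
  tsum (cot_val z) (fun m w => balcls diag_act M (unchain w *t m)).

(** [unchain] sees the first factor only through the counit, so v^(2) m^(1) disappears and the class
    of [unchain u] \ox v m remains. Balancing moves v to the left, where [diag_act_chain] recovers
    h. *)
Lemma thetaK n : cancel (theta_lin n) (@theta_inv n).
Proof.
move=> x; rewrite -[x]modquot_reprK -/(balcls _ _ _) /theta_inv theta_linE.
move: (modquot_repr x) => {x} z.
apply: (tens_ext (f := fun z => tsum (theta_pre z)
   (fun m w => balcls diag_act M (unchain w *t m)))
  (g := balcls diag_act M)) z => [||h m].
- by apply: islin_tsum_arg => //; apply: islin_theta_pre; apply: islin_id.
- exact/islin_balcls/islin_id.
rewrite theta_pre_pure /theta_at tsum_tsum //.
rewrite -[in RHS](diag_act_chain h) tsum_ptensl.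
rewrite (lin_tsum _ _ (g := balcls diag_act M)); last exact/islin_balcls/islin_id.
apply: eq_tsum => u v; rewrite tsum_tsum // balcls_act.
transitivity (tsum (comul v) (fun a b => tsum (coact m) (fun m0 m1 =>
  counit b *: (counit m1 *: balcls diag_act M (unchain u *t hact a m0))))).
  apply: eq_tsum => a b; rewrite tsum_tsum //; apply: eq_tsum => m0 m1.
  rewrite tsum_pure // unchain_lmul counitM linearZl /=.
  rewrite (linZ _ _ (f := balcls diag_act M)) ?scalerA //; exact/islin_balcls/islin_id.
under eq_tsum => a b.
  rewrite -tsum_scale.
  rewrite (coact_counit_sum m (G := fun m => balcls diag_act M (unchain u *t hact a m))) //.
  over.
by rewrite (counit_sumr v (G := fun a => balcls diag_act M (unchain u *t hact a m))).
Qed.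

(** By [chain_unchain] the composite gives m^(0) \ox m^(1) . [contract w]. The cotensor equation
    replaces m^(1) by the coaction leg of [w], and [lmul_contract] restores [w]. *)
Lemma theta_invK n : cancel (@theta_inv n) (theta_lin n).
Proof.
move=> z; apply: cot_val_inj; rewrite /theta_inv map_tsum.
rewrite (lin_tsum _ _ (g := @cot_val _ _ _ _ _ _)); last exact/islin_cot_val/islin_id.
transitivity (tsum (cot_val z) (fun m w => tsum (coact m) (fun m0 m1 =>
   m0 *t lmul m1 (contract w)))).
  apply: eq_tsum => m w; rewrite theta_linE theta_pre_pure chain_unchain.
  rewrite tsum_pure; try by rewrite /theta_at.
  rewrite /theta_at comul_one //; apply: eq_tsum => m0 m1.
  by rewrite hact1 mul1r.
have zP : cot_val z \in cotens_pred coact (@diag_coact k H n) by case: z.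
rewrite (cot_tsum (F := fun m c w => m *t lmul c (contract w)) zP) //.
rewrite -[RHS]tsumE; apply: eq_tsum => m w.
by rewrite -tsum_ptensr lmul_contract.
Qed.

End Theta.

(** * Operators on tensor powers *)

Section SeqOperators.
Variable R : nzRingType.
Implicit Types h : seq R.

(** A recursive counterpart of the [take] and [drop] expression in the prescribed faces, as [oneseq]
    is for the degeneracies: the simplicial identities follow by induction on the position. The
    connection is made by [mulseqE] and [oneseqE]. *)
Fixpoint mulseq i h :=
  if h is x :: h' then
    if i is i'.+1 then x :: mulseq i' h'
    else if h' is y :: h'' then x * y :: h'' else h
  else h.

Fixpoint oneseq i h :=
  if i is i'.+1 then if h is x :: h' then x :: oneseq i' h' else [:: 1]
  else 1 :: h.

Lemma mulseqE i h : (i.+1 < size h)%N ->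
  mulseq i h = take i h ++ h`_i * h`_i.+1 :: drop i.+2 h.
Proof.
elim: i h => [|i IH] [|x h] //=; first by case: h => [|y h] //=; rewrite drop0.
by rewrite ltnS => /IH ->.
Qed.

Lemma oneseqE i h : (i <= size h)%N -> oneseq i h = take i h ++ 1 :: drop i h.
Proof. by elim: i h => [|i IH] [|x h] //= /IH ->. Qed.

Lemma size_mulseq i h : (i.+1 < size h)%N -> size (mulseq i h) = (size h).-1.
Proof.
elim: i h => [|i IH] [|x h] //=; first by case: h.
by case: h => // y h ih; rewrite IH.
Qed.

Lemma size_oneseq i h : size (oneseq i h) = (size h).+1.
Proof. by elim: i h => [|i IH] [|x h] //=; rewrite IH. Qed.

Lemma mulseq_mulseq i j h : (i < j)%N -> (j.+1 < size h)%N ->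
  mulseq i (mulseq j h) = mulseq j.-1 (mulseq i h).
Proof.
elim: i j h => [|i IH] [|j] [|x h] //=.
  by case: h j => [|y h] [|j] //=; case: h => [|z h] //= _ _; rewrite mulrA.
by move=> ij jh; move: (IH j h ij jh); case: j ij jh => // j _ _ /= ->.
Qed.

Lemma oneseq_oneseq i j h : (i <= j <= size h)%N ->
  oneseq i (oneseq j h) = oneseq j.+1 (oneseq i h).
Proof. by elim: i j h => [|i IH] [|j] [|x h] //=;
  rewrite ?andbF // => /IH /= ->. Qed.

Lemma mulseq_oneseq_lt i j h : (i < j)%N -> (j < size h)%N ->
  mulseq i (oneseq j.+1 h) = oneseq j (mulseq i h).
Proof.
elim: i j h => [|i IH] [|j] [|x h] //=; first by case: h.
by move=> ij jh; have /= -> := IH j h ij jh.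
Qed.

Lemma mulseq_oneseq_eq j h : (j < size h)%N -> mulseq j (oneseq j.+1 h) = h.
Proof. by elim: j h => [|j IH] [|x h] //= jh; rewrite ?mulr1 ?IH. Qed.

Lemma mulseq_oneseq_eqS j h : (j.+1 < size h)%N -> mulseq j.+1 (oneseq j.+1 h) = h.
Proof.
elim: j h => [|j IH] [|x h] //=; first by case: h => //= y h _; rewrite mul1r.
by move=> /IH /= ->.
Qed.

Lemma mulseq_oneseq_gt i j h : (j.+1 < i)%N -> (i < size h)%N ->
  mulseq i (oneseq j.+1 h) = oneseq j.+1 (mulseq i.-1 h).
Proof.
elim: j i h => [|j IH] [|i] [|x h] //=; first by case: i => //= i; case: h.
by move=> ji ih; move: (IH i h ji ih); case: i ji ih => // i _ _ /= ->.
Qed.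

Lemma mulseq_rcons i h c : (i.+1 < size h)%N ->
  mulseq i (rcons h c) = rcons (mulseq i h) c.
Proof.
elim: i h => [|i IH] [|x h] //=; first by case: h.
by move=> ih; rewrite IH.
Qed.

Lemma mulseq_rcons2 h a b : mulseq (size h) (rcons (rcons h a) b) = rcons h (a * b).
Proof. by elim: h => //= x h ->. Qed.

Lemma oneseq_rcons i h c : (i <= size h)%N ->
  oneseq i (rcons h c) = rcons (oneseq i h) c.
Proof. by elim: i h => [|i IH] [|x h] //= ih; rewrite IH. Qed.

Lemma oneseq_size h : oneseq (size h) h = rcons h 1.
Proof. by elim: h => //= x h ->. Qed.

End SeqOperators.

Section Operators.
Variables (k : comNzRingType) (H : hopfAlgebra k).
Local Notation S := (@antipode k H).
Local Notation T := (hpow H).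
Implicit Types U V W : lmodType k.

Lemma hpow_pure_ext n W (f g : T n -> W) : islin f -> islin g ->
  (forall h : seq H, size h = n.+1 -> f (hpure n h) = g (hpure n h)) -> f =1 g.
Proof. by move=> lf lg; exact: (hpow_ext (f := mklin lf) (g := mklin lg)). Qed.

Lemma hpure_cons n (x : H) (h : seq H) :
  hpure n.+1 (x :: h) = x *t hpure n h.
Proof. by []. Qed.

(* For [n < i] the value of [mulT] is irrelevant. *)
Fixpoint mulT n (i : nat) : T n.+1 -> T n :=
  match n return T n.+1 -> T n with
  | 0 => fun z => tsum (z : H \ox T 0) (fun x y => lmul x y)
  | n'.+1 => fun z => tsum (z : H \ox T n'.+1)
      (fun x y => if i is i'.+1 then x *t mulT i' y else lmul (n := n'.+1) x y)
  end.
Arguments mulT {n}.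

(** The unit goes in front of factor number [i], so sigma_i is [oneT i.+1]. Position 0 belongs to no
    degeneracy; it is the base of the recursion. *)
Fixpoint oneT n (i : nat) : T n -> T n.+1 :=
  match n return T n -> T n.+1 with
  | 0 => fun x => if i is 0 then 1 *t x else x *t (1 : T 0)
  | n'.+1 => fun z => if i is i'.+1
      then tsum (z : H \ox T n') (fun x y => x *t oneT i' y)
      else 1 *t z
  end.
Arguments oneT {n}.

Fixpoint snoc n : T n -> H -> T n.+1 :=
  match n return T n -> H -> T n.+1 with
  | 0 => fun x c => x *t (c : T 0)
  | n'.+1 => fun z c => tsum (z : H \ox T n') (fun x y => x *t snoc y c)
  end.
Arguments snoc {n}.

(** [hpow] is nested to the right and exposes only its first factor, whereas the cyclic operator
    takes away the last one. *)
Fixpoint unsnoc n : T n.+1 -> T n \ox H :=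
  match n return T n.+1 -> T n \ox H with
  | 0 => fun z => z
  | n'.+1 => fun z => tsum (z : H \ox T n'.+1) (fun x w =>
      tsum (unsnoc w) (fun y c => (x *t y : T n'.+1) *t c))
  end.
Arguments unsnoc {n}.

Lemma islin_mulT U n i (f : U -> T n.+1) : islin f -> islin (fun x => mulT i (f x)).
Proof.
elim: n U i f => [|n IH] U i f lf /=; first by [].
case: i => [|i]; apply: islin_tsum_arg => // a.
exact/islin_ptensr/IH/islin_id.
Qed.

Lemma islin_oneT U n i (f : U -> T n) : islin f -> islin (fun x => oneT i (f x)).
Proof.
elim: n U i f => [|n IH] U [|i] f lf //=.
apply: islin_tsum_arg => // a.
exact/islin_ptensr/IH/islin_id.
Qed.

Lemma islin_snocl U n c (f : U -> T n) : islin f -> islin (fun x => snoc (f x) c).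
Proof.
elim: n U c f => [|n IH] U c f lf //=; apply: islin_tsum_arg => // a.
exact/islin_ptensr/IH/islin_id.
Qed.

Lemma islin_snocr U n y (f : U -> H) : islin f -> islin (fun x => snoc (n := n) y (f x)).
Proof.
elim: n U y f => [|n IH] U y f lf //=; apply: islin_tsum => a b.
exact/islin_ptensr/IH.
Qed.

Lemma islin_unsnoc U n (f : U -> T n.+1) : islin f -> islin (fun x => unsnoc (f x)).
Proof.
elim: n U f => [|n IH] U f lf //=; apply: islin_tsum_arg => // a.
by apply: islin_tsum_arg => //; apply/IH/islin_id.
Qed.

End Operators.

Ltac islin_op_step := first [islin_cot_step | apply: islin_mulT | apply: islin_oneT
  | apply: islin_snocl | apply: islin_snocr | apply: islin_unsnoc | apply: islin_theta_pre].
Ltac islin_ext ::= islin_op_step.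

Section OperatorTheory.
Variables (k : comNzRingType) (H : hopfAlgebra k).
Local Notation S := (@antipode k H).
Local Notation T := (hpow H).
Implicit Types U V W : lmodType k.

Lemma mulT0_pure n x (y : T n) : mulT 0 (x *t y : T n.+1) = lmul x y.
Proof. by case: n y => [|n] y; rewrite /= tsum_pure. Qed.

Lemma mulTS_pure n i x (y : T n.+1) : mulT i.+1 (x *t y : T n.+2) = x *t mulT i y.
Proof. by rewrite /= tsum_pure. Qed.

Lemma oneT0 n (y : T n) : oneT 0 y = 1 *t y.
Proof. by case: n y. Qed.

Lemma oneTS_pure n i x (y : T n) : oneT i.+1 (x *t y : T n.+1) = x *t oneT i y.
Proof. by rewrite /= tsum_pure. Qed.

Lemma snoc_pure n x (y : T n) c : snoc (x *t y : T n.+1) c = x *t snoc y c.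
Proof. by rewrite /= tsum_pure. Qed.

Lemma unsnoc_pure n x (y : T n.+1) : unsnoc (x *t y : T n.+2) =
   tsum (unsnoc y) (fun y c => (x *t y : T n.+1) *t c).
Proof. by rewrite /= tsum_pure. Qed.

Lemma lmul_hpure n a x (h : seq H) : lmul a (hpure n (x :: h)) = hpure n (a * x :: h).
Proof. by case: n => [|n] //; rewrite !hpure_cons lmul_pure. Qed.

Lemma mulT_hpure n i (h : seq H) : size h = n.+2 -> (i <= n)%N ->
  mulT i (hpure n.+1 h) = hpure n (mulseq i h).
Proof.
elim: n i h => [|n IH] [|i] [|x [|y h]] // [sh] ni; rewrite hpure_cons.
- by rewrite mulT0_pure lmul_hpure.
- by rewrite mulT0_pure lmul_hpure.
- by rewrite mulTS_pure IH //= sh.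
Qed.

Lemma oneT_hpure n i (h : seq H) : size h = n.+1 -> (i <= n.+1)%N ->
  oneT i (hpure n h) = hpure n.+1 (oneseq i h).
Proof.
elim: n i h => [|n IH] [|i] [|x h] // [sh] ni.
  by case: h sh i ni => // _ [].
by rewrite hpure_cons oneTS_pure IH.
Qed.

Lemma snoc_hpure n (h : seq H) c : size h = n.+1 ->
  snoc (hpure n h) c = hpure n.+1 (rcons h c).
Proof.
elim: n h => [|n IH] [|x h] // [sh]; first by case: h sh.
by rewrite hpure_cons snoc_pure IH.
Qed.

Lemma snocK n (w : T n) c : unsnoc (snoc w c) = w *t c.
Proof.
elim: n w => [|n IH] w //.
apply: (hpowS_ext (f := fun w => unsnoc (snoc w c)) (g := fun w => w *t c)) w => [||x y] //.
by rewrite snoc_pure unsnoc_pure IH tsum_pure.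
Qed.

Lemma unsnocK n (w : T n.+1) : tsum (unsnoc w) (fun y c => snoc y c) = w.
Proof.
elim: n w => [|n IH] w; first exact: tsumE.
apply: (hpowS_ext (f := fun w => tsum (unsnoc w) (fun y c => snoc y c))
  (g := fun w => w)) w => [||x y] //.
rewrite unsnoc_pure tsum_tsum // -[in RHS](IH y) tsum_ptensr; apply: eq_tsum => z c.
by rewrite tsum_pure // snoc_pure.
Qed.

Lemma lmul_snoc n a (w : T n) c : lmul a (snoc w c) = snoc (lmul a w) c.
Proof.
case: n w => [|n] w; first by rewrite /= tsum_pure.
apply: (hpowS_ext (f := fun w => lmul a (snoc w c))
  (g := fun w => snoc (lmul a w) c)) w => [||x y] //.
by rewrite snoc_pure !lmul_pure snoc_pure.
Qed.

Lemma mulT_lmul n i a (w : T n.+1) : mulT i (lmul a w) = lmul a (mulT i w).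
Proof.
apply: (hpowS_ext (f := fun w => mulT i (lmul a w))
  (g := fun w => lmul a (mulT i w))) w => [||x y] //.
rewrite lmul_pure; case: n i y => [|n] i y; first by rewrite /= !tsum_pure //= mulrA.
by case: i => [|i]; rewrite ?mulT0_pure ?lmulM // !mulTS_pure lmul_pure.
Qed.

(** Position 0 is excluded: there the new unit would become the first factor and receive [a]
    itself. *)
Lemma oneTS_lmul n i a (w : T n) : oneT i.+1 (lmul a w) = lmul a (oneT i.+1 w).
Proof.
case: n w => [|n] w; first by rewrite /= tsum_pure.
apply: (hpowS_ext (f := fun w => oneT i.+1 (lmul a w))
  (g := fun w => lmul a (oneT i.+1 w))) w => [||x y] //.
by rewrite lmul_pure !oneTS_pure lmul_pure.
Qed.

(** * The operators against the diagonal coaction and the chain map *)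

Section Coact.
Variables (W : lmodType k).

Lemma diag_coact_mulT n i (w : T n.+1) (F : H -> T n -> W) :
  (forall b, islin (F^~ b)) -> (forall a, islin (F a)) ->
  tsum (diag_coact n (mulT i w)) F = tsum (diag_coact n.+1 w) (fun c z => F c (mulT i z)).
Proof.
(* [mulT] does not recurse at position 0, and on two factors it ignores the position; both cases are
   this one. *)
have base m (y : T m.+1) (G : H -> T m -> W) : (forall b, islin (G^~ b)) ->
   (forall a, islin (G a)) ->
   tsum (diag_coact m (mulT 0 y)) G = tsum (diag_coact m.+1 y) (fun c z => G c (mulT 0 z)).
  move=> l1 l2; apply: (hpowS_ext (f := fun w => tsum (diag_coact m (mulT 0 w)) G)
    (g := fun w => tsum (diag_coact m.+1 w) (fun c z => G c (mulT 0 z)))) y => [||a b] //.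
  rewrite mulT0_pure diag_coact_lmul // diag_coact_pureF //.
  by apply: eq_tsum => a1 a2; apply: eq_tsum => c z; rewrite mulT0_pure.
elim: n i w F => [|n IH] [|i] w F l1 l2; try exact: base.
apply: (hpowS_ext (f := fun w => tsum (diag_coact n.+1 (mulT i.+1 w)) F)
  (g := fun w => tsum (diag_coact n.+2 w) (fun c z => F c (mulT i.+1 z)))) w => [||x y] //.
rewrite mulTS_pure !diag_coact_pureF //; apply: eq_tsum => a b.
rewrite (IH i y (fun c w => F (a * c) (b *t w))) //.
by apply: eq_tsum => c z; rewrite mulTS_pure.
Qed.

Lemma diag_coact_oneT n i (w : T n) (F : H -> T n.+1 -> W) :
  (forall b, islin (F^~ b)) -> (forall a, islin (F a)) ->
  tsum (diag_coact n.+1 (oneT i w)) F = tsum (diag_coact n w) (fun c z => F c (oneT i z)).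
Proof.
elim: n i w F => [|n IH] [|i] w F l1 l2.
- rewrite diag_coact_pureF // comul_one //; apply: eq_tsum => a b.
  by rewrite mul1r.
- rewrite diag_coact_pureF //; apply: eq_tsum => a b.
  by rewrite comul_one // mulr1.
- rewrite oneT0 diag_coact_pureF // comul_one //; apply: eq_tsum => a b.
  by rewrite mul1r oneT0.
apply: (hpowS_ext (f := fun w => tsum (diag_coact n.+2 (oneT i.+1 w)) F)
  (g := fun w => tsum (diag_coact n.+1 w) (fun c z => F c (oneT i.+1 z)))) w => [||x y] //.
rewrite oneTS_pure !diag_coact_pureF //; apply: eq_tsum => a b.
rewrite (IH i y (fun c w => F (a * c) (b *t w))) //.
by apply: eq_tsum => c z; rewrite oneTS_pure.
Qed.

Lemma diag_coact_snoc n (w : T n) e (F : H -> T n.+1 -> W) :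
  (forall b, islin (F^~ b)) -> (forall a, islin (F a)) ->
  tsum (diag_coact n.+1 (snoc w e)) F = tsum (diag_coact n w) (fun c z =>
    tsum (comul e) (fun a b => F (c * a) (snoc z b))).
Proof.
elim: n w F => [|n IH] w F l1 l2; first by rewrite diag_coact_pureF.
apply: (hpowS_ext (f := fun w => tsum (diag_coact n.+2 (snoc w e)) F)
  (g := fun w => tsum (diag_coact n.+1 w) (fun c z =>
    tsum (comul e) (fun a b => F (c * a) (snoc z b))))) w => [||x y] //.
rewrite snoc_pure !diag_coact_pureF //; apply: eq_tsum => a b.
rewrite (IH y (fun c w => F (a * c) (b *t w))) //; apply: eq_tsum => c z.
by apply: eq_tsum => e1 e2; rewrite mulrA snoc_pure.
Qed.

(** [chain] recurses at the first factor, but the cyclic operator acts at the last. At that end the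
    carried leg [v] opens a new factor v S(c^(1)), and c^(2) is carried instead. *)
Lemma chain_snoc n (w : T n) c (F : T n.+1 -> H -> W) :
  (forall b, islin (F^~ b)) -> (forall a, islin (F a)) ->
  tsum (chain (snoc w c)) F = tsum (chain w) (fun u v =>
    tsum (comul c) (fun a b => F (snoc u (v * S a)) b)).
Proof.
elim: n w F => [|n IH] w F l1 l2.
  rewrite chain_pureF // !chain0F // tsum_exch; apply: eq_tsum => x1 x2.
  by apply: eq_tsum => a b.
apply: (hpowS_ext (f := fun w => tsum (chain (snoc w c)) F)
  (g := fun w => tsum (chain w) (fun u v =>
    tsum (comul c) (fun a b => F (snoc u (v * S a)) b)))) w => [||x y] //.
rewrite snoc_pure !chain_pureF // IH //; apply: eq_tsum => u v.
rewrite tsum_exch; apply: eq_tsum => a b; apply: eq_tsum => c1 c2.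
by rewrite snoc_pure lmul_snoc.
Qed.

Lemma chain_mulT0 n x (y : T n) (F : T n -> H -> W) :
  (forall b, islin (F^~ b)) -> (forall a, islin (F a)) ->
  tsum (chain (x *t y : T n.+1)) (fun u v => F (mulT 0 u) v) =
  counit x *: tsum (chain y) F.
Proof.
move=> l1 l2; rewrite chain_pureF // tsum_scale; apply: eq_tsum => u v.
rewrite -[in RHS](lmul1 u) -(antipode_suml x (G := fun a => F (lmul a u) v)) //.
by apply: eq_tsum => a b; rewrite mulT0_pure lmulM.
Qed.

(** Merging the two factors that hold the legs of h_i brings S(h_i^(1)) and h_i^(2) together, and
    the antipode axiom turns them into the counit. Thus deleting an entry corresponds to multiplying
    neighbours. *)
Lemma chain_counit n i (h : seq H) (F : T n -> H -> W) :
  (forall b, islin (F^~ b)) -> (forall a, islin (F a)) ->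
  size h = n.+2 -> (i <= n)%N ->
  tsum (chain (hpure n.+1 h)) (fun u v => F (mulT i u) v) =
  counit h`_i *: tsum (chain (hpure n (take i h ++ drop i.+1 h))) F.
Proof.
elim: n i h F => [|n IH] [|i] [|x h] F l1 l2 // [sh] ni; rewrite hpure_cons.
- by rewrite chain_mulT0 // [take _ _]/= [drop _ _]/= drop0.
- by rewrite chain_mulT0 // [take _ _]/= [drop _ _]/= drop0.
rewrite [take _ _]/= [drop _ _]/= cat_cons hpure_cons.
rewrite chain_pureF // [in RHS]chain_pureF //.
rewrite -(IH i h (fun u v => tsum (comul x) (fun a b => F (S a *t lmul b u) v))) //.
apply: eq_tsum => u v; apply: eq_tsum => a b.
by rewrite mulTS_pure mulT_lmul.
Qed.

Lemma chain_comul0 n x (y : T n) (F : T n.+2 -> H -> W) :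
  (forall b, islin (F^~ b)) -> (forall a, islin (F a)) ->
  tsum (comul x) (fun a b => tsum (chain (a *t (b *t y : T n.+1) : T n.+2)) F) =
  tsum (chain (x *t y : T n.+1)) (fun u v => F (oneT 1 u) v).
Proof.
move=> l1 l2; rewrite chain_pureF //.
transitivity (tsum (chain y) (fun u v => tsum (comul x) (fun a b =>
  tsum (comul a) (fun a1 a2 => tsum (comul b) (fun b1 b2 =>
    F (S a1 *t (a2 * S b1 *t lmul b2 u)) v))))).
  rewrite [RHS]tsum_exch; apply: eq_tsum => a b; rewrite !chain_pureF //.
  apply: eq_tsum => u v; rewrite tsum_exch; apply: eq_tsum => a1 a2.
  by apply: eq_tsum => b1 b2; rewrite lmul_pure.
apply: eq_tsum => u v.
rewrite (coassoc _ (F := fun a1 a2 b => tsum (comul b) (fun b1 b2 =>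
    F (S a1 *t (a2 * S b1 *t lmul b2 u)) v))) //.
apply: eq_tsum => a r.
rewrite (antipodeKr (F := fun s b2 => F (S a *t (s *t lmul b2 u)) v)) //.
by rewrite oneTS_pure oneT0.
Qed.

(** Splitting h_i creates the new factor h_i^(2) S(h_i^(3)), which cancels to 1. It stands at
    position [i.+1] because position 0 holds S(h_0^(1)). *)
Lemma chain_comul n i (h : seq H) (F : T n.+1 -> H -> W) :
  (forall b, islin (F^~ b)) -> (forall a, islin (F a)) ->
  size h = n.+1 -> (i <= n)%N ->
  tsum (comul h`_i) (fun a b =>
    tsum (chain (hpure n.+1 (take i h ++ [:: a, b & drop i.+1 h]))) F) =
  tsum (chain (hpure n h)) (fun u v => F (oneT i.+1 u) v).
Proof.
elim: n i h F => [|n IH] [|i] [|x h] F l1 l2 // [sh] ni.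
- case: h sh => // _; rewrite chain0F //.
  transitivity (tsum (comul x) (fun a b => tsum (comul a) (fun a1 a2 =>
    tsum (comul b) (fun b1 b2 => F (S a1 *t (a2 * S b1)) b2)))).
    apply: eq_tsum => a b; rewrite [LHS]chain_pureF // chain0F // tsum_exch.
    by apply: eq_tsum => a1 a2; apply: eq_tsum => b1 b2.
  rewrite (coassoc _ (F := fun a1 a2 b =>
    tsum (comul b) (fun b1 b2 => F (S a1 *t (a2 * S b1)) b2))) //.
  apply: eq_tsum => a r.
  by rewrite (antipodeKr (F := fun s b2 => F (S a *t s) b2)).
- rewrite hpure_cons -chain_comul0 //; apply: eq_tsum => a b.
  by rewrite [take _ _]/= [drop _ _]/= drop0.
rewrite [in RHS]hpure_cons [RHS]chain_pureF // [_`_ _]/=.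
under [RHS]eq_tsum => u v do under eq_tsum => a b do
  rewrite oneTS_pure oneTS_lmul.
rewrite -(IH i h (fun u v => tsum (comul x) (fun a b => F (S a *t lmul b u) v))) //.
apply: eq_tsum => a b; rewrite [take _ _]/= [drop _ _]/= cat_cons hpure_cons.
exact: chain_pureF.
Qed.

End Coact.
End OperatorTheory.

(** * Cocyclic modules from inner faces *)

(* The faces [d n i] are only used for [i <= n]; the last one is [d n 0 \o tau n.+1]. *)
Section InnerFaces.
Variables (k : comNzRingType) (X : nat -> lmodType k).
Variables (d : forall n, nat -> {linear X n.+1 -> X n})
  (s : forall n, nat -> {linear X n -> X n.+1}) (tau : forall n, {linear X n -> X n}).
Hypotheses
  (dd : forall n i j x, (i < j <= n.+1)%N ->
    d n i (d n.+1 j x) = d n j.-1 (d n.+1 i x))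
  (ss : forall n i j x, (i <= j <= n)%N ->
    s n.+1 i (s n j x) = s n.+1 j.+1 (s n i x))
  (ds_lt : forall n i j x, (i < j <= n.+1)%N ->
    d n.+1 i (s n.+1 j x) = s n j.-1 (d n i x))
  (ds_eq : forall n j x, (j <= n)%N -> d n j (s n j x) = x)
  (ds_eqS : forall n j x, (j < n)%N -> d n j.+1 (s n j x) = x)
  (ds_gt : forall n i j x, (j.+1 < i <= n.+1)%N ->
    d n.+1 i (s n.+1 j x) = s n j (d n i.-1 x))
  (d_tau : forall n i x, (i < n)%N -> d n i.+1 (tau n.+1 x) = tau n (d n i x))
  (d0_tau2 : forall n x, d n 0 (tau n.+1 (tau n.+1 x)) = tau n (d n n x))
  (d0_tau_s : forall n x, d n 0 (tau n.+1 (s n n x)) = x)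
  (s_tau : forall n i x, (i < n)%N -> s n i.+1 (tau n x) = tau n.+1 (s n i x))
  (s0_tau : forall n x, s n 0 (tau n x) = tau n.+1 (tau n.+1 (s n n x)))
  (tau_order : forall n x, iter n.+1 (tau n) x = x).

Lemma islin_iter_tau n m : islin (iter m (tau n)).
Proof. by elim: m => [|m IH]; [exact: islin_id | exact: islin_map]. Qed.

Definition tau_inv n : {linear X n -> X n} := mklin (islin_iter_tau n n).

Lemma tauK n : cancel (tau n) (tau_inv n).
Proof. by move=> x; rewrite /tau_inv /= -iterSr tau_order. Qed.

Lemma tau_invK n : cancel (tau_inv n) (tau n).
Proof. by move=> x; rewrite /tau_inv /= -iterS tau_order. Qed.

Lemma iter_tauK n m : cancel (iter m (tau n)) (iter m (tau_inv n)).
Proof. by elim: m => // m IH x; rewrite iterSr iterS tauK IH. Qed.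

Let tau_inj n : injective (tau n) := can_inj (@tauK n).

(** The second branch, meant for [i = n.+1], is forced by the cyclic identity equating face 0 after
    the cyclic operator with the last face. *)
Definition outer_face n i : {linear X n.+1 -> X n} :=
  if (i <= n)%N then d n i else d n 0 \o tau n.+1.

(** A cyclic module has no degeneracy number n+1; the last coface is forced by t d_0 = d_{n+1}, with
    t the inverse of [tau]. *)
Definition outer_coface n i : {linear X n -> X n.+1} :=
  if (i <= n)%N then s n i else tau_inv n.+1 \o s n 0.

Let face_in n i x : (i <= n)%N -> outer_face n i x = d n i x.
Proof. by rewrite /outer_face => ->. Qed.

Let face_out n x : outer_face n n.+1 x = d n 0 (tau n.+1 x).
Proof. by rewrite /outer_face ltnn. Qed.

Let coface_in n i x : (i <= n)%N -> outer_coface n i x = s n i x.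
Proof. by rewrite /outer_coface => ->. Qed.

Let coface_out n x : outer_coface n n.+1 x = tau_inv n.+1 (s n 0 x).
Proof. by rewrite /outer_coface ltnn. Qed.

Let tinv_s n i x : (i < n)%N -> tau_inv n.+1 (s n i.+1 x) = s n i (tau_inv n x).
Proof. by move=> ni; apply: tau_inj; rewrite tau_invK -s_tau // tau_invK. Qed.

Let tinv_s0 n x : tau_inv n.+1 (tau_inv n.+1 (s n 0 x)) = s n n (tau_inv n x).
Proof. by do 2!apply: tau_inj; rewrite !tau_invK -s0_tau tau_invK. Qed.

Let tinv_d n i x : (i < n)%N -> tau_inv n (d n i.+1 x) = d n i (tau_inv n.+1 x).
Proof. by move=> ni; apply: tau_inj; rewrite tau_invK -d_tau // tau_invK. Qed.

Let tinv_d0 n x : tau_inv n (d n 0 (tau n.+1 x)) = d n n (tau_inv n.+1 x).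
Proof. by apply: tau_inj; rewrite tau_invK -d0_tau2 tau_invK. Qed.

Lemma outer_coface_coface n i j x : (i < j <= n.+2)%N ->
  outer_coface n.+1 j (outer_coface n i x) =
  outer_coface n.+1 i (outer_coface n j.-1 x).
Proof.
case: j => [|j] //= /andP[ij jn]; have [jn1|] := leqP j n.
  have le_in : (i <= n)%N by apply: leq_trans jn1.
  by rewrite !coface_in // ?leqW // [RHS]ss // -ltnS ij.
move=> nj; have -> : j = n.+1 by apply/eqP; rewrite eqn_leq nj andbT -ltnS.
have := leq_trans ij jn; rewrite !ltnS; rewrite leq_eqVlt => /predU1P[->|].
  rewrite !coface_out coface_in // -tinv_s0.
  by rewrite -[in LHS]tinv_s // [in RHS]ss.
rewrite ltnS => le_in; rewrite !coface_out [outer_coface n i x]coface_in //.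
by rewrite ss // tinv_s // coface_in // leqW.
Qed.

(** Codegeneracy number j is face number j+1, as in the cyclic dual, whence the shifts. The case
    distinctions isolate the composite last face. *)
Lemma outer_codegen_codegen n i j x : (i <= j <= n)%N ->
  outer_face n j.+1 (outer_face n.+1 i.+1 x) =
  outer_face n i.+1 (outer_face n.+1 j.+2 x).
Proof.
move=> /andP[ij jn]; rewrite [outer_face n.+1 i.+1 x]face_in; last exact: leq_trans ij jn.
have := jn; rewrite leq_eqVlt => /predU1P[jE|lt_jn]; last first.
  have lt_in := leq_ltn_trans ij lt_jn.
  by rewrite !face_in // [RHS]dd // !ltnS ij.
subst j; rewrite !face_out.
have := ij; rewrite leq_eqVlt => /predU1P[->|lt_in].
  by rewrite face_out -[in LHS]d0_tau2 -[in RHS]d_tau // [in RHS]dd.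
by rewrite face_in // -(@dd n 0 i.+2) // d_tau.
Qed.

Lemma outer_codegen_coface_lt n i j x : (i < j <= n.+1)%N ->
  outer_face n.+1 j.+1 (outer_coface n.+1 i x) =
  outer_coface n i (outer_face n j x).
Proof.
move=> /andP[ij]; rewrite leq_eqVlt => /predU1P[jE|].
  rewrite jE in ij *; rewrite !face_out !coface_in // ?leqW //.
  by rewrite -s_tau // ds_lt //= ij.
rewrite ltnS => jn; have le_in := leq_trans (ltnW ij) jn.
by rewrite !face_in // !coface_in // ?leqW // ds_gt // !ltnS ij.
Qed.

Lemma outer_codegen_coface_eq n j x : (j <= n)%N ->
  outer_face n j.+1 (outer_coface n j x) = x.
Proof.
move=> jn; rewrite coface_in //; have := jn.
rewrite leq_eqVlt => /predU1P[->|ltjn]; first by rewrite face_out d0_tau_s.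
by rewrite face_in // ds_eqS.
Qed.

Lemma outer_codegen_coface_eqS n j x : (j <= n)%N ->
  outer_face n j.+1 (outer_coface n j.+1 x) = x.
Proof.
rewrite leq_eqVlt => /predU1P[->|ltjn].
  by rewrite face_out coface_out tau_invK ds_eq.
by rewrite face_in // coface_in // ds_eq.
Qed.

Lemma outer_codegen_coface_gt n i j x : (j.+1 < i <= n.+2)%N ->
  outer_face n.+1 j.+1 (outer_coface n.+1 i x) =
  outer_coface n i.-1 (outer_face n j.+1 x).
Proof.
case: i => [|i] //= /andP[ji]; rewrite ltnS leq_eqVlt => /predU1P[iE|].
  rewrite iE ltnS in ji *; rewrite !coface_out face_in //.
  have := ji; rewrite leq_eqVlt => /predU1P[[->]|ltjn].
    rewrite face_out -tinv_d0 -[in LHS]s_tau // ds_lt //.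
  rewrite face_in // -tinv_d // ds_gt //=.
rewrite ltnS => lein; have jn : (j < n)%N by apply: leq_trans lein.
by rewrite !face_in ?leqW // !coface_in // ds_lt // ji ltnS.
Qed.

(** Face 0 is not among the codegeneracies; in the cyclic dual it returns as the last codegeneracy
    after the inverse of [tau]. The definition is transparent so that its operators can be computed
    later. *)
Definition cocyclic_of_inner : cocyclicModule X.
Proof.
apply: (@CocyclicModule k X outer_coface (fun n i => outer_face n i.+1) tau_inv).
- exact: outer_coface_coface.
- exact: outer_codegen_codegen.
- by move=> n i [//|j] x ij; exact: outer_codegen_coface_lt.
- exact: outer_codegen_coface_eq.
- exact: outer_codegen_coface_eqS.
- exact: outer_codegen_coface_gt.
- move=> n [//|i] x /andP[_]; rewrite ltnS leq_eqVlt => /predU1P[->|ltin].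
    by rewrite coface_out tinv_s0 coface_in.
  by rewrite !coface_in // ?tinv_s // ltnW.
- by move=> n x; rewrite coface_out coface_in.
- move=> n [//|i] x /andP[_]; rewrite leq_eqVlt => /predU1P[iE|ltin].
    by subst n; rewrite face_out tinv_d0 face_in.
  by rewrite face_in // tinv_d // face_in // ltnW.
- move=> [|n] x; rewrite [in RHS]face_out tau_invK.
    by rewrite face_out tinv_d0.
  by rewrite face_in // tinv_d.
- by move=> n x; rewrite -[x in LHS]tau_order iter_tauK.
Defined.

End InnerFaces.

(** * Transport of a cocyclic structure along linear bijections *)

Section Transport.
Variables (k : comNzRingType) (X Y : nat -> lmodType k) (C : cocyclicModule Y).
Variables (f : forall n, {linear X n -> Y n}) (g : forall n, Y n -> X n).
Hypotheses (fK : forall n, cancel (f n) (@g n)) (gK : forall n, cancel (@g n) (f n)).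

Lemma islin_inverse n : islin (@g n).
Proof. by split=> c x y; apply: (can_inj (@fK n)); rewrite linearP !gK. Qed.

Definition conj_map m n (e : {linear Y m -> Y n}) : {linear X m -> X n} :=
  mklin (islin_comp (islin_inverse n) (islin_map e (islin_linear (f m)))).

Lemma conj_mapE m n (e : {linear Y m -> Y n}) x : conj_map e x = g (e (f m x)).
Proof. by []. Qed.

Lemma map_conj m n (e : {linear Y m -> Y n}) x : f n (conj_map e x) = e (f m x).
Proof. by rewrite conj_mapE gK. Qed.

Lemma map_iter_conj n (e : {linear Y n -> Y n}) m x :
  f n (iter m (conj_map e) x) = iter m e (f n x).
Proof. by elim: m => // m IH; rewrite !iterS map_conj IH. Qed.

Definition cocyclic_transport : cocyclicModule X.
Proof.
apply: (@CocyclicModule k X (fun n i => conj_map (coface C n i))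
  (fun n i => conj_map (codegen C n i)) (fun n => conj_map (cocyc C n))).
- by move=> *; apply: (can_inj (@fK _)); rewrite !map_conj coface_coface.
- by move=> *; apply: (can_inj (@fK _)); rewrite !map_conj codegen_codegen.
- by move=> *; apply: (can_inj (@fK _)); rewrite !map_conj codegen_coface_lt.
- by move=> *; apply: (can_inj (@fK _)); rewrite !map_conj codegen_coface_eq.
- by move=> *; apply: (can_inj (@fK _)); rewrite !map_conj codegen_coface_eqS.
- by move=> *; apply: (can_inj (@fK _)); rewrite !map_conj codegen_coface_gt.
- by move=> *; apply: (can_inj (@fK _)); rewrite !map_conj cocyc_coface.
- by move=> *; apply: (can_inj (@fK _)); rewrite !map_conj cocyc_coface0.
- by move=> *; apply: (can_inj (@fK _)); rewrite !map_conj cocyc_codegen.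
- by move=> *; apply: (can_inj (@fK _)); rewrite !map_conj cocyc_codegen0.
move=> n x; apply: (can_inj (@fK _)); by rewrite map_iter_conj cocyc_order.
Defined.

(** The transported operators are conjugates by [f], so [f] intertwines them by construction; face 0
    is separate because in the dual it is a composite. *)
Lemma cyclic_dual_transport : cyclic_iso (cyclic_dual cocyclic_transport) (cyclic_dual C) f.
Proof.
split=> [n|n [|i] x _|n i x _|n x].
- exact: Bijective (@fK n) (@gK n).
- by rewrite /= !gK.
- exact: gK.
- exact: gK.
exact: map_iter_conj.
Qed.

End Transport.

(** * Operators on the cotensor products *)

Section CotOperators.
Variables (k : comNzRingType) (H : hopfAlgebra k) (M : modComod H).
Local Notation S := (@antipode k H).
Local Notation T := (hpow H).
Implicit Types U V W : lmodType k.

Definition mulM n i (z : M \ox T n.+1) : M \ox T n :=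
  tsum z (fun m w => m *t mulT i w).

Definition oneM n i (z : M \ox T n) : M \ox T n.+1 :=
  tsum z (fun m w => m *t oneT i w).

Definition rotM n : M \ox T n -> M \ox T n :=
  match n return M \ox T n -> M \ox T n with
  | 0 => fun z => tsum z (fun m c => tsum (comul c) (fun a b => hact a m *t (b : T 0)))
  | n'.+1 => fun z => tsum z (fun m w => tsum (unsnoc w) (fun y c =>
      tsum (comul c) (fun a b => hact a m *t (b *t y : T n'.+1))))
  end.

Lemma islin_mulM U n i (f : U -> M \ox T n.+1) :
  islin f -> islin (fun x => mulM i (f x)).
Proof. by rewrite /mulM. Qed.

Lemma islin_oneM U n i (f : U -> M \ox T n) : islin f -> islin (fun x => oneM i (f x)).
Proof. by rewrite /oneM. Qed.

Lemma islin_rotM U n (f : U -> M \ox T n) : islin f -> islin (fun x => rotM (f x)).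
Proof. by case: n f => [|n] f lf /=. Qed.

Lemma islin_hpure U n (f : U -> H) (h : seq H) :
  islin f -> islin (fun x => hpure n (f x :: h)).
Proof. by case: n => [|n] lf //; exact: (islin_ptensl (hpure n h)). Qed.

End CotOperators.

Ltac islin_cotop_step := first [islin_op_step
  | apply: islin_hpure | apply: islin_mulM | apply: islin_oneM | apply: islin_rotM].
Ltac islin_ext ::= islin_cotop_step.

Section CotOperatorTheory.
Variables (k : comNzRingType) (H : hopfAlgebra k) (M : modComod H).
Hypotheses (aydM : is_aYD M) (stableM : is_stable M).
Local Notation S := (@antipode k H).
Local Notation T := (hpow H).
Implicit Types U V W : lmodType k.

Lemma mulM_pure n i (m : M) (w : T n.+1) : mulM i (m *t w) = m *t mulT i w.
Proof. by rewrite /mulM tsum_pure. Qed.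

Lemma oneM_pure n i (m : M) (w : T n) : oneM i (m *t w) = m *t oneT i w.
Proof. by rewrite /oneM tsum_pure. Qed.

Lemma rotM_snoc n (m : M) (w : T n) c : rotM (m *t snoc w c) =
  tsum (comul c) (fun a b => hact a m *t (b *t w : T n.+1)).
Proof. by rewrite /= tsum_pure // snocK tsum_pure. Qed.

Lemma rotM_hpure n (m : M) (h : seq H) c : size h = n ->
  rotM (m *t hpure n (rcons h c)) =
  tsum (comul c) (fun a b => hact a m *t hpure n (b :: h)).
Proof.
case: n => [|n] sh; last by rewrite -snoc_hpure // rotM_snoc.
by case: h sh => // _; rewrite /= tsum_pure.
Qed.

Lemma cot_pure_ext n W (f g : M \ox T n -> W) : islin f -> islin g ->
  (forall (m : M) (h : seq H), size h = n.+1 -> f (m *t hpure n h) = g (m *t hpure n h)) ->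
  f =1 g.
Proof.
move=> lf lg fg; apply: tens_ext => // m w.
apply: (hpow_pure_ext (f := fun w => f (m *t w)) (g := fun w => g (m *t w))) w => //.
exact: fg.
Qed.

Lemma cot_rcons_ext n W (f g : M \ox T n -> W) : islin f -> islin g ->
  (forall (m : M) (h : seq H) c, size h = n ->
     f (m *t hpure n (rcons h c)) = g (m *t hpure n (rcons h c))) ->
  f =1 g.
Proof.
move=> lf lg fg; apply: cot_pure_ext => // m h.
by case/lastP: h => // h c; rewrite size_rcons => -[]; exact: fg.
Qed.

Lemma mulM_hpure n i (m : M) (h : seq H) : size h = n.+2 -> (i <= n)%N ->
  mulM i (m *t hpure n.+1 h) = m *t hpure n (mulseq i h).
Proof. by move=> sh ni; rewrite mulM_pure mulT_hpure. Qed.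

Lemma oneM_hpure n i (m : M) (h : seq H) : size h = n.+1 -> (i <= n.+1)%N ->
  oneM i (m *t hpure n h) = m *t hpure n.+1 (oneseq i h).
Proof. by move=> sh ni; rewrite oneM_pure oneT_hpure. Qed.

Lemma mulM_mulM n i j (z : M \ox T n.+2) : (i < j <= n.+1)%N ->
  mulM i (mulM j z) = mulM j.-1 (mulM i z).
Proof.
case: j => // j /andP[ij jn]; move: z; apply: cot_pure_ext => // m h sh.
have iN : (i <= n)%N by exact: leq_trans ij jn.
have s1 : size (mulseq j.+1 h) = n.+2 by rewrite size_mulseq sh.
have s2 : size (mulseq i h) = n.+2 by rewrite size_mulseq sh // !ltnS leqW.
by rewrite !mulM_hpure // ?leqW // mulseq_mulseq ?sh.
Qed.

Lemma oneM_oneM n i j (z : M \ox T n) : (i <= j <= n)%N ->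
  oneM i.+1 (oneM j.+1 z) = oneM j.+2 (oneM i.+1 z).
Proof.
case/andP=> ij jn; move: z; apply: cot_pure_ext => // m h sh.
have iN : (i <= n)%N by exact: leq_trans ij jn.
rewrite !oneM_hpure ?size_oneseq ?sh // ?ltnS ?leqW // oneseq_oneseq //.
by rewrite sh !ltnS ij.
Qed.

Lemma mulM_oneM_lt n i j (z : M \ox T n.+1) : (i < j <= n.+1)%N ->
  mulM i (oneM j.+1 z) = oneM j (mulM i z).
Proof.
case/andP=> ij jn; move: z; apply: cot_pure_ext => // m h sh.
have iN : (i <= n)%N by exact: leq_trans ij jn.
have s1 : size (mulseq i h) = n.+1 by rewrite size_mulseq sh.
rewrite oneM_hpure // mulM_hpure ?size_oneseq ?sh // ?leqW //.
by rewrite mulM_hpure // oneM_hpure // mulseq_oneseq_lt ?sh.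
Qed.

Lemma mulM_oneM_eq n j (z : M \ox T n) : (j <= n)%N -> mulM j (oneM j.+1 z) = z.
Proof.
move=> jn; move: z; apply: cot_pure_ext => // m h sh.
by rewrite oneM_hpure // mulM_hpure ?size_oneseq ?sh // mulseq_oneseq_eq ?sh.
Qed.

Lemma mulM_oneM_eqS n j (z : M \ox T n) : (j < n)%N -> mulM j.+1 (oneM j.+1 z) = z.
Proof.
move=> jn; move: z; apply: cot_pure_ext => // m h sh.
rewrite oneM_hpure //; last exact: leqW.
by rewrite mulM_hpure ?size_oneseq ?sh // mulseq_oneseq_eqS ?sh.
Qed.

Lemma mulM_oneM_gt n i j (z : M \ox T n.+1) : (j.+1 < i <= n.+1)%N ->
  mulM i (oneM j.+1 z) = oneM j.+1 (mulM i.-1 z).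
Proof.
case: i => // i /andP[ji iN]; move: z; apply: cot_pure_ext => // m h sh.
have jn : (j < n)%N by exact: leq_trans ji iN.
have s1 : size (mulseq i h) = n.+1 by rewrite size_mulseq sh.
rewrite oneM_hpure //; last by rewrite ltnS leqW // ltnW.
rewrite mulM_hpure ?size_oneseq ?sh // mulM_hpure // oneM_hpure //; last exact: ltnW.
by rewrite mulseq_oneseq_gt ?sh.
Qed.

Lemma mulM_rotM n i (z : M \ox T n.+1) : (i < n)%N ->
  mulM i.+1 (rotM z) = rotM (mulM i z).
Proof.
move=> ni; move: z; apply: cot_rcons_ext => // m h c sh.
rewrite rotM_hpure // mulM_hpure ?size_rcons ?sh //; last exact: ltnW.
rewrite mulseq_rcons ?sh // rotM_hpure ?size_mulseq ?sh //.
rewrite (lin_tsum _ _ (g := fun z => mulM i.+1 z)) //; apply: eq_tsum => a b.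
by rewrite mulM_hpure //= sh.
Qed.

Lemma mulM0_rotM2 n (z : M \ox T n.+1) : mulM 0 (rotM (rotM z)) = rotM (mulM n z).
Proof.
move: z; apply: cot_rcons_ext => // m h b; case/lastP: h => // h a.
rewrite size_rcons => -[sh].
rewrite rotM_hpure ?size_rcons ?sh // mulM_hpure ?size_rcons ?sh //.
have -> : mulseq n (rcons (rcons h a) b) = rcons h (a * b).
  by rewrite -sh mulseq_rcons2.
rewrite rotM_hpure // comul_mul // tsum_exch.
rewrite (lin_tsum _ _ (g := fun z => mulM 0 (rotM z))) //; apply: eq_tsum => b1 b2.
rewrite -rcons_cons rotM_hpure; last by rewrite /= sh.
rewrite (lin_tsum _ _ (g := fun z => mulM 0 z)) //; apply: eq_tsum => a1 a2.
by rewrite mulM_hpure; rewrite ?hactM //= sh.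
Qed.

Lemma mulM0_rotM_one n (z : M \ox T n) : mulM 0 (rotM (oneM n.+1 z)) = z.
Proof.
move: z; apply: cot_pure_ext => // m h sh.
have one_h : oneseq n.+1 h = rcons h 1 by rewrite -sh oneseq_size.
rewrite oneM_hpure // one_h rotM_hpure // comul_one //.
rewrite hact1 mulM_hpure //=; last by rewrite sh.
by case: h sh {one_h} => // x h _; rewrite mul1r.
Qed.

Lemma oneM_rotM n i (z : M \ox T n) : (i < n)%N ->
  oneM i.+2 (rotM z) = rotM (oneM i.+1 z).
Proof.
move=> ni; move: z; apply: cot_rcons_ext => // m h c sh.
rewrite rotM_hpure // oneM_hpure ?size_rcons ?sh //; last exact: leqW.
rewrite oneseq_rcons ?sh // rotM_hpure ?size_oneseq ?sh //.
rewrite (lin_tsum _ _ (g := fun z => oneM i.+2 z)) //; apply: eq_tsum => a b.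
by rewrite oneM_hpure //= sh.
Qed.

Lemma one1M_rotM n (z : M \ox T n) :
  oneM 1 (rotM z) = rotM (rotM (oneM n.+1 z)).
Proof.
move: z; apply: cot_rcons_ext => // m h c sh.
rewrite rotM_hpure // oneM_hpure ?size_rcons ?sh //.
have -> : oneseq n.+1 (rcons h c) = rcons (rcons h c) 1.
  by rewrite -oneseq_size size_rcons sh.
rewrite rotM_hpure ?size_rcons ?sh // comul_one // hact1 -rcons_cons.
rewrite rotM_hpure; last by rewrite /= sh.
rewrite (lin_tsum _ _ (g := fun z => oneM 1 z)) //; apply: eq_tsum => a b.
by rewrite oneM_hpure //= sh.
Qed.

(** Only the last entries [z] are rotated to the front, so that induction can run on [z]; with [y]
    empty this is the full power needed in [iter_rotM]. *)
Lemma iter_rotM_hpure n (m : M) (y z : seq H) : size (y ++ z) = n.+1 ->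
  iter (size z) (@rotM k H M n) (m *t hpure n (y ++ z)) =
  \sum_(ps <- sweedlers z)
    hact (\prod_(p <- ps) p.1) m *t hpure n ([seq p.2 | p <- ps] ++ y).
Proof.
elim: z y => [|c z IH] y syz.
  by rewrite big_seq1 big_nil hact1 cats0.
rewrite [size _]/= iterS -cat_rcons IH; last by rewrite cat_rcons.
rewrite (lin_sum _ _ (g := @rotM k H M n)); last exact/islin_rotM/islin_id.
rewrite [sweedlers _]/= big_allpairs_dep exchange_big.
rewrite [LHS]big_seq [RHS]big_seq; apply: eq_bigr => ps psz.
have sps : size ps = size z.
  elim: z ps psz {IH syz} => [|x z IH] ps; first by rewrite inE => /eqP->.
  by case/allpairsPdep=> p [qs [_ qz ->]]; rewrite /= (IH qs).
rewrite -rcons_cat rotM_hpure; last first.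
  by rewrite size_cat size_map sps addnC; move: syz; rewrite size_cat /= addnS => -[].
rewrite tsum_def; apply: eq_bigr => p _ /=.
by rewrite big_cons hactM.
Qed.

Lemma iter_rotM n (z : M \ox T n) : iter n.+1 (@rotM k H M n) z =
  tsum z (fun m w => tsum (diag_coact n w) (fun c w' => hact c m *t w')).
Proof.
have lit p : islin (iter p (@rotM k H M n)).
  by elim: p => [|p IH]; [exact: islin_id | exact: islin_rotM].
move: z; apply: cot_pure_ext => // m h sh.
rewrite tsum_pure // diag_coactE // lin_tsum_bigsum //.
rewrite -sh -[h in LHS]cat0s iter_rotM_hpure //; apply: eq_bigr => ps _.
by rewrite cats0 tsum_pure.
Qed.

Lemma rotM_order n (z : M \ox T n) :
  z \in cotens_pred coact (@diag_coact k H n) -> iter n.+1 (@rotM k H M n) z = z.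
Proof.
move=> zP; rewrite iter_rotM -(cot_tsum (F := fun m c w => hact c m *t w) zP) //.
rewrite -[RHS]tsumE; apply: eq_tsum => m w.
exact: (stable_sum stableM m (G := fun m => m *t w)).
Qed.

Lemma mulM_cot n i (z : M \ox T n.+1) :
  z \in cotens_pred coact (@diag_coact k H n.+1) ->
  mulM i z \in cotens_pred coact (@diag_coact k H n).
Proof.
move=> zP; apply: cot_tsumP; rewrite /mulM !(tsum_tsum z) //.
transitivity (tsum z (fun m w => tsum (coact m) (fun a b => a *t (b *t mulT i w)))).
  by apply: eq_tsum => m w; rewrite tsum_pure.
rewrite (cot_tsum (F := fun a b w => a *t (b *t mulT i w)) zP) //.
by apply: eq_tsum => m w; rewrite tsum_pure // diag_coact_mulT.
Qed.

Lemma oneM_cot n i (z : M \ox T n) :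
  z \in cotens_pred coact (@diag_coact k H n) ->
  oneM i z \in cotens_pred coact (@diag_coact k H n.+1).
Proof.
move=> zP; apply: cot_tsumP; rewrite /oneM !(tsum_tsum z) //.
transitivity (tsum z (fun m w => tsum (coact m) (fun a b => a *t (b *t oneT i w)))).
  by apply: eq_tsum => m w; rewrite tsum_pure.
rewrite (cot_tsum (F := fun a b w => a *t (b *t oneT i w)) zP) //.
by apply: eq_tsum => m w; rewrite tsum_pure // diag_coact_oneT.
Qed.

Lemma rotM_cot n (z : M \ox T n) :
  z \in cotens_pred coact (@diag_coact k H n) ->
  rotM z \in cotens_pred coact (@diag_coact k H n).
Proof.
(* In degree 0 a single rotation is already the full power, hence the identity on the cotensor
   product. *)
case: n z => [|n] z zP; first by have -> : rotM z = z := rotM_order zP.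
(* By the anti-Yetter-Drinfeld condition the coaction on [rotM z] is the image
     under [L] of the coaction on [z], which may be moved to the second factor. *)
pose L (m : M) (a : H) (s : T n.+1) := tsum (unsnoc s) (fun w c =>
  tsum (comul c) (fun c1 r => tsum (comul r) (fun c2 q => tsum (comul q) (fun c3 c4 =>
    hact c2 m *t (c3 * a * S c1 *t (c4 *t w : T n.+1)))))).
apply: cot_tsumP; rewrite /rotM !(tsum_tsum z) //.
transitivity (tsum z (fun m w => tsum (coact m) (fun a b => L a b w))).
  apply: eq_tsum => m s; rewrite /L [RHS]tsum_exch tsum_tsum //.
  apply: eq_tsum => w c; rewrite tsum_tsum //.
  transitivity (tsum (comul c) (fun a b => tsum (comul a) (fun p1 p2 =>
    tsum (comul p2) (fun q1 q2 => tsum (coact m) (fun m0 m1 =>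
      hact q1 m0 *t (q2 * m1 * S p1 *t (b *t w : T n.+1))))))).
    by apply: eq_tsum => a b; rewrite tsum_pure // coact_hact.
  rewrite (coassoc _ (F := fun p1 p2 b =>
    tsum (comul p2) (fun q1 q2 => tsum (coact m) (fun m0 m1 =>
      hact q1 m0 *t (q2 * m1 * S p1 *t (b *t w : T n.+1)))))) //.
  rewrite [RHS]tsum_exch; apply: eq_tsum => p r.
  rewrite (coassoc _ (F := fun q1 q2 b => tsum (coact m) (fun m0 m1 =>
      hact q1 m0 *t (q2 * m1 * S p *t (b *t w : T n.+1))))) //.
  rewrite [RHS]tsum_exch; apply: eq_tsum => q s'.
  by rewrite tsum_exch.
rewrite (cot_tsum (F := L) zP); try by rewrite /L.
apply: eq_tsum => m s; rewrite tsum_tsum // -[in LHS](unsnocK s).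
rewrite (lin_tsum _ _ (g := fun s => tsum (diag_coact n.+1 s) (L m))); last by rewrite /L.
apply: eq_tsum => w c; rewrite diag_coact_snoc; try by rewrite /L.
rewrite tsum_tsum //.
(* The coaction leg of [snoc w c] is e c^(1). The S coming from the anti-Yetter-Drinfeld condition
   meets c^(1) and cancels it, which leaves the coaction on the rotated tensor. *)
transitivity (tsum (diag_coact n w) (fun e w' => tsum (comul c) (fun q s =>
  tsum (comul s) (fun t u => hact q m *t (t * e *t (u *t w' : T n.+1)))))).
  apply: eq_tsum => e w'; rewrite /L.
  transitivity (tsum (comul c) (fun c1 c2 => tsum (comul c2) (fun p r =>
     tsum (comul r) (fun q s => tsum (comul s) (fun t u =>
       hact q m *t (t * e * (c1 * S p) *t (u *t w' : T n.+1))))))).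
    apply: eq_tsum => c1 c2; rewrite snocK tsum_pure //.
    apply: eq_tsum => p r; apply: eq_tsum => q t; apply: eq_tsum => u v.
    by rewrite !mulrA.
  rewrite (antipodeKr (F := fun x r => tsum (comul r) (fun q s =>
    tsum (comul s) (fun t u => hact q m *t (t * e * x *t (u *t w' : T n.+1)))))) //.
  by apply: eq_tsum => q t; apply: eq_tsum => u v; rewrite mulr1.
rewrite tsum_exch; apply: eq_tsum => a b; rewrite tsum_pure // diag_coact_pureF //.
exact: tsum_exch.
Qed.

End CotOperatorTheory.

(** * Compatibility of theta with the operators *)

Section Intertwining.
Variables (k : comNzRingType) (H : hopfAlgebra k) (M : modComod H).
Local Notation S := (@antipode k H).
Local Notation T := (hpow H).
Implicit Types U V W : lmodType k.

Lemma mulM_theta_at n i (u : T n.+1) v (m : M) :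
  mulM i (theta_at u v m) = theta_at (mulT i u) v m.
Proof.
rewrite /theta_at (lin_tsum _ _ (g := fun z => mulM i z)) //; apply: eq_tsum => a b.
rewrite (lin_tsum _ _ (g := fun z => mulM i z)) //; apply: eq_tsum => m0 m1.
by rewrite mulM_pure mulT_lmul.
Qed.

Lemma oneM_theta_at n i (u : T n) v (m : M) :
  oneM i.+1 (theta_at u v m) = theta_at (oneT i.+1 u) v m.
Proof.
rewrite /theta_at (lin_tsum _ _ (g := fun z => oneM i.+1 z)) //; apply: eq_tsum => a b.
rewrite (lin_tsum _ _ (g := fun z => oneM i.+1 z)) //; apply: eq_tsum => m0 m1.
by rewrite oneM_pure oneTS_lmul.
Qed.

Lemma mulM_theta n i (h : seq H) (m : M) : size h = n.+2 -> (i <= n)%N ->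
  mulM i (theta_pre (hpure n.+1 h *t m)) =
  counit h`_i *: theta_pre (hpure n (take i h ++ drop i.+1 h) *t m).
Proof.
move=> sh ni; rewrite !theta_pre_pure (lin_tsum _ _ (g := fun z => mulM i z)) //.
under eq_tsum => u v do rewrite mulM_theta_at.
by rewrite (chain_counit (F := fun u v => theta_at u v m)) //; rewrite /theta_at.
Qed.

Lemma oneM_theta n i (h : seq H) (m : M) : size h = n.+1 -> (i <= n)%N ->
  oneM i.+1 (theta_pre (hpure n h *t m)) = tsum (comul h`_i) (fun a b =>
    theta_pre (hpure n.+1 (take i h ++ [:: a, b & drop i.+1 h]) *t m)).
Proof.
move=> sh ni; rewrite !theta_pre_pure (lin_tsum _ _ (g := fun z => oneM i.+1 z)) //.
under eq_tsum => u v do rewrite oneM_theta_at.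
under [RHS]eq_tsum => a b do rewrite theta_pre_pure.
by rewrite (chain_comul (F := fun u v => theta_at u v m)) //; rewrite /theta_at.
Qed.

(** Both sides reduce to the sum of v^(1) m^(0) \ox v^(2) S(c^(1)) \ox (c^(2) m^(1)) . u over the
    chain u \ox v of [w]. On the left, rotating v S(c^(1)) to the front produces a pair S(c^(2))
    c^(3) acting on m^(0); on the right, theta produces m^(1) S(m^(2)). Both pairs cancel. *)
Lemma rotM_theta n (w : T n) c (m : M) :
  rotM (theta_pre (snoc w c *t m)) =
  tsum (coact m) (fun m0 m1 => theta_pre ((c * m1) *t w *t m0 : T n.+1 \ox M)).
Proof.
under [RHS]eq_tsum => m0 m1 do rewrite theta_pre_pure.
rewrite theta_pre_pure chain_snoc; try by rewrite /theta_at.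
rewrite (lin_tsum _ _ (g := fun z : M \ox T n.+1 => rotM z)) //.
transitivity (tsum (chain w) (fun u v => tsum (coact m) (fun m0 m1 =>
  tsum (comul v) (fun v1 v2 => tsum (comul c) (fun p r =>
    hact v1 m0 *t ((v2 * S p) *t lmul (r * m1) u : T n.+1)))))).
  apply: eq_tsum => u v; rewrite (lin_tsum _ _ (g := fun z : M \ox T n.+1 => rotM z)) //.
  transitivity (tsum (comul c) (fun c1 c2 => tsum (comul c1) (fun p q =>
    tsum (comul c2) (fun a b => tsum (coact m) (fun m0 m1 =>
      tsum (comul v) (fun v1 v2 =>
        hact (v1 * (S q * a)) m0 *t (v2 * S p *t lmul (b * m1) u : T n.+1))))))).
    apply: eq_tsum => c1 c2; rewrite /theta_at.
    rewrite (lin_tsum _ _ (g := fun z : M \ox T n.+1 => rotM z)) // [RHS]tsum_exch.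
    apply: eq_tsum => a b.
    rewrite (lin_tsum _ _ (g := fun z : M \ox T n.+1 => rotM z)) // [RHS]tsum_exch.
    apply: eq_tsum => m0 m1; rewrite lmul_snoc rotM_snoc comul_mul // tsum_exch.
    rewrite comul_antipode_sum //; apply: eq_tsum => p q; apply: eq_tsum => v1 v2.
    by rewrite -hactM -mulrA.
  rewrite (coassoc _ (F := fun p q c2 => tsum (comul c2) (fun a b =>
    tsum (coact m) (fun m0 m1 => tsum (comul v) (fun v1 v2 =>
        hact (v1 * (S q * a)) m0 *t (v2 * S p *t lmul (b * m1) u : T n.+1)))))) //.
  transitivity (tsum (comul c) (fun p r => tsum (coact m) (fun m0 m1 =>
    tsum (comul v) (fun v1 v2 =>
    hact v1 m0 *t ((v2 * S p) *t lmul (r * m1) u : T n.+1))))).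
    apply: eq_tsum => p r.
    rewrite (antipodeKl (F := fun x b => tsum (coact m) (fun m0 m1 =>
      tsum (comul v) (fun v1 v2 =>
        hact (v1 * x) m0 *t (v2 * S p *t lmul (b * m1) u : T n.+1))))) //.
    by apply: eq_tsum => m0 m1; apply: eq_tsum => v1 v2; rewrite mulr1.
  by rewrite tsum_exch; apply: eq_tsum => m0 m1; rewrite tsum_exch.
transitivity (tsum (coact m) (fun m0 m1 => tsum (chain w) (fun u v =>
  tsum (comul c) (fun c1 c2 => tsum (comul m1) (fun e1 e2 =>
    theta_at (S (c1 * e1) *t lmul (c2 * e2) u : T n.+1) v m0))))); last first.
  apply: eq_tsum => m0 m1; rewrite chain_pureF; try by rewrite /theta_at.
  by apply: eq_tsum => u v; rewrite comul_mul //; rewrite /theta_at.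
rewrite [RHS]tsum_exch; apply: eq_tsum => u v.
transitivity (tsum (coact m) (fun m0 m1 => tsum (coact m0) (fun n0 n1 =>
  tsum (comul m1) (fun e1 e2 => tsum (comul v) (fun v1 v2 => tsum (comul c) (fun c1 c2 =>
    hact v1 n0 *t (v2 * (n1 * S e1) * S c1 *t lmul (c2 * e2) u : T n.+1))))))).
  rewrite (coact_coassoc _ (F := fun n0 n1 m1 =>
    tsum (comul m1) (fun e1 e2 => tsum (comul v) (fun v1 v2 => tsum (comul c) (fun c1 c2 =>
    hact v1 n0 *t (v2 * (n1 * S e1) * S c1 *t lmul (c2 * e2) u : T n.+1)))))) //.
  apply: eq_tsum => m0 m1.
  rewrite (antipodeKr (F := fun x e2 => tsum (comul v) (fun v1 v2 =>
    tsum (comul c) (fun c1 c2 =>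
    hact v1 m0 *t (v2 * x * S c1 *t lmul (c2 * e2) u : T n.+1))))) //.
  by apply: eq_tsum => v1 v2; apply: eq_tsum => c1 c2; rewrite mulr1.
apply: eq_tsum => m0 m1; rewrite /theta_at.
transitivity (tsum (comul m1) (fun e1 e2 => tsum (comul c) (fun c1 c2 =>
  theta_at (S (c1 * e1) *t lmul (c2 * e2) u : T n.+1) v m0))); last exact: tsum_exch.
rewrite tsum_exch; apply: eq_tsum => e1 e2; rewrite tsum_exch.
transitivity (tsum (comul v) (fun v1 v2 => tsum (comul c) (fun c1 c2 =>
  tsum (coact m0) (fun n0 n1 =>
   hact v1 n0 *t (v2 * (n1 * S e1) * S c1 *t lmul (c2 * e2) u : T n.+1))))).
  by apply: eq_tsum => v1 v2; rewrite tsum_exch.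
rewrite tsum_exch; apply: eq_tsum => c1 c2; apply: eq_tsum => v1 v2.
by apply: eq_tsum => n0 n1; rewrite lmul_pure antipodeM !mulrA.
Qed.

Lemma rotM_theta_hpure n (h : seq H) c (m : M) : size h = n.+1 ->
  rotM (theta_pre (hpure n.+1 (rcons h c) *t m)) =
  tsum (coact m) (fun m0 m1 => theta_pre (hpure n.+1 (c * m1 :: h) *t m0)).
Proof. by move=> sh; rewrite -snoc_hpure // rotM_theta. Qed.

(** Rotation brings c m^(1) to the front, where merging takes its counit; the counit of m^(1) is
    absorbed by the coaction. *)
Lemma mulM0_rotM_theta n (h : seq H) c (m : M) : size h = n.+1 ->
  mulM 0 (rotM (theta_pre (hpure n.+1 (rcons h c) *t m))) =
  counit c *: theta_pre (hpure n h *t m).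
Proof.
move=> sh; rewrite rotM_theta_hpure // (lin_tsum _ _ (g := fun z => mulM 0 z)) //.
transitivity (tsum (coact m) (fun m0 m1 =>
  counit m1 *: (counit c *: theta_pre (hpure n h *t m0)))).
  apply: eq_tsum => m0 m1; rewrite mulM_theta //=; last by rewrite sh.
  by rewrite drop0 counitM scalerA mulrC.
by rewrite (coact_counit_sum m (G := fun m => counit c *: theta_pre (hpure n h *t m))).
Qed.

Lemma chain_hpure n (h : seq H) : size h = n.+1 ->
  chain (hpure n h) = \sum_(ps <- sweedlers h)
    hpure n (S (nth (0, 0) ps 0).1 ::
      [seq (nth (0, 0) ps i).2 * S (nth (0, 0) ps i.+1).1 | i <- iota 0 n])
    *t (nth (0, 0) ps n).2.
Proof.
elim: n h => [|n IH] [|x h] // [sh].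
  case: h sh => // _; rewrite big_allpairs_dep /= tsum_def; apply: eq_bigr => p _.
  by rewrite big_seq1.
rewrite hpure_cons -[LHS]tsumE chain_pureF // IH // lin_tsum_bigsum //.
(* [sweedlers] sums over the head first, whereas the recursion of [chain] sums over the tail
   first. *)
rewrite [sweedlers _]/= big_allpairs_dep exchange_big; apply: eq_bigr => ps _.
rewrite tsum_pure // tsum_def; apply: eq_bigr => p _.
rewrite [RHS]/= (iotaDl 1 0) -map_comp /=.
by rewrite -/(hpure n) lmul_hpure.
Qed.

Lemma theta_pre_formula n (h : seq H) (m : M) : size h = n.+1 ->
  theta_pre (hpure n h *t m) = theta_formula n h m.
Proof.
move=> sh; rewrite theta_pre_pure chain_hpure // lin_tsum_bigsum;
  try by rewrite /theta_at.
apply: eq_bigr => ps _; rewrite tsum_pure; try by rewrite /theta_at.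
rewrite /theta_at tsum_def; apply: eq_bigr => q _; rewrite tsum_def.
by apply: eq_bigr => r _; rewrite lmul_hpure.
Qed.

End Intertwining.

(** * Cancellation with the inverse antipode *)

Section InverseAntipode.
Variables (k : comNzRingType) (H : hopfAlgebra k) (Sinv : H -> H).
Hypotheses (SK : cancel (@antipode k H) Sinv) (SinvK : cancel Sinv (@antipode k H)).
Local Notation S := (@antipode k H).

Lemma islin_Sinv (U : lmodType k) (f : U -> H) : islin f -> islin (fun x => Sinv (f x)).
Proof.
move=> [lf]; split=> c x y; apply: (can_inj SK).
by rewrite linearP !SinvK lf.
Qed.

(** Applying S reverses the product and yields the antipode axiom. *)
Lemma Sinv_suml (h : H) : tsum (comul h) (fun a b => Sinv b * a) = (counit h)%:A.
Proof.
apply: (can_inj SK); rewrite map_tsum linearZ /= antipode1.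
under eq_tsum => a b do rewrite antipodeM SinvK.
exact: (antipode_suml h (@islin_id _ _)).
Qed.

Variable M : modComod H.

(** Coassociativity of the coaction brings Sinv(m^(2)) and m^(1) together. It is used on the formula
    for t_n, once a second coaction has been applied to m^(0). *)
Lemma Sinv_cancel (m : M) (W : lmodType k) (F : M -> H -> W) :
  (forall b, islin (F^~ b)) -> (forall a, islin (F a)) ->
  tsum (coact m) (fun m0 m1 => tsum (coact m0) (fun a b => F a (Sinv m1 * b))) = F m 1.
Proof.
move=> l1 l2; have lS := islin_Sinv.
rewrite (coact_coassoc m (F := fun a b c => F a (Sinv c * b))) //; last first.
  by move=> a b; apply: islin_comp (l2 a) _; apply: islin_mull; apply/lS/islin_id.
transitivity (tsum (coact m) (fun m0 m1 => counit m1 *: F m0 1)).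
  apply: eq_tsum => m0 m1; rewrite -(lin_tsum _ _ (l2 m0)) Sinv_suml.
  exact: linZ.
exact: (coact_counit_sum m (G := F^~ 1)).
Qed.

End InverseAntipode.

Theorem theorem3p1 (k : comNzRingType) (H : hopfAlgebra k) (Sinv : H -> H)
    (SK : cancel (@antipode k H) Sinv) (SinvK : cancel Sinv (@antipode k H))
    (M : modComod H) (aydM : is_aYD M) (stableM : is_stable M) :
  exists (X : cocyclicModule (CH_mod M)) (C : cyclicModule (cot_mod M))
         (theta : forall n, {linear CH_mod M n -> cot_mod M n}),
    [/\ has_CH_operators Sinv X, has_cot_operators C, is_theta theta
      & cyclic_iso (cyclic_dual X) C theta].
Proof.
have lc m n (f : M \ox hpow H m -> M \ox hpow H n) (lf : islin f) :
    islin (fun z : cot_mod M m => f (cot_val z)).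
  by apply: islin_comp lf _; apply/islin_cot_val/islin_id.
have zP n (z : cot_mod M n) : cot_val z \in cotens_pred coact (@diag_coact k H n).
  by case: z.
pose d n i : {linear cot_mod M n.+1 -> cot_mod M n} :=
  cot_lift (lc _ _ _ (islin_mulM i (@islin_id _ _))) (fun z => mulM_cot i (zP _ z)).
pose s n i : {linear cot_mod M n -> cot_mod M n.+1} :=
  cot_lift (lc _ _ _ (islin_oneM i.+1 (@islin_id _ _))) (fun z => oneM_cot i.+1 (zP _ z)).
pose tau n : {linear cot_mod M n -> cot_mod M n} :=
  cot_lift (lc _ _ _ (islin_rotM (@islin_id _ _))) (fun z => rotM_cot aydM stableM (zP _ z)).
have dE n i z : cot_val (d n i z) = mulM i (cot_val z) by apply: cot_liftE.
have sE n i z : cot_val (s n i z) = oneM i.+1 (cot_val z) by apply: cot_liftE.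
have tauE n z : cot_val (tau n z) = rotM (cot_val z) by apply: cot_liftE.
have tau_iter n m z : cot_val (iter m (tau n) z) = iter m (@rotM _ _ _ n) (cot_val z).
  by elim: m => // m IH; rewrite !iterS tauE IH.
have tau_order n z : iter n.+1 (tau n) z = z.
  by apply: cot_val_inj; rewrite tau_iter rotM_order.
unshelve epose (Y := @cocyclic_of_inner k (cot_mod M) d s tau _ _ _ _ _ _ _ _ _ _ _ tau_order).
- by move=> n i j x ij; apply: cot_val_inj; rewrite !dE mulM_mulM.
- by move=> n i j x ij; apply: cot_val_inj; rewrite !sE oneM_oneM.
- move=> n i [//|j] x ij; apply: cot_val_inj.
  by rewrite dE !sE dE mulM_oneM_lt.
- by move=> n j x jn; apply: cot_val_inj; rewrite dE sE mulM_oneM_eq.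
- by move=> n j x jn; apply: cot_val_inj; rewrite dE sE mulM_oneM_eqS.
- by move=> n i j x ij; apply: cot_val_inj; rewrite dE !sE dE mulM_oneM_gt.
- by move=> n i x ni; apply: cot_val_inj; rewrite dE !tauE dE mulM_rotM.
- by move=> n x; apply: cot_val_inj; rewrite dE !tauE dE mulM0_rotM2.
- by move=> n x; apply: cot_val_inj; rewrite dE !tauE sE mulM0_rotM_one.
- by move=> n i x ni; apply: cot_val_inj; rewrite sE !tauE sE oneM_rotM.
- by move=> n x; apply: cot_val_inj; rewrite sE !tauE sE one1M_rotM.
have fK n : cancel (theta_lin aydM n) (@theta_inv _ _ M n) := thetaK aydM (n := n).
have gK n : cancel (@theta_inv _ _ M n) (theta_lin aydM n) := theta_invK aydM (n := n).
pose X := cocyclic_transport Y fK gK.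
exists X, (cyclic_dual Y), (theta_lin aydM).
have thetaE n (h : seq H) m :
   cot_val (theta_lin aydM n (CH_cls n h m)) = theta_pre (hpure n h *t m).
  exact: theta_linE.
have theta_sum n (I : Type) (r : seq I) (F : I -> CH_mod M n) :
  cot_val (theta_lin aydM n (\sum_(i <- r) F i)) =
  \sum_(i <- r) cot_val (theta_lin aydM n (F i)).
  rewrite linear_sum; apply: (lin_sum _ _ (g := @cot_val _ _ _ _ _ _)).
  exact/islin_cot_val/islin_id.
(* Formulas for the operators of [X] are checked on images under the injective theta, inside the
   full tensor product. *)
have XE n m (e : {linear cot_mod M m -> cot_mod M n}) x y :
   cot_val (theta_lin aydM n y) = cot_val (e (theta_lin aydM m x)) ->
   conj_map fK gK e x = y.
  move=> /cot_val_inj E; apply: (can_inj (@fK _)); rewrite E; exact: map_conj.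
have YsE n i z : (i <= n)%N -> coface Y n i z = s n i z.
  by rewrite /= /outer_coface => ->.
have YdE n i z : (i < n)%N -> codegen Y n i z = d n i.+1 z.
  by rewrite /= /outer_face => ->.
have YlE n z : codegen Y n n z = d n 0 (tau n.+1 z).
  by rewrite /= /outer_face ltnn.
have tauV n z : tau n (cocyc Y n z) = z by apply: (tau_invK tau_order).
have cocycE n (h : seq H) (m : M) : size h = n.+1 -> cocyc X n (CH_cls n h m) =
    \sum_(r <- terms (coact m)) CH_cls n (rcons (behead h) (h`_0 * Sinv r.2)) r.1.
  move=> sh; case: n h sh => [|n] [|x h] // [sh].
    (* In degree 0 the operator of [Y] is an empty iterate, so x Sinv(m^(1)) \ox m^(0) has to be
       shown equal to x \ox m in the balanced tensor product. *)
    case: h sh => // _; apply: XE; congr (cot_val (theta_lin aydM 0 _)).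
    transitivity (tsum (coact m) (fun m0 m1 => CH_cls 0 [:: x * Sinv m1] m0)).
      by rewrite tsum_def.
    transitivity (tsum (coact m) (fun m0 m1 => CH_cls 0 [:: x] (hact (Sinv m1) m0))).
      by apply: eq_tsum => m0 m1; apply: balcls_act.
    transitivity (tsum (coact m) (fun m0 m1 => tsum (coact m0) (fun a b =>
      CH_cls 0 [:: x] (hact (Sinv m1 * b) a)))).
      (* Stability rewrites m^(0) as its own m^(1) m^(0), which supplies the second coaction for
         [Sinv_cancel]. *)
      apply: eq_tsum => m0 m1; rewrite -[in LHS](stableM m0).
      rewrite -(tsum_def _ (fun a b => hact b a)).
      rewrite (lin_tsum _ _ (g := fun a => CH_cls 0 [:: x] (hact (Sinv m1) a))).
        by apply: eq_tsum => a b; rewrite hactM.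
      by apply: islin_balcls; apply: islin_ptensr; apply: islin_hactr; apply: islin_id.
    rewrite (Sinv_cancel SK SinvK m (F := fun a b => CH_cls 0 [:: x] (hact b a))).
    - by rewrite hact1.
    - by move=> b; apply: islin_balcls; apply: islin_ptensr; apply: islin_hactr; apply: islin_id.
    - by move=> a; apply: islin_balcls; apply: islin_ptensr; apply: islin_hactl; apply: islin_id.
  (* In positive degree [tau] is applied to both sides; by [rotM_theta_hpure] it coacts once more on
     m^(0) and brings x Sinv(m^(1)) back to the front. *)
  apply: XE; congr cot_val; apply: (can_inj (tauK tau_order (n := n.+1))); rewrite tauV.
  apply: cot_val_inj; rewrite tauE theta_sum thetaE.
  rewrite (lin_sum _ _ (g := @rotM _ _ _ n.+1)); last exact/islin_rotM/islin_id.
  transitivity (tsum (coact m) (fun m0 m1 => tsum (coact m0) (fun a b =>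
     theta_pre (hpure n.+1 (x * (Sinv m1 * b) :: h) *t a)))).
    rewrite [RHS]tsum_def; apply: eq_bigr => r _; rewrite thetaE rotM_theta_hpure //.
    by apply: eq_tsum => a b; rewrite mulrA.
  rewrite (Sinv_cancel SK SinvK m (F := fun a b =>
    theta_pre (hpure n.+1 (x * b :: h) *t a))) ?mulr1 //.
have cofaceE n (h : seq H) (m : M) i : size h = n.+1 -> (i <= n)%N ->
    coface X n i (CH_cls n h m) = \sum_(p <- terms (comul h`_i))
      CH_cls n.+1 (take i h ++ [:: p.1, p.2 & drop i.+1 h]) m.
  move=> sh ni; apply: XE; rewrite theta_sum YsE // sE thetaE.
  rewrite oneM_theta // tsum_def; apply: eq_bigr => p _; exact: thetaE.
split; last exact: cyclic_dual_transport.
- split=> //.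
  (* The last coface is t d_0, so its formula follows from those for t and d_0. *)
  + move=> n h m sh; rewrite -cocyc_coface0 cofaceE // linear_sum.
    apply: eq_bigr => p _; rewrite cocycE /=; last first.
      by case: h sh => // x h [sh]; rewrite /= drop0 sh.
    by apply: eq_bigr => r _; rewrite take0 drop1.
  + move=> n h m i sh ni; apply: XE.
    rewrite linearZ (linZ _ _ (f := @cot_val _ _ _ _ _ _)); last exact/islin_cot_val/islin_id.
    rewrite thetaE; move: ni; rewrite leq_eqVlt => /predU1P[->|lt_in]; last first.
      by rewrite YdE // dE thetaE mulM_theta.
    (* The last codegeneracy is the composite face, which removes the last entry [c]. *)
    rewrite YlE dE tauE thetaE; case/lastP: h sh => // h c; rewrite size_rcons => -[sh].
    rewrite mulM0_rotM_theta // nth_rcons sh ltnn eqxx.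
    by rewrite -cats1 take_size_cat // drop_oversize ?cats0 // size_cat sh addn1.
- split.
  + move=> n [|i] ni.
      exists (mklin (islin_mulM 0 (@islin_id _ _))).
        by move=> m h sh; rewrite /= mulM_hpure // mulseqE ?sh.
      (* Face 0 of the dual is a codegeneracy after t; the [tau] inside that codegeneracy undoes
         t. *)
      move=> z; rewrite -[face _ _ _ _]/(codegen Y n n (cocyc Y n.+1 z)).
      by rewrite YlE dE tauV.
    exists (mklin (islin_mulM i.+1 (@islin_id _ _))).
      by move=> m h sh; rewrite /= mulM_hpure // mulseqE ?sh.
    move=> z; rewrite -[face _ _ _ _]/(codegen Y n i z).
    by rewrite YdE // dE.
  (* The last face is a rotation followed by merging the first two factors. *)
  + move=> n; exists (mklin (islin_mulM 0 (islin_rotM (@islin_id _ _)))).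
      move=> m h; case/lastP: h => // h c; rewrite size_rcons => -[sh].
      transitivity (mulM 0 (rotM (m *t hpure n.+1 (rcons h c)))); first by [].
      rewrite rotM_hpure // nth_rcons sh ltnn eqxx.
      rewrite (lin_tsum _ _ (g := fun z => mulM 0 z)) // tsum_def.
      apply: eq_bigr => p _; rewrite mulM_hpure /= ?sh //.
      by case: h sh => // x h [sh] /=; rewrite -cats1 take_size_cat.
    move=> z; rewrite -[face _ _ _ _]/(codegen Y n n z).
    by rewrite YlE dE tauE.
  + move=> n i ni; exists (mklin (islin_oneM i.+1 (@islin_id _ _))).
      by move=> m h sh; rewrite /= oneM_hpure // oneseqE ?sh.
    move=> z; rewrite -[degen _ _ _ _]/(coface Y n i z).
    by rewrite YsE // sE.
  + move=> n; exists (mklin (islin_rotM (@islin_id _ _))).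
      move=> m h; case/lastP: h => // h c; rewrite size_rcons => -[sh].
      transitivity (rotM (m *t hpure n (rcons h c))); first by [].
      rewrite rotM_hpure // nth_rcons sh ltnn eqxx tsum_def.
      by rewrite -cats1 take_size_cat.
    (* The cyclic operator of the dual inverts [cocyc Y n], as [tau n] does, so the two agree. *)
    move=> z; apply: etrans (tauE n z); congr cot_val.
    by rewrite -[in RHS](cocyc_invK Y z) tauV.
move=> n h m sh; rewrite thetaE; exact: theta_pre_formula.
Qed.
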